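(* Let $G=(V,E)$ be a graph with pairwise disjoint terminal sets $T_1,\dots,T_m \subseteq V$, let $T = \bigcup_i T_i$, and suppose $\kappa'(T_i) \ge k$ for all $i$. Then there is a polynomial-time algorithm that finds $\Omega\!\left(k/(\log |T| \log m)\right)$ element-disjoint Steiner forests in $G$.
   Context: Vertices not in $T$ are non-terminals. For terminals $u,v$, $\kappa'_G(u,v)$ is the maximum number of $u$-$v$ paths pairwise disjoint in edges and non-terminal vertices (they may share terminals), and $\kappa'(T_i)=\min_{u,v\in T_i}\kappa'_G(u,v)$. A Steiner forest is a subgraph of $G$ that is a forest, contains all terminals, and in which each $T_i$ is contained in a single tree (different $T_i$ may share a tree). Two Steiner forests are element-disjoint if they share no edges and no non-terminal vertices. *)

(* Defs.v *)
From mathcomp Require Import all_boot all_order all_algebra.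
From mathcomp Require Import reals exp.

Set Implicit Arguments.
Unset Strict Implicit.
Unset Printing Implicit Defensive.

Import Order.TTheory GRing.Theory Num.Theory.

(** * Graphs, element-connectivity and Steiner forests *)

(* A simple graph on [V] is a symmetric irreflexive [e : rel V]. *)

Section Graphs.
Variable V : finType.
Implicit Types (e : rel V) (T S : {set V}) (u v : V) (p q : seq V).

Definition edge_set e : {set {set V}} :=
  [set [set z.1; z.2] | z : V * V & e z.1 z.2].

(* The path with vertex sequence [u :: p] is represented by [u] and [p]. *)
Definition upath e u v p := [&& path e u p, last u p == v & uniq (u :: p)].

Definition path_edges u p : seq {set V} :=
  pairmap (fun x y => [set x; y]) u p.

Definition paths_element_disjoint T u p q :=
  [disjoint path_edges u p & path_edges u q] &&
  [disjoint [seq x <- u :: p | x \notin T] & [seq x <- u :: q | x \notin T]].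

(* Simple paths have fewer than [#|V|] edges, hence the bounded sequences.  For
   [u != v] edge-disjoint paths are distinct, so a family of them is a set. *)
Definition element_disjoint_paths e T u v (P : {set #|V|.-bseq V}) :=
  [forall p in P, upath e u v p] &&
  [forall p in P, forall q in P, (p != q) ==> paths_element_disjoint T u p q].

Definition kappa e T u v : nat :=
  \max_(P : {set #|V|.-bseq V} | element_disjoint_paths e T u v P) #|P|.

(* The minimum is over distinct terminals.  Since [kappa e T u v] is at most
   the number of edges when [u != v], taking that number as the neutral element
   only matters when [S] has fewer than two elements (an empty minimum). *)
Definition kappa_set e T S : nat :=
  \big[minn/#|edge_set e|]_(z : V * V | [&& z.1 \in S, z.2 \in S & z.1 != z.2])
     kappa e T z.1 z.2.

Record subgraph := Subgraph { sg_verts : {set V}; sg_adj : rel V }.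
Implicit Types H K : subgraph.

Definition is_subgraph e H : Prop :=
  [/\ symmetric (sg_adj H), subrel (sg_adj H) e &
      forall x y, sg_adj H x y -> (x \in sg_verts H) && (y \in sg_verts H)].

(* In a simple graph seen as a symmetric relation, a duplicate-free cyclic
   sequence is a cycle of the graph when it has at least three vertices. *)
Definition acyclic (f : rel V) : Prop :=
  forall c : seq V, ucycle f c -> size c <= 2.

Definition steiner_forest e m (Ts : 'I_m -> {set V}) H : Prop :=
  [/\ is_subgraph e H,
      acyclic (sg_adj H),
      \bigcup_i Ts i \subset sg_verts H &
      forall i x y, x \in Ts i -> y \in Ts i -> connect (sg_adj H) x y].

Definition element_disjoint T H K : bool :=
  [forall x, forall y, ~~ (sg_adj H x y && sg_adj K x y)] &&
  (sg_verts H :&: sg_verts K \subset T).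

End Graphs.

(** * Polynomial-time algorithms *)

(* The model of computation is the WHILE language on binary trees (N. D. Jones,
   Computability and Complexity from a Programming Perspective).  An expression
   is charged for the size of every value it computes, so that a program
   running within a given cost only ever handles values of that size: sharing
   of subtrees cannot be used to build large values cheaply. *)

Inductive tree := Leaf | Node of tree & tree.

Fixpoint tree_size (t : tree) : nat :=
  if t is Node l r then (tree_size l + tree_size r).+1 else 1.

Definition is_node (t : tree) : bool := if t is Node _ _ then true else false.

Inductive expr :=
  | EVar of nat
  | ELeaf
  | ENode of expr & expr
  | EHead of expr
  | ETail of expr.

Inductive command :=
  | CSkip
  | CAssign of nat & expr
  | CSeq of command & command
  | CIf of expr & command & command
  | CWhile of expr & command.

Definition store := nat -> tree.

Fixpoint eval (s : store) (a : expr) : tree :=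
  match a with
  | EVar x => s x
  | ELeaf => Leaf
  | ENode a1 a2 => Node (eval s a1) (eval s a2)
  | EHead a1 => if eval s a1 is Node l _ then l else Leaf
  | ETail a1 => if eval s a1 is Node _ r then r else Leaf
  end.

Fixpoint eval_cost (s : store) (a : expr) : nat :=
  tree_size (eval s a) +
  match a with
  | EVar _ | ELeaf => 0
  | ENode a1 a2 => eval_cost s a1 + eval_cost s a2
  | EHead a1 | ETail a1 => eval_cost s a1
  end.

Definition update (s : store) (x : nat) (t : tree) : store :=
  fun y => if y == x then t else s y.

(* [exec c s k s']: run from [s], the command [c] halts in [s'] at cost [k]. *)
Inductive exec : command -> store -> nat -> store -> Prop :=
  | ExecSkip s : exec CSkip s 1 s
  | ExecAssign s x a :
      exec (CAssign x a) s (eval_cost s a).+1 (update s x (eval s a))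
  | ExecSeq c1 c2 s1 s2 s3 k1 k2 :
      exec c1 s1 k1 s2 -> exec c2 s2 k2 s3 ->
      exec (CSeq c1 c2) s1 (k1 + k2).+1 s3
  | ExecIf a c1 c2 s s' k :
      exec (if is_node (eval s a) then c1 else c2) s k s' ->
      exec (CIf a c1 c2) s (eval_cost s a + k).+1 s'
  | ExecWhileStop a c s :
      ~~ is_node (eval s a) -> exec (CWhile a c) s (eval_cost s a).+1 s
  | ExecWhileLoop a c s1 s2 s3 k1 k2 :
      is_node (eval s1 a) ->
      exec c s1 k1 s2 -> exec (CWhile a c) s2 k2 s3 ->
      exec (CWhile a c) s1 (eval_cost s1 a + k1 + k2).+1 s3.

(* Input and output are in variable 0; the other variables start at [Leaf]. *)
Definition init_store (t : tree) : store :=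
  fun x => if x == 0 then t else Leaf.

Definition computes_within (c : command) (input output : tree) (b : nat) :=
  exists k s, [/\ exec c (init_store input) k s, s 0 = output & k <= b].

(** ** Encodings: characteristic vectors and adjacency matrices *)

Definition enc_bool (b : bool) : tree := if b then Node Leaf Leaf else Leaf.

Definition enc_seq (s : seq tree) : tree := foldr Node Leaf s.

Definition enc_pred n (A : pred 'I_n) : tree :=
  enc_seq [seq enc_bool (A x) | x <- enum 'I_n].

Definition enc_rel n (e : rel 'I_n) : tree :=
  enc_seq [seq enc_pred (e x) | x <- enum 'I_n].

Definition enc_set n (A : {set 'I_n}) : tree := enc_pred (fun x => x \in A).

Definition enc_instance n (e : rel 'I_n) m (Ts : 'I_m -> {set 'I_n}) : tree :=
  Node (enc_rel e) (enc_seq [seq enc_set (Ts i) | i <- enum 'I_m]).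

Definition enc_subgraph n (H : subgraph 'I_n) : tree :=
  Node (enc_set (sg_verts H)) (enc_rel (sg_adj H)).

Definition enc_family n r (F : 'I_r -> subgraph 'I_n) : tree :=
  enc_seq [seq enc_subgraph (F i) | i <- enum 'I_r].

(** * Asymptotics *)

(* Under an Omega the logarithm is bounded below by 1, so that the bound keeps
   its meaning for the arguments 0, 1 and 2. *)
Definition log1 (R : realType) (n : nat) : R := Num.max 1%R (ln n%:R)%R.
Arguments log1 : clear implicits.

(* Main.v *)
Require Import Defs.
From Stdlib Require Import FunctionalExtensionality.
From mathcomp Require Import all_boot all_order all_algebra.
From mathcomp Require Import reals exp.
From mathcomp Require Import zify ring lra.

(** The graph is subdivided, so that the elements are the non-terminal nodes
   (white nodes, the terminals being black), and element-connectivity [k] of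
   the terminal sets says that every set of white nodes separating two terminals
   of a common set has size at least [k].  Edges between white nodes are deleted
   or contracted keeping this property, which leaves a bipartite graph.  In it a
   union [W] of terminal sets is sought whose internal white nodes form a
   hypergraph with all cuts of size at least [q0 = k / (log m + 1)]: as long as
   there is a smaller cut, pass to the side with fewer terminal sets; this halves
   their number and adds at most [q0] to the boundary, so no terminal set is ever
   split.  The white nodes of [W] are coloured so that many colour classes connect
   [W], each such class is added to one of the forests, and [W] is contracted to a
   single terminal; a terminal that is alone in its set is eliminated.

   The colouring is the usual random one, derandomised by local search: for a
   colour class [A] let [U_t(A)] be the minimum over the partitions of [W] of the
   total number of blocks touched by the elements of [A] plus [t] times the number
   of merged blocks ([strength]).  A local maximum of the sum over the classes of
   [sum_t 4^(q-t) U_t(A)], where [q] is of order [log |T|], has few disconnected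
   classes.  [U_t] is computed greedily by minimum cuts. *)

Set Implicit Arguments.
Unset Strict Implicit.
Unset Printing Implicit Defensive.

(** * Polynomial-time functions *)

(** A class [A] connects [W] exactly when [U_1(A)] has its largest possible value |A| + |W| - 1. The
    level 1 alone yields no usable condition of local optimality: the optimal partitions before and
    after a move may cross, and uncrossing them costs one level on either side. Moving an element
    gains at least the number of blocks it touches in a level-t optimum of its new class, and loses
    at most the number it touches in a level-(t+2) optimum of its old one. Hence the hierarchy of
    levels. With weights 4^(q-t) the shift by two costs a factor 16 and two terms at the top, which
    are negligible once 4^q exceeds a multiple of |W|. At level t an optimum has up to t surplus
    touches per block, so the cuts must have size of order r q for r classes; this is where log |T|
    is lost, while log m is lost in the search for [W]. Terminals may be shared by all forests, so
    merging [W] or eliminating a terminal costs nothing. Only white nodes are used up, and the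
    internal ones of [W] serve no other terminals. *)

Class codable (A : Type) := code : A -> tree.

Instance code_tree : codable tree := id.
Instance code_unit : codable unit := fun _ => Leaf.
Instance code_bool : codable bool := enc_bool.
(** Unary, so that a computable number has polynomially bounded value ([pbnd_nat]) and a loop
    bounded by a number is a fold over a list. The price is that exponentials such as 4 ^ q must be
    truncated. *)
Instance code_nat : codable nat := fun n => enc_seq (nseq n Leaf).
Instance code_prod A B (cA : codable A) (cB : codable B) : codable (A * B) :=
  fun p => Node (code p.1) (code p.2).
Instance code_seq A (cA : codable A) : codable (seq A) :=
  fun s => enc_seq (map code s).

Definition sz A {cA : codable A} (x : A) := tree_size (code x).

Lemma tree_size_gt0 t : 0 < tree_size t.
Proof. by case: t. Qed.

Lemma sz_gt0 A (cA : codable A) (x : A) : 0 < sz x.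
Proof. exact: tree_size_gt0. Qed.

Section PolynomialBounds.
Variables (A : Type) (cA : codable A).
Implicit Types F G : A -> nat.

(** The base is at least 2, because sizes are positive; coefficients and additive constants can
    therefore be absorbed into the exponent. *)
Definition pbnd F := exists d, forall x, F x <= (sz x).+1 ^ d.

Lemma pbnd_le F G : (forall x, F x <= G x) -> pbnd G -> pbnd F.
Proof. by move=> le [d H]; exists d => x; apply: leq_trans (le x) (H x). Qed.

Lemma pbnd_const n : pbnd (fun=> n).
Proof.
exists n => x; apply: leq_trans (ltnW (ltn_expl n (isT : 1 < 2))) _.
by case: n => // n; rewrite leq_exp2r // ltnS; apply: sz_gt0.
Qed.

Lemma pbnd_sz : pbnd (fun x => sz x).
Proof. by exists 1 => x; rewrite expn1. Qed.

Lemma pbnd_add F G : pbnd F -> pbnd G -> pbnd (fun x => F x + G x).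
Proof.
move=> [a Ha] [b Hb]; exists (maxn a b).+1 => x.
have s1 : 1 < (sz x).+1 by rewrite ltnS sz_gt0.
apply: leq_trans (leq_add (Ha x) (Hb x)) _; rewrite expnS.
apply: (@leq_trans (2 * (sz x).+1 ^ maxn a b)); last by rewrite leq_mul2r s1 orbT.
by rewrite mul2n -addnn leq_add // leq_exp2l // ?leq_maxl ?leq_maxr.
Qed.

Lemma pbnd_mul F G : pbnd F -> pbnd G -> pbnd (fun x => F x * G x).
Proof.
move=> [a Ha] [b Hb]; exists (a + b) => x.
by rewrite expnD leq_mul.
Qed.

Lemma pbnd_S F : pbnd F -> pbnd (fun x => (F x).+1).
Proof.
move=> pF; apply: (@pbnd_le _ (fun x => 1 + F x)) => //.
by apply: pbnd_add pF; apply: pbnd_const.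
Qed.

End PolynomialBounds.
Arguments pbnd {A cA}.

Lemma pbnd_comp A B (cA : codable A) (cB : codable B) (F : B -> nat) (g : A -> B) :
  pbnd F -> pbnd (fun x => sz (g x)) -> pbnd (fun x => F (g x)).
Proof.
move=> [a Ha] [b Hb]; exists (b.+1 * a) => x.
apply: leq_trans (Ha _) _; rewrite expnM.
have s1 : 1 < (sz x).+1 by rewrite ltnS sz_gt0.
case: a {Ha} => // a; rewrite leq_exp2r // expnS.
have := Hb x; have : 0 < (sz x).+1 ^ b by rewrite expn_gt0.
by nia.
Qed.

Create HintDb pbnd.
#[export] Hint Resolve pbnd_const pbnd_sz pbnd_add pbnd_mul pbnd_S : pbnd.

(** * Execution rules and program combinators *)

Definition run c s (Q : store -> nat -> Prop) :=
  exists k s', exec c s k s' /\ Q s' k.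

Lemma run_mono c s (Q Q' : store -> nat -> Prop) :
  (forall s' k, Q s' k -> Q' s' k) -> run c s Q -> run c s Q'.
Proof. by move=> H [k [s' [E /H ?]]]; exists k, s'. Qed.

Lemma run_assign x a s (Q : store -> nat -> Prop) :
  Q (update s x (eval s a)) (eval_cost s a).+1 -> run (CAssign x a) s Q.
Proof. by move=> H; exists (eval_cost s a).+1, (update s x (eval s a)); split=> //; constructor. Qed.

Lemma run_seq c1 c2 s (Q : store -> nat -> Prop) :
  run c1 s (fun s1 k1 => run c2 s1 (fun s2 k2 => Q s2 (k1 + k2).+1)) ->
  run (CSeq c1 c2) s Q.
Proof.
move=> [k1 [s1 [E1 [k2 [s2 [E2 H]]]]]]; exists (k1 + k2).+1, s2.
by split=> //; apply: ExecSeq E1 E2.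
Qed.

Lemma run_if a c1 c2 s (Q : store -> nat -> Prop) :
  run (if is_node (eval s a) then c1 else c2) s (fun s' k => Q s' (eval_cost s a + k).+1) ->
  run (CIf a c1 c2) s Q.
Proof.
by move=> [k [s' [E H]]]; exists (eval_cost s a + k).+1, s'; split=> //; constructor.
Qed.

Lemma run_while_stop a c s (Q : store -> nat -> Prop) :
  ~~ is_node (eval s a) -> Q s (eval_cost s a).+1 -> run (CWhile a c) s Q.
Proof. by move=> H HQ; exists (eval_cost s a).+1, s; split=> //; constructor. Qed.

Lemma run_while_loop a c s (Q : store -> nat -> Prop) :
  is_node (eval s a) ->
  run c s (fun s1 k1 => run (CWhile a c) s1
             (fun s2 k2 => Q s2 (eval_cost s a + k1 + k2).+1)) ->
  run (CWhile a c) s Q.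
Proof.
move=> H [k1 [s1 [E1 [k2 [s2 [E2 HQ]]]]]].
exists (eval_cost s a + k1 + k2).+1, s2; split=> //.
exact: ExecWhileLoop H E1 E2.
Qed.

(* The program reads and writes variable 0, may use any variable below [b]
   as scratch space and leaves the others alone. *)
Definition PT A B {cA : codable A} {cB : codable B} (f : A -> B) : Prop :=
  exists c b K, [/\ pbnd K, pbnd (fun x => sz (f x)) & forall s x, s 0 = code x ->
    run c s (fun s' k => [/\ s' 0 = code (f x), forall y, b <= y -> s' y = s y & k <= K x])].

Section Combinators.
Variables (A B C : Type) (cA : codable A) (cB : codable B) (cC : codable C).

Lemma PT_sz (f : A -> B) : PT f -> pbnd (fun x => sz (f x)).
Proof. by case=> c [b [K []]]. Qed.

(** [PT] sees a result only through its code, so even the type of the result may change as long as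
    the codes agree. The destructors of pairs, lists and numbers are obtained from [hdt] and [tlt]
    in this way. *)
Lemma PT_recode (f : A -> B) (g : A -> C) :
  (forall x, code (f x) = code (g x)) -> PT f -> PT g.
Proof.
move=> E [c [b [K [HK Hs H]]]]; exists c, b, K; split=> //.
  by apply: pbnd_le Hs => x; rewrite /sz E.
by move=> s x /H; apply: run_mono => s' k; rewrite E.
Qed.

Lemma PT_ext (f g : A -> B) : (forall x, f x = g x) -> PT f -> PT g.
Proof.
move=> E [c [b [K [HK Hs H]]]]; exists c, b, K; split=> //.
  by apply: pbnd_le Hs => x; rewrite E.
by move=> s x /H; apply: run_mono => s' k; rewrite E.
Qed.

Lemma PT_id : PT (fun x : A => x).
Proof.
exists CSkip, 1, (fun=> 1); split; [exact: pbnd_const|exact: pbnd_sz|].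
by move=> s x E; exists 1, s; split; [constructor|].
Qed.

Fixpoint tree_expr t := if t is Node l r then ENode (tree_expr l) (tree_expr r) else ELeaf.

Lemma eval_tree_expr s t : eval s (tree_expr t) = t.
Proof. by elim: t => //= l -> r ->. Qed.

Lemma eval_cost_tree_expr s s' t : eval_cost s (tree_expr t) = eval_cost s' (tree_expr t).
Proof. by elim: t => //= l -> r ->; rewrite !eval_tree_expr. Qed.

Lemma PT_const (y : B) : PT (fun _ : A => y).
Proof.
pose s0 : store := fun=> Leaf.
exists (CAssign 0 (tree_expr (code y))), 1, (fun=> (eval_cost s0 (tree_expr (code y))).+1).
split; [exact: pbnd_const|exact: pbnd_const|] => s x E.
apply: run_assign; rewrite eval_tree_expr /update /=; split=> //.
  by case.
by rewrite (eval_cost_tree_expr s0 s).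
Qed.

Lemma PT_comp (f : A -> B) (g : B -> C) : PT f -> PT g -> PT (fun x => g (f x)).
Proof.
move=> [c1 [b1 [K1 [HK1 S1 H1]]]] [c2 [b2 [K2 [HK2 S2 H2]]]].
exists (CSeq c1 c2), (maxn b1 b2), (fun x => (K1 x + K2 (f x)).+1); split.
- by apply: pbnd_S; apply: pbnd_add => //; apply: pbnd_comp.
- exact: (pbnd_comp S2 S1).
move=> s x E; apply: run_seq; apply: run_mono (H1 _ _ E) => s1 k1 [E1 F1 L1].
apply: run_mono (H2 _ _ E1) => s2 k2 [E2 F2 L2]; split=> //.
  by move=> y; rewrite geq_max => /andP[? ?]; rewrite F2 // F1.
by rewrite ltnS leq_add.
Qed.

Lemma PT_pair (f : A -> B) (g : A -> C) : PT f -> PT g -> PT (fun x => (f x, g x)).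
Proof.
move=> [c1 [b1 [K1 [HK1 S1 H1]]]] [c2 [b2 [K2 [HK2 S2 H2]]]].
pose b := (maxn b1 b2).+1.
have [bb1 bb2] : b1 <= b /\ b2 <= b by rewrite /b; lia.
(* The scratch variables of both programs lie below [b], so the copy of the input in [b] and the
   first result in [b.+1] survive. *)
exists (CSeq (CAssign b (EVar 0)) (CSeq c1 (CSeq (CAssign b.+1 (EVar 0))
  (CSeq (CAssign 0 (EVar b)) (CSeq c2 (CAssign 0 (ENode (EVar b.+1) (EVar 0)))))))), b.+2,
  (fun x => K1 x + K2 x + sz x + sz x + sz (f x) + sz (f x) + sz (f x) + sz (g x) + sz (g x) + 20).
split.
- by auto 20 with pbnd.
- apply: (@pbnd_le _ _ _ (fun x => (sz (f x) + sz (g x)).+1)) => [x|]; first by [].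
  by auto with pbnd.
move=> s x E; apply: run_seq; apply: run_assign; rewrite /= E.
set s0 := update _ _ _.
have E0 : s0 0 = code x by rewrite /s0 /update /= E.
apply: run_seq; apply: run_mono (H1 _ _ E0) => s1 k1 [E1 F1 L1].
apply: run_seq; apply: run_assign; rewrite /= E1; set s2 := update _ _ _.
apply: run_seq; apply: run_assign => /=.
have -> : s2 b = code x.
  by rewrite /s2 /update ltn_eqF // F1 // /s0 /update eqxx.
set s3 := update _ _ _.
have E3 : s3 0 = code x by [].
apply: run_seq; apply: run_mono (H2 _ _ E3) => s4 k2 [E4 F4 L2].
apply: run_assign => /=; rewrite E4 F4; last by lia.
have -> : s3 b.+1 = code (f x) by rewrite /s3 /update /= /s2 /update eqxx.
split=> //.
  move=> y by_; rewrite /update; case: eqP => [|_]; first by lia.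
  rewrite F4; last by lia.
  rewrite /s3 /update; case: eqP => [|_]; first by lia.
  rewrite /s2 /update; case: eqP => [|_]; first by lia.
  rewrite F1; last by lia.
  by rewrite /s0 /update; case: eqP => [|_]; first by lia.
by rewrite /sz /=; lia.
Qed.

Lemma PT_if (b : A -> bool) (f g : A -> B) :
  PT b -> PT f -> PT g -> PT (fun x => if b x then f x else g x).
Proof.
move=> [c0 [b0 [K0 [HK0 S0 H0]]]] [c1 [b1 [K1 [HK1 S1 H1]]]] [c2 [b2 [K2 [HK2 S2 H2]]]].
pose v := (maxn b0 (maxn b1 b2)).+1.
exists (CSeq (CAssign v (EVar 0)) (CSeq c0 (CSeq (CAssign v.+1 (EVar 0))
  (CSeq (CAssign 0 (EVar v)) (CIf (EVar v.+1) c1 c2))))), v.+2,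
  (fun x => K0 x + K1 x + K2 x + sz x + sz x + sz (b x) + sz (b x) + 20).
split.
- by auto 20 with pbnd.
- apply: (@pbnd_le _ _ _ (fun x => sz (f x) + sz (g x))) => [x|].
    by case: (b x); rewrite ?leq_addr ?leq_addl.
  by auto with pbnd.
move=> s x E; apply: run_seq; apply: run_assign; rewrite /= E.
set s0 := update _ _ _.
have E0 : s0 0 = code x by rewrite /s0 /update /= E.
apply: run_seq; apply: run_mono (H0 _ _ E0) => s1 k1 [E1 F1 L1].
apply: run_seq; apply: run_assign; rewrite /= E1; set s2 := update _ _ _.
apply: run_seq; apply: run_assign => /=.
have -> : s2 v = code x.
  by rewrite /s2 /update ltn_eqF // F1 ?/s0 /update ?eqxx //; rewrite /v; lia.
set s3 := update _ _ _.
have E3 : s3 0 = code x by [].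
apply: run_if => /=.
have -> : s3 v.+1 = code (b x) by rewrite /s3 /update /= /s2 /update eqxx.
have F3 y : v.+2 <= y -> s3 y = s y.
  move=> by_; rewrite /s3 /update; case: eqP => [|_]; first by lia.
  rewrite /s2 /update; case: eqP => [|_]; first by lia.
  rewrite F1; last by lia.
  by rewrite /s0 /update; case: eqP => [|_]; first by lia.
have -> : is_node (code (b x)) = b x by case: (b x).
case Eb: (b x).
  apply: run_mono (H1 _ _ E3) => s4 k4 [E4 F4 L4]; split=> //.
    by move=> y yv; rewrite F4 ?F3 //; lia.
  by rewrite /sz; lia.
apply: run_mono (H2 _ _ E3) => s4 k4 [E4 F4 L4]; split=> //.
  by move=> y yv; rewrite F4 ?F3 //; lia.
by rewrite /sz; lia.
Qed.

End Combinators.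

Section TreePrimitives.

Definition hdt t := if t is Node l _ then l else Leaf.
Definition tlt t := if t is Node _ r then r else Leaf.

Lemma PT_hdt : PT hdt.
Proof.
exists (CAssign 0 (EHead (EVar 0))), 1, (fun x => sz x + sz x + 1); split.
- by auto with pbnd.
- apply: pbnd_le (pbnd_sz _) => -[//|l r]; rewrite /sz /code /code_tree /=; lia.
move=> s x; rewrite /code /code_tree => E; apply: run_assign => /=; rewrite E; split=> //.
  by case.
by rewrite /sz /code /code_tree; case: x {E} => //= l r; lia.
Qed.

Lemma PT_tlt : PT tlt.
Proof.
exists (CAssign 0 (ETail (EVar 0))), 1, (fun x => sz x + sz x + 1); split.
- by auto with pbnd.
- apply: pbnd_le (pbnd_sz _) => -[//|l r]; rewrite /sz /code /code_tree /=; lia.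
move=> s x; rewrite /code /code_tree => E; apply: run_assign => /=; rewrite E; split=> //.
  by case.
by rewrite /sz /code /code_tree; case: x {E} => //= l r; lia.
Qed.

Lemma PT_is_node : PT is_node.
Proof.
exists (CIf (EVar 0) (CAssign 0 (ENode ELeaf ELeaf)) (CAssign 0 ELeaf)), 1,
  (fun x => sz x + 20); split.
- by auto with pbnd.
- by apply: (@pbnd_le _ _ _ (fun=> 3)) (pbnd_const _ _) => -[].
move=> s x; rewrite /code /code_tree => E; apply: run_if => /=; rewrite E.
by case: x E => [|l r] E; apply: run_assign => /=; split=> //; first [by case|rewrite /sz /code /code_tree /=; lia].
Qed.

End TreePrimitives.

(** * Bounded recursion on lists *)

Section Fold.
Variables (X Y Z : Type) (cX : codable X) (cY : codable Y) (cZ : codable Z).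
Variables (F : X -> Z -> Y -> Z) (a : X -> Z) (l : X -> seq Y) (B : X -> nat).

Lemma sz_cons (y : Y) (t : seq Y) : sz (y :: t) = (sz y + sz t).+1.
Proof. by []. Qed.

Lemma sz_pair (x : X) (y : Y) : sz (x, y) = (sz x + sz y).+1.
Proof. by []. Qed.

Lemma sz_drop (t : seq Y) i : sz (drop i t) <= sz t.
Proof. by elim: t i => [|y t IH] [|i] //=; rewrite sz_cons; have := IH i; lia. Qed.

Lemma sz_mem_nth d (t : seq Y) i : i < size t -> sz (nth d t i) <= sz t.
Proof.
elim: t i => [|y t IH] [|i] //= il; rewrite sz_cons; first by lia.
by have := IH i il; lia.
Qed.

Lemma size_le_sz (t : seq Y) : size t < sz t.
Proof. by elim: t => //= y t IH; rewrite sz_cons; have := sz_gt0 cY y; lia. Qed.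

(** A polynomial-time step may double its accumulator at each turn, hence the bound [B] on the
    accumulator after every prefix of the list: with it each call of the step has an argument of
    polynomial size. *)
Lemma PT_foldl :
  PT (fun p : X * (Z * Y) => F p.1 p.2.1 p.2.2) -> PT a -> PT l ->
  pbnd B -> (forall x i, sz (foldl (F x) (a x) (take i (l x))) <= B x) ->
  PT (fun x => foldl (F x) (a x) (l x)).
Proof.
move=> [c1 [b1 [K1 [HK1 S1 H1]]]] [c2 [b2 [K2 [HK2 S2 H2]]]] [c3 [b3 [K3 [HK3 S3 H3]]]] HB hB.
pose v := (maxn b1 (maxn b2 b3)).+1.
have [d Hd] := HK1.
(* [M] dominates the sizes of all the arguments [(x, (z, y))] met in the loop, so that [KF] bounds
   the cost of each call. The variable [v] holds the input, [v.+1] the rest of the list and [v.+2]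
   the accumulator. *)
pose M : X -> nat := fun x => @sz X cX x + B x + @sz (seq Y) (code_seq cY) (l x) + 10.
pose M20 : X -> nat := fun x => 20 * M x.
pose KF : X -> nat := fun x => (M x).+1 ^ d.
pose body := CSeq (CAssign 0 (ENode (EVar v) (ENode (EVar v.+2) (EHead (EVar v.+1)))))
  (CSeq c1 (CSeq (CAssign v.+2 (EVar 0)) (CAssign v.+1 (ETail (EVar v.+1))))).
exists (CSeq (CAssign v (EVar 0)) (CSeq c3 (CSeq (CAssign v.+1 (EVar 0))
  (CSeq (CAssign 0 (EVar v)) (CSeq c2 (CSeq (CAssign v.+2 (EVar 0))
  (CSeq (CWhile (EVar v.+1) body) (CAssign 0 (EVar v.+2))))))))), v.+3,
  (fun x => K2 x + K3 x + sz (l x) * (KF x + M20 x) + M20 x).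
have HM : pbnd M by rewrite /M; auto with pbnd.
have HM20 : pbnd M20 by rewrite /M20; auto with pbnd.
have HKF : pbnd KF.
  rewrite /KF; elim: (d) => [|d' IH]; first exact: pbnd_const.
  apply: (@pbnd_le _ _ _ (fun x => (M x).+1 * (M x).+1 ^ d')) => [x|]; first by rewrite expnS.
  by auto with pbnd.
split.
- by auto 10 with pbnd.
- apply: pbnd_le HB => x; have := hB x (size (l x)); rewrite take_size; exact.
move=> s x E; apply: run_seq; apply: run_assign; rewrite /= E; set s0 := update _ _ _.
have E0 : s0 0 = code x by rewrite /s0 /update /= E.
apply: run_seq; apply: run_mono (H3 _ _ E0) => s1 k1 [E1 F1 L1].
apply: run_seq; apply: run_assign; rewrite /= E1; set s2 := update _ _ _.
apply: run_seq; apply: run_assign => /=.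
have E2 : s2 v = code x.
  by rewrite /s2 /update ltn_eqF // F1 ?/s0 /update ?eqxx //; rewrite /v; lia.
rewrite E2; set s3 := update _ _ _.
have E3 : s3 0 = code x by [].
apply: run_seq; apply: run_mono (H2 _ _ E3) => s4 k4 [E4 F4 L4].
apply: run_seq; apply: run_assign; rewrite /= E4; set s5 := update _ _ _.
apply: run_seq.
have loop (n : nat) : forall s, n <= size (l x) -> s v = code x ->
    s v.+1 = code (drop (size (l x) - n) (l x)) ->
    s v.+2 = code (foldl (F x) (a x) (take (size (l x) - n) (l x))) ->
    run (CWhile (EVar v.+1) body) s (fun s' k =>
      [/\ s' v.+2 = code (foldl (F x) (a x) (l x)), forall y, v.+3 <= y -> s' y = s y
        & k <= n * (KF x + M20 x) + M x]).
  elim: n => [|n IH] s' nl e1 e2 e3.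
    rewrite subn0 drop_size in e2; rewrite subn0 take_size in e3.
    by apply: run_while_stop; rewrite /= e2 //; split=> //=; rewrite /M; lia.
  set i := size (l x) - n.+1 in e2 e3.
  have il : i < size (l x) by rewrite /i; lia.
  case El: (l x) il => [//|y0 l0]; rewrite -El => il.
  pose y := nth y0 (l x) i.
  rewrite (drop_nth y0 il) -/y in e2.
  have szy : sz y <= sz (l x) by apply: sz_mem_nth.
  have szt : sz (y :: drop i.+1 (l x)) <= sz (l x).
    by rewrite -(drop_nth y0 il); apply: sz_drop.
  have szt' : sz (drop i.+1 (l x)) <= sz (l x) by apply: sz_drop.
  have szz := hB x i.
  apply: run_while_loop; first by rewrite /= e2.
  apply: run_seq; apply: run_assign; rewrite /= e1 e2 e3 /=; set s6 := update _ _ _.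
  pose z := foldl (F x) (a x) (take i (l x)).
  have E6 : s6 0 = code (x, (z, y)) by [].
  have Kb : K1 (x, (z, y)) <= KF x.
    apply: leq_trans (Hd _) _; rewrite /KF; case: (d) => // d'; rewrite leq_exp2r //.
    by move: szz szy; rewrite /M -/z !/(sz (_, _)) /=; rewrite /sz; lia.
  apply: run_seq; apply: run_mono (H1 _ _ E6) => s7 k7 [E7 F7 L7].
  apply: run_seq; apply: run_assign; rewrite /= E7; set s8 := update _ _ _.
  apply: run_assign => /=.
  have -> : s8 v.+1 = code (y :: drop i.+1 (l x)).
    by rewrite /s8 /update ltn_eqF // F7 ?/s6 /update //=; rewrite /v; lia.
  set s9 := update _ _ _.
  have iE : size (l x) - n = i.+1 by rewrite /i; lia.
  have szz1 := hB x i.+1.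
  apply: run_mono (IH s9 _ _ _ _).
  - move=> s10 k10 [E10 F10 L10]; split=> //.
      move=> w wv; rewrite F10 // /s9 /update; case: eqP => [|_]; first by lia.
      rewrite /s8 /update; case: eqP => [|_]; first by lia.
      rewrite F7; last by rewrite /v in wv; lia.
      by rewrite /s6 /update; case: eqP => [|_]; first by lia.
    have f1 : sz (F x z y) <= B x.
      by move: szz1; rewrite (take_nth y0 il) -cats1 foldl_cat.
    move: L7 L10 Kb szy szt szt' szz f1; rewrite [n.+1 * _]mulSn -/z.
    move: (n * (KF x + M20 x)) (KF x) => PP KFx; rewrite sz_cons /M20 /M /sz.
    set t1 := enc_seq _; have -> : t1 = code (drop i.+1 (l x)) by [].
    set m20 := 20 * _; move: (n * (KFx + m20)) => nk; rewrite {}/m20 /=.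
    set t2 := enc_seq _; have -> : t2 = code (drop i.+1 (l x)) by [].
    by clear; lia.
  - by lia.
  - rewrite /s9 /update; case: eqP => [|_]; first by lia.
    rewrite /s8 /update; case: eqP => [|_]; first by lia.
    rewrite F7; last by rewrite /v; lia.
    by rewrite /s6 /update; case: eqP => [|_]; first by lia.
  - by rewrite /s9 /update eqxx iE.
  - rewrite /s9 /update; case: eqP => [|_]; first by lia.
    by rewrite /s8 /update eqxx iE (take_nth y0 il) -cats1 foldl_cat.
have e1 : s5 v = code x.
  rewrite /s5 /update; case: eqP => [|_]; first by lia.
  rewrite F4; last by rewrite /v; lia.
  by rewrite /s3 /update /= E2.
have e2 : s5 v.+1 = code (l x).
  rewrite /s5 /update; case: eqP => [|_]; first by lia.
  rewrite F4; last by rewrite /v; lia.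
  by rewrite /s3 /update /= /s2 /update eqxx.
have e3 : s5 v.+2 = code (a x) by rewrite /s5 /update eqxx.
apply: run_mono (loop (size (l x)) s5 _ _ _ _); rewrite ?subnn ?drop0 ?take0 //.
move=> s11 k11 [E11 F11 L11]; apply: run_assign; rewrite /= E11; split=> //.
  move=> w wv; rewrite /update; case: eqP => [|_]; first by lia.
  rewrite F11 // /s5 /update; case: eqP => [|_]; first by lia.
  rewrite F4; last by rewrite /v in wv; lia.
  rewrite /s3 /update; case: eqP => [|_]; first by lia.
  rewrite /s2 /update; case: eqP => [|_]; first by lia.
  rewrite F1; last by rewrite /v in wv; lia.
  by rewrite /s0 /update; case: eqP => [|_]; first by lia.
have := hB x (size (l x)); rewrite take_size; have := hB x 0; rewrite take0 /=.
have := size_le_sz (l x).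
have : size (l x) * (KF x + M20 x) <= sz (l x) * (KF x + M20 x).
  by rewrite leq_mul2r (ltnW (size_le_sz _)) orbT.
move: L1 L4 L11; set p1 := size (l x) * _; set p2 := sz (l x) * _.
by move: p1 p2 => p1 p2; rewrite /M20 /M /sz; lia.
Qed.

End Fold.

(** * A library of polynomial-time list functions *)

Ltac pt_base := lazymatch goal with
  | |- PT (fun x => x) => exact (PT_id _)
  | |- PT (fun _ => ?c) => exact (PT_const _ _ c)
  | |- PT (fun x => (@?f x, @?g x)) => refine (PT_pair _ _)
  end.
(** Hooks that are redefined as closure lemmas become available; [pt] decomposes a goal by the head
    symbol of the function body. *)
Ltac pt_ext := fail.
Ltac pt_list := fail.
Ltac pt_user := fail.
Ltac pt_eta := lazymatch goal with
  | |- PT (fun _ => _) => fail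
  | |- PT ?f => change (PT (fun x => f x))
  end.
Ltac pt_asm := match goal with
  | H : ?T |- ?T => exact H
  | H : PT ?f |- PT (fun x => ?f x) => exact H
  | H : PT ?f |- PT (fun x => ?f (@?g x)) => refine (PT_comp _ H)
  end.
Ltac pt := cbv zeta; solve [repeat (cbv beta; first [pt_asm | pt_base | pt_user | pt_list | pt_ext | pt_eta | refine (PT_if _ _ _)])].

Lemma p_app1 X (cX : codable X) Y Z (cY : codable Y) (cZ : codable Z) (f : Y -> Z) (g : X -> Y) :
  PT f -> PT g -> PT (fun x => f (g x)).
Proof. by move=> Hf Hg; apply: PT_comp Hg Hf. Qed.

Lemma p_app2 X (cX : codable X) Y Z U (cY : codable Y) (cZ : codable Z) (cU : codable U)
    (f : Y -> Z -> U) (g : X -> Y) (h : X -> Z) :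
  PT (fun p : Y * Z => f p.1 p.2) -> PT g -> PT h -> PT (fun x => f (g x) (h x)).
Proof. by move=> Hf Hg Hh; apply: PT_comp (PT_pair Hg Hh) Hf. Qed.

Lemma p_app3 X (cX : codable X) Y Z U V (cY : codable Y) (cZ : codable Z) (cU : codable U) (cV : codable V)
    (f : Y -> Z -> U -> V) (g : X -> Y) (h : X -> Z) (k : X -> U) :
  PT (fun p : Y * (Z * U) => f p.1 p.2.1 p.2.2) -> PT g -> PT h -> PT k ->
  PT (fun x => f (g x) (h x) (k x)).
Proof. by move=> Hf Hg Hh Hk; apply: PT_comp (PT_pair Hg (PT_pair Hh Hk)) Hf. Qed.

Lemma PT_code X (cX : codable X) Y (cY : codable Y) (f : X -> Y) : PT f -> PT (fun x => code (f x)).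
Proof. exact: PT_recode. Qed.

Lemma p_fst X (cX : codable X) Y Z (cY : codable Y) (cZ : codable Z) (f : X -> Y * Z) :
  PT f -> PT (fun x => (f x).1).
Proof.
move=> Hf; apply: (@PT_recode _ _ _ _ _ _ (fun x => hdt (code (f x)))) => //.
exact: p_app1 PT_hdt (PT_code Hf).
Qed.

Lemma p_snd X (cX : codable X) Y Z (cY : codable Y) (cZ : codable Z) (f : X -> Y * Z) :
  PT f -> PT (fun x => (f x).2).
Proof.
move=> Hf; apply: (@PT_recode _ _ _ _ _ _ (fun x => tlt (code (f x)))) => //.
exact: p_app1 PT_tlt (PT_code Hf).
Qed.

Lemma p_negb X (cX : codable X) (f : X -> bool) : PT f -> PT (fun x => ~~ f x).
Proof.
move=> Hf; apply: (@PT_ext _ _ _ _ (fun x => if f x then false else true)).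
  by move=> x; case: (f x).
by pt.
Qed.

Lemma p_andb X (cX : codable X) (f g : X -> bool) : PT f -> PT g -> PT (fun x => f x && g x).
Proof. by move=> Hf Hg; apply: (@PT_ext _ _ _ _ (fun x => if f x then g x else false)) => //; pt. Qed.

Lemma p_orb X (cX : codable X) (f g : X -> bool) : PT f -> PT g -> PT (fun x => f x || g x).
Proof. by move=> Hf Hg; apply: (@PT_ext _ _ _ _ (fun x => if f x then true else g x)) => //; pt. Qed.

Lemma p_implyb X (cX : codable X) (f g : X -> bool) : PT f -> PT g -> PT (fun x => f x ==> g x).
Proof. by move=> Hf Hg; apply: (@PT_ext _ _ _ _ (fun x => if f x then g x else true)) => //; pt. Qed.

Lemma p_cons X (cX : codable X) Y (cY : codable Y) (f : X -> Y) (g : X -> seq Y) :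
  PT f -> PT g -> PT (fun x => f x :: g x).
Proof. by move=> Hf Hg; apply: PT_recode (PT_pair Hf Hg). Qed.

Lemma p_nilp X (cX : codable X) Y (cY : codable Y) (f : X -> seq Y) : PT f -> PT (fun x => nilp (f x)).
Proof.
move=> Hf; apply: (@PT_ext _ _ _ _ (fun x => ~~ is_node (code (f x)))).
  by move=> x; case: (f x).
exact: p_negb (p_app1 PT_is_node (PT_code Hf)).
Qed.

Lemma p_behead X (cX : codable X) Y (cY : codable Y) (f : X -> seq Y) : PT f -> PT (fun x => behead (f x)).
Proof.
move=> Hf; apply: (@PT_recode _ _ _ _ _ _ (fun x => tlt (code (f x)))).
  by move=> x; case: (f x).
exact: p_app1 PT_tlt (PT_code Hf).
Qed.

Lemma p_head X (cX : codable X) Y (cY : codable Y) (d : X -> Y) (f : X -> seq Y) :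
  PT d -> PT f -> PT (fun x => head (d x) (f x)).
Proof.
move=> Hd Hf.
apply: (@PT_recode _ _ _ _ _ _ (fun x => if nilp (f x) then code (d x) else hdt (code (f x)))).
  by move=> x; case: (f x).
apply: PT_if; [exact: p_nilp|exact: PT_code|].
exact: p_app1 PT_hdt (PT_code Hf).
Qed.

Lemma p_S X (cX : codable X) (f : X -> nat) : PT f -> PT (fun x => (f x).+1).
Proof. by move=> Hf; apply: PT_recode (PT_pair (PT_const _ _ tt) Hf). Qed.

Lemma p_pred X (cX : codable X) (f : X -> nat) : PT f -> PT (fun x => (f x).-1).
Proof.
move=> Hf; apply: (@PT_recode _ _ _ _ _ _ (fun x => tlt (code (f x)))).
  by move=> x; case: (f x).
exact: p_app1 PT_tlt (PT_code Hf).
Qed.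

Lemma sz_nat n : sz n = n.*2.+1.
Proof. by rewrite /sz /code /code_nat; elim: n => //= n ->; rewrite doubleS; lia. Qed.

Lemma sz_bool (b : bool) : sz b <= 3.
Proof. by case: b. Qed.

Lemma pbnd_nat X (cX : codable X) (f : X -> nat) : PT f -> pbnd f.
Proof. by move/PT_sz; apply: pbnd_le => x; rewrite sz_nat; lia. Qed.

(** A number and a list of that many units have the same code, so an iteration is a fold over such a
    list. *)
Lemma p_iter X (cX : codable X) Z (cZ : codable Z) (F : X -> Z -> Z) (a : X -> Z) (n : X -> nat) (B : X -> nat) :
  PT (fun p : X * Z => F p.1 p.2) -> PT a -> PT n -> pbnd B ->
  (forall x i, i <= n x -> sz (iter i (F x) (a x)) <= B x) ->
  PT (fun x => iter (n x) (F x) (a x)).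
Proof.
move=> HF Ha Hn HB hB.
have E i z x : foldl (fun z (_ : unit) => F x z) z (nseq i tt) = iter i (F x) z.
  by elim: i z => //= i IH z; rewrite IH -iterS iterSr.
apply: (@PT_ext _ _ _ _ (fun x => foldl (fun z (_ : unit) => F x z) (a x) (nseq (n x) tt))).
  by move=> x; rewrite E.
apply: (PT_foldl (B := B)) => //.
- exact: (p_app2 HF (p_fst (PT_id _)) (p_fst (p_snd (PT_id _)))).
- apply: PT_recode Hn => x; rewrite /code /code_seq /code_nat.
  by congr enc_seq; elim: (n x) => //= k ->.
move=> x i; have -> : take i (nseq (n x) tt) = nseq (minn i (n x)) tt.
  by elim: (n x) i => [|k IH] [|i] //=; rewrite ?minn0 // IH minnSS.
by rewrite E hB // geq_minr.
Qed.

Lemma p_addn X (cX : codable X) (f g : X -> nat) : PT f -> PT g -> PT (fun x => f x + g x).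
Proof.
move=> Hf Hg; apply: (@PT_ext _ _ _ _ (fun x => iter (g x) succn (f x))).
  by move=> x; elim: (g x) => [|k /= ->]; rewrite ?addn0 ?addnS.
apply: (p_iter (B := fun x => 2 * (f x + g x) + 1)) => //; first by apply: p_S; apply: p_snd; pt.
  by have := pbnd_nat Hf; have := pbnd_nat Hg; auto with pbnd.
by move=> x i ix; rewrite iter_succn sz_nat; lia.
Qed.

Lemma p_subn X (cX : codable X) (f g : X -> nat) : PT f -> PT g -> PT (fun x => f x - g x).
Proof.
have E i y : iter i predn y = y - i by elim: i => [|i /= ->]; rewrite ?subn0 ?subnS.
move=> Hf Hg; apply: (@PT_ext _ _ _ _ (fun x => iter (g x) predn (f x))) => //.
apply: (p_iter (B := fun x => sz (f x))) => //; first by apply: p_pred; apply: p_snd; pt.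
  exact: PT_sz.
by move=> x i ix; rewrite E !sz_nat; lia.
Qed.

Lemma p_eq0 X (cX : codable X) (f : X -> nat) : PT f -> PT (fun x => f x == 0).
Proof.
move=> Hf; apply: (@PT_ext _ _ _ _ (fun x => ~~ is_node (code (f x)))).
  by move=> x; case: (f x).
exact: p_negb (p_app1 PT_is_node (PT_code Hf)).
Qed.

Lemma p_leq X (cX : codable X) (f g : X -> nat) : PT f -> PT g -> PT (fun x => f x <= g x).
Proof. by move=> Hf Hg; apply: p_eq0; apply: p_subn. Qed.

Lemma p_eqn X (cX : codable X) (f g : X -> nat) : PT f -> PT g -> PT (fun x => f x == g x).
Proof.
move=> Hf Hg; apply: (@PT_ext _ _ _ _ (fun x => (f x <= g x) && (g x <= f x))).
  by move=> x; rewrite eqn_leq.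
by apply: p_andb; apply: p_leq.
Qed.

Lemma p_minn X (cX : codable X) (f g : X -> nat) : PT f -> PT g -> PT (fun x => minn (f x) (g x)).
Proof. by move=> Hf Hg; apply: PT_if => //; apply: p_leq => //; apply: p_S. Qed.

Ltac pt_ext ::= lazymatch goal with
  | |- PT (fun x => (@?f x).1) => refine (p_fst _)
  | |- PT (fun x => (@?f x).2) => refine (p_snd _)
  | |- PT (fun x => ~~ (@?f x)) => refine (p_negb _)
  | |- PT (fun x => (@?f x) && (@?g x)) => refine (p_andb _ _)
  | |- PT (fun x => (@?f x) || (@?g x)) => refine (p_orb _ _)
  | |- PT (fun x => (@?f x) ==> (@?g x)) => refine (p_implyb _ _)
  | |- PT (fun x => (@?f x) :: (@?g x)) => refine (p_cons _ _)
  | |- PT (fun x => nilp (@?f x)) => refine (p_nilp _)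
  | |- PT (fun x => behead (@?f x)) => refine (p_behead _)
  | |- PT (fun x => head (@?d x) (@?f x)) => refine (p_head _ _)
  | |- PT (fun x => (@?f x).+1) => refine (p_S _)
  | |- PT (fun x => (@?f x).-1) => refine (p_pred _)
  | |- PT (fun x => (@?f x) + (@?g x)) => refine (p_addn _ _)
  | |- PT (fun x => (@?f x) - (@?g x)) => refine (p_subn _ _)
  | |- PT (fun x => (@?f x) <= (@?g x)) => refine (p_leq _ _)
  | |- PT (fun x => (@?f x) == (@?g x)) => refine (p_eqn _ _)
  | |- PT (fun x => minn (@?f x) (@?g x)) => refine (p_minn _ _)
  end.

Lemma p_muln X (cX : codable X) (f g : X -> nat) : PT f -> PT g -> PT (fun x => f x * g x).
Proof.
have E i m : iter i (addn m) 0 = m * i by elim: i => [|i /= ->]; rewrite ?muln0 ?mulnS.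
move=> Hf Hg; apply: (@PT_ext _ _ _ _ (fun x => iter (g x) (addn (f x)) 0)) => [x|]; first exact: E.
apply: (p_iter (B := fun x => 2 * (f x * g x) + 1)) => //.
- by apply: p_addn; [apply: p_app1 Hf _|]; pt.
- by pt.
- by have := pbnd_nat Hf; have := pbnd_nat Hg; auto with pbnd.
by move=> x i ix; rewrite E sz_nat; nia.
Qed.

Lemma sz_catrev Y (cY : codable Y) (s t : seq Y) : sz (catrev s t) + 1 = sz s + sz t.
Proof. by elim: s t => [|y s IH] t /=; rewrite ?IH ?sz_cons //; rewrite /sz /=; lia. Qed.

Lemma sz_nil Y (cY : codable Y) : sz (@nil Y) = 1.
Proof. by []. Qed.

Lemma sz_take Y (cY : codable Y) (s : seq Y) i : sz (take i s) <= sz s.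
Proof.
by elim: s i => [|y s IH] [|i] //=; rewrite !sz_cons; have := IH i; lia.
Qed.

Lemma p_rev X (cX : codable X) Y (cY : codable Y) (l : X -> seq Y) : PT l -> PT (fun x => rev (l x)).
Proof.
have E (s t : seq Y) : foldl (fun acc y => y :: acc) t s = catrev s t.
  by elim: s t => //= y s IH t; rewrite IH.
move=> Hl; apply: (@PT_ext _ _ _ _ (fun x => foldl (fun acc y => y :: acc) [::] (l x))).
  by move=> x; rewrite E.
apply: (PT_foldl (B := fun x => sz (l x))) => //; [by pt|by pt|exact: PT_sz|].
move=> x i; rewrite E; have := sz_catrev cY (take i (l x)) [::]; have := sz_take cY (l x) i.
by rewrite sz_nil; lia.
Qed.

(** Turns a bound depending on the pair [(x, y)] into one that is uniform over the entries [y] of a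
    list, as the accumulator bounds of folds require. *)
Lemma pbnd_mem X Y Z (cX : codable X) (cY : codable Y) (cZ : codable Z) (l : X -> seq Y) (Hl : PT l) (f : X -> Y -> Z) : PT (fun p : X * Y => f p.1 p.2) ->
  exists2 B, pbnd B & forall x y, sz y <= sz (l x) -> sz (f x y) <= B x.
Proof.
move=> /PT_sz[d Hd]; exists (fun x => (sz x + sz (l x)).+2 ^ d) => [|x y le].
  elim: d {Hd} => [|d IH]; first exact: pbnd_const.
  apply: (@pbnd_le _ _ _ (fun x => (sz x + sz (l x)).+2 * (sz x + sz (l x)).+2 ^ d)) => [x|].
    by rewrite expnS.
  by have := PT_sz Hl; auto with pbnd.
apply: leq_trans (Hd (x, y)) _; case: (d) => // d'; rewrite leq_exp2r // sz_pair; lia.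
Qed.

Lemma p_map X Y Z (cX : codable X) (cY : codable Y) (cZ : codable Z) (l : X -> seq Y) (Hl : PT l) (f : X -> Y -> Z) : PT (fun p : X * Y => f p.1 p.2) -> PT (fun x => map (f x) (l x)).
Proof.
move=> Hf; have [B HB hB] := pbnd_mem Hl Hf.
have E x s t : foldl (fun acc y => f x y :: acc) t s = catrev (map (f x) s) t.
  by elim: s t => //= y s IH t; rewrite IH.
apply: (@PT_ext _ _ _ _ (fun x => rev (foldl (fun acc y => f x y :: acc) [::] (l x)))).
  by move=> x; rewrite E -/(rev _) revK.
apply: p_rev; apply: (PT_foldl (B := fun x => sz (l x) * (B x).+1 + 1)) => //.
- by apply: p_cons; [apply: p_app2 Hf _ _|]; pt.
- by pt.
- by have := PT_sz Hl; auto with pbnd.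
move=> x i; rewrite E; have := sz_catrev cZ (map (f x) (take i (l x))) [::].
have H s : sz s <= sz (l x) -> sz (map (f x) s) <= size s * (B x).+1 + 1.
  elim: s => [|y s IH] //=; rewrite !sz_cons mulSn => le.
  by have := hB x y; have := IH; lia.
have le1 := sz_take cY (l x) i.
have := H _ le1; have : size (take i (l x)) <= sz (l x).
  by have := size_le_sz cY (l x); rewrite size_take; case: ifP; lia.
rewrite sz_nil; nia.
Qed.

Lemma p_filter X Y (cX : codable X) (cY : codable Y) (l : X -> seq Y) (Hl : PT l) (p : X -> Y -> bool) :
  PT (fun q : X * Y => p q.1 q.2) -> PT (fun x => filter (p x) (l x)).
Proof.
move=> Hp.
have E x s t : foldl (fun acc y => if p x y then y :: acc else acc) t s = catrev (filter (p x) s) t.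
  by elim: s t => //= y s IH t; rewrite IH; case: (p x y).
apply: (@PT_ext _ _ _ _ (fun x => rev (foldl (fun acc y => if p x y then y :: acc else acc) [::] (l x)))).
  by move=> x; rewrite E -/(rev _) revK.
apply: p_rev; apply: (PT_foldl (B := fun x => sz (l x))) => //.
- by apply: PT_if; [apply: p_app2 Hp _ _| |]; pt.
- by pt.
- exact: PT_sz.
move=> x i; rewrite E; have := sz_catrev cY (filter (p x) (take i (l x))) [::].
have : sz (filter (p x) (take i (l x))) <= sz (l x).
  elim: (l x) i => [|y s IH] [|i] //=.
  by have := IH i; rewrite sz_cons; case: (p x y); rewrite ?sz_cons; lia.
rewrite sz_nil; lia.
Qed.

Lemma p_all X Y (cX : codable X) (cY : codable Y) (l : X -> seq Y) (Hl : PT l) (p : X -> Y -> bool) :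
  PT (fun q : X * Y => p q.1 q.2) -> PT (fun x => all (p x) (l x)).
Proof.
move=> Hp.
have E x s b : foldl (fun b y => b && p x y) b s = b && all (p x) s.
  by elim: s b => [|y s IH] b /=; rewrite ?andbT // IH andbA.
apply: (@PT_ext _ _ _ _ (fun x => foldl (fun b y => b && p x y) true (l x))) => [x|].
  by rewrite E.
apply: (PT_foldl (B := fun x => 3)) => //; try exact: pbnd_const.
- by apply: p_andb; [|apply: p_app2 Hp _ _]; pt.
- by pt.
by move=> x i; apply: sz_bool.
Qed.

Lemma p_has X Y (cX : codable X) (cY : codable Y) (l : X -> seq Y) (Hl : PT l) (p : X -> Y -> bool) :
  PT (fun q : X * Y => p q.1 q.2) -> PT (fun x => has (p x) (l x)).
Proof.
move=> Hp; apply: (@PT_ext _ _ _ _ (fun x => ~~ all (fun y => ~~ p x y) (l x))).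
  by move=> x; rewrite -has_predC; apply: eq_has => y /=; rewrite negbK.
by apply: p_negb; apply: (p_all Hl); apply: p_negb.
Qed.

Lemma p_count X Y (cX : codable X) (cY : codable Y) (l : X -> seq Y) (Hl : PT l) (p : X -> Y -> bool) :
  PT (fun q : X * Y => p q.1 q.2) -> PT (fun x => count (p x) (l x)).
Proof.
move=> Hp.
have E x s n : foldl (fun n y => if p x y then n.+1 else n) n s = n + count (p x) s.
  by elim: s n => [|y s IH] n /=; rewrite ?addn0 // IH; case: (p x y); lia.
apply: (@PT_ext _ _ _ _ (fun x => foldl (fun n y => if p x y then n.+1 else n) 0 (l x))) => [x|].
  by rewrite E.
apply: (PT_foldl (B := fun x => 2 * sz (l x) + 1)) => //.
- by apply: PT_if; [apply: p_app2 Hp _ _| |]; pt.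
- by pt.
- by have := PT_sz Hl; auto with pbnd.
move=> x i; rewrite E sz_nat; have := count_size (p x) (take i (l x)).
by have := size_le_sz cY (l x); rewrite size_take; case: ifP; lia.
Qed.

Lemma p_find X Y (cX : codable X) (cY : codable Y) (l : X -> seq Y) (Hl : PT l) (p : X -> Y -> bool) :
  PT (fun q : X * Y => p q.1 q.2) -> PT (fun x => find (p x) (l x)).
Proof.
move=> Hp.
pose g x (a : bool * nat) y := if a.1 then a else if p x y then (true, a.2) else (false, a.2.+1).
have E0 x s (a : bool * nat) : a.1 -> foldl (g x) a s = a.
  by elim: s a => //= y s IH a a1; rewrite IH // /g a1.
have E x s n : foldl (g x) (false, n) s = (has (p x) s, n + find (p x) s).
  elim: s n => [|y s IH] n /=; rewrite ?addn0 // /g /=; case: (p x y).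
    by rewrite E0 // addn0.
  by rewrite IH addnS.
apply: (@PT_ext _ _ _ _ (fun x => (foldl (g x) (false, 0) (l x)).2)) => [x|].
  by rewrite E.
apply: p_snd; apply: (PT_foldl (B := fun x => 2 * sz (l x) + 10)) => //.
- by rewrite /g; apply: PT_if; [|  |apply: PT_if; [apply: p_app2 Hp _ _| |]]; pt.
- by pt.
- by have := PT_sz Hl; auto with pbnd.
move=> x i; rewrite E sz_pair sz_nat; have := find_size (p x) (take i (l x)).
have := sz_bool (has (p x) (take i (l x))).
by have := size_le_sz cY (l x); rewrite size_take; case: ifP; lia.
Qed.

Lemma p_size X Y (cX : codable X) (cY : codable Y) (l : X -> seq Y) (Hl : PT l) : PT (fun x => size (l x)).
Proof.
apply: (@PT_ext _ _ _ _ (fun x => count (fun _ => true) (l x))) => [x|].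
  by elim: (l x) => //= y s ->.
by apply: (p_count Hl); pt.
Qed.

Lemma p_drop X Y (cX : codable X) (cY : codable Y) (l : X -> seq Y) (Hl : PT l) (i : X -> nat) : PT i -> PT (fun x => drop (i x) (l x)).
Proof.
move=> Hi; apply: (@PT_ext _ _ _ _ (fun x => iter (i x) behead (l x))) => [x|].
  by elim: (i x) (l x) => [|k IH] s /=; rewrite ?drop0 // IH -drop1 drop_drop add1n.
apply: (p_iter (B := fun x => sz (l x))) => //; [by pt|exact: PT_sz|].
move=> x k _; elim: k => //= k; case: (iter _ _ _) => //= y s; rewrite sz_cons; lia.
Qed.

Lemma p_nth X Y (cX : codable X) (cY : codable Y) (l : X -> seq Y) (d : X -> Y) (i : X -> nat) :
  PT d -> PT l -> PT i -> PT (fun x => nth (d x) (l x) (i x)).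
Proof.
move=> Hd Hl Hi; apply: (@PT_ext _ _ _ _ (fun x => head (d x) (drop (i x) (l x)))) => [x|].
  by rewrite -nth0 nth_drop addn0.
by apply: p_head => //; apply: (p_drop Hl).
Qed.

Lemma p_cat X Y (cX : codable X) (cY : codable Y) (l : X -> seq Y) (Hl : PT l) (m : X -> seq Y) : PT m -> PT (fun x => l x ++ m x).
Proof.
move=> Hm.
have E (s t : seq Y) : foldl (fun acc y => y :: acc) t s = catrev s t.
  by elim: s t => //= y s IH t; rewrite IH.
apply: (@PT_ext _ _ _ _ (fun x => foldl (fun acc y => y :: acc) (m x) (rev (l x)))) => [x|].
  by rewrite E catrevE revK.
have Hr := p_rev Hl.
apply: (PT_foldl (B := fun x => sz (rev (l x)) + sz (m x))) => //; [by pt| |].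
  by have := PT_sz Hr; have := PT_sz Hm; auto with pbnd.
move=> x i; rewrite E; have := sz_catrev cY (take i (rev (l x))) (m x).
have := sz_take cY (rev (l x)) i.
lia.
Qed.

Lemma sz_seq_le Y (cY : codable Y) (s : seq Y) b :
  (forall i d, i < size s -> sz (nth d s i) <= b) -> sz s <= size s * b.+1 + 1.
Proof.
elim: s => [|y s IH] H //.
rewrite sz_cons /= mulSn; have := H 0 y isT; have := IH (fun i d => H i.+1 d); rewrite /=; lia.
Qed.

Lemma p_iota X (cX : codable X) (n : X -> nat) : PT n -> PT (fun x => iota 0 (n x)).
Proof.
move=> Hn.
have E i : iter i (fun s => size s :: s) [::] = rev (iota 0 i).
  by elim: i => // i IH; rewrite iterS IH size_rev size_iota -[in RHS]addn1 iotaD rev_cat.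
apply: (@PT_ext _ _ _ _ (fun x => rev (iter (n x) (fun s => size s :: s) [::]))) => [x|].
  by rewrite E revK.
apply: p_rev; apply: (p_iter (B := fun x => n x * (2 * n x).+2 + 1)) => //.
- by apply: p_cons; [apply: p_size; pt|pt].
- by pt.
- by have := pbnd_nat Hn; auto 10 with pbnd.
move=> x i ix; rewrite E; apply: leq_trans (@sz_seq_le _ _ _ (2 * n x).+1 _) _.
  move=> j d; rewrite size_rev size_iota => ji; rewrite nth_rev size_iota // nth_iota ?sz_nat; lia.
by rewrite size_rev size_iota; nia.
Qed.

Ltac pt_list ::= lazymatch goal with
  | |- PT (fun x => (@?f x) * (@?g x)) => refine (p_muln _ _)
  | |- PT (fun x => rev (@?l x)) => refine (p_rev _)
  | |- PT (fun x => map (@?f x) (@?l x)) => refine (p_map _ _)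
  | |- PT (fun x => filter (@?f x) (@?l x)) => refine (p_filter _ _)
  | |- PT (fun x => all (@?f x) (@?l x)) => refine (p_all _ _)
  | |- PT (fun x => has (@?f x) (@?l x)) => refine (p_has _ _)
  | |- PT (fun x => count (@?f x) (@?l x)) => refine (p_count _ _)
  | |- PT (fun x => find (@?f x) (@?l x)) => refine (p_find _ _)
  | |- PT (fun x => size (@?l x)) => refine (p_size _)
  | |- PT (fun x => drop (@?i x) (@?l x)) => refine (p_drop _ _)
  | |- PT (fun x => nth (@?d x) (@?l x) (@?i x)) => refine (p_nth _ _ _)
  | |- PT (fun x => (@?l x) ++ (@?m x)) => refine (p_cat _ _)
  | |- PT (fun x => iota 0 (@?n x)) => refine (p_iota _)
  end.

Section Matrices.
Variable (T : Type).

Definition mkrow n (f : nat -> T) := [seq f i | i <- iota 0 n].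
Definition mkmx m n (f : nat -> nat -> T) := [seq [seq f i j | j <- iota 0 n] | i <- iota 0 m].
Definition get d (M : seq (seq T)) i j := nth d (nth [::] M i) j.

Lemma nth_mkrow d n f i : i < n -> nth d (mkrow n f) i = f i.
Proof. by move=> ni; rewrite (nth_map 0) ?size_iota // nth_iota. Qed.

Lemma get_mkmx d m n f i j : i < m -> j < n -> get d (mkmx m n f) i j = f i j.
Proof.
move=> im jn; rewrite /get (nth_map 0) ?size_iota // nth_iota //=.
by rewrite (nth_map 0) ?size_iota // nth_iota.
Qed.
End Matrices.

Section MatricesPT.
Variables (X : Type) (cX : codable X) (T : Type) (cT : codable T).

Lemma p_mkrow (n : X -> nat) (f : X -> nat -> T) :
  PT n -> PT (fun p : X * nat => f p.1 p.2) -> PT (fun x => mkrow (n x) (f x)).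
Proof. by move=> Hn Hf; apply: (p_map (p_iota Hn)). Qed.

Lemma p_mkmx (m n : X -> nat) (f : X -> nat -> nat -> T) :
  PT m -> PT n -> PT (fun p : X * nat * nat => f p.1.1 p.1.2 p.2) -> PT (fun x => mkmx (m x) (n x) (f x)).
Proof.
move=> Hm Hn Hf; apply: (p_map (p_iota Hm)).
by apply: (p_map (p_iota (p_app1 Hn (p_fst (PT_id _))))).
Qed.

Lemma p_get d (M : X -> seq (seq T)) (i j : X -> nat) :
  PT M -> PT i -> PT j -> PT (fun x => get d (M x) (i x) (j x)).
Proof. by move=> HM Hi Hj; apply: p_nth => //; [exact: PT_const|apply: p_nth => //; exact: PT_const]. Qed.

End MatricesPT.

Lemma sz_mkrow T (cT : codable T) n (f : nat -> T) b : (forall i, i < n -> sz (f i) <= b) ->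
  sz (mkrow n f) <= n * b.+1 + 1.
Proof.
move=> H; apply: leq_trans (@sz_seq_le _ _ _ b _) _; rewrite size_map size_iota //.
by move=> i d ni; rewrite nth_mkrow // H.
Qed.

Lemma sz_mkmx T (cT : codable T) m n (f : nat -> nat -> T) b :
  (forall i j, i < m -> j < n -> sz (f i j) <= b) ->
  sz (mkmx m n f) <= m * (n * b.+1 + 2) + 1.
Proof.
move=> H; have := @sz_mkrow (seq T) _ m (fun i => mkrow n (f i)) (n * b.+1 + 1).
by rewrite -addnS; apply => i im; apply: sz_mkrow => j jn; apply: H.
Qed.

Ltac pt_mx := lazymatch goal with
  | |- PT (fun x => mkrow (@?n x) (@?f x)) => refine (p_mkrow _ _)
  | |- PT (fun x => mkmx (@?m x) (@?n x) (@?f x)) => refine (p_mkmx _ _ _)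
  | |- PT (fun x => get ?d (@?M x) (@?i x) (@?j x)) => refine (p_get _ _ _ _)
  end.
Ltac pt_user ::= pt_mx.

(** * Minimum cuts *)

Definition cut N (c : nat -> nat -> nat) (S : nat -> bool) :=
  \sum_(u < N | S u) \sum_(v < N | ~~ S v) c u v.

(** A failing [find] returns the length [N] of the range, which is also the mark of an unreached
    node. *)
Definition bfs_step N (c : seq (seq nat)) (par : seq nat) :=
  mkrow N (fun v => if nth N par v < N then nth N par v else
    find (fun u => (nth N par u < N) && (0 < get 0 c u v)) (iota 0 N)).

(* Parent pointers of a breadth-first search tree; [N] marks an unreached node. *)
Definition bfs N c s := iter N (bfs_step N c) (mkrow N (fun v => if v == s then s else N)).

Definition bfs_path N (par : seq nat) s t :=
  iter N (fun l => if head s l == s then l else nth N par (head s l) :: l) [:: t].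

Definition path_arc (l : seq nat) a b :=
  count (fun i => (nth 0 l i == a) && (nth 0 l i.+1 == b)) (iota 0 (size l).-1).

Definition augment N s t (c : seq (seq nat)) :=
  let par := bfs N c s in
  let l := bfs_path N par s t in
  mkmx N N (fun a b => if nth N par t < N
    then get 0 c a b - path_arc l a b + path_arc l b a else get 0 c a b).

(** Unit augmentations on residual capacities, followed by the set of nodes still reachable. No flow
    is represented, neither here nor in the correctness proof. *)
Definition mincut N (c : seq (seq nat)) s t fuel :=
  let par := bfs N (iter fuel (augment N s t) c) s in mkrow N (fun v => nth N par v < N).

Section Cut.
Variable N : nat.
Implicit Types (c f g : nat -> nat -> nat) (S : nat -> bool).

Lemma eq_cut f g S : (forall a b, a < N -> b < N -> f a b = g a b) -> cut N f S = cut N g S.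
Proof. by move=> E; apply: eq_bigr => u _; apply: eq_bigr => v _; apply: E. Qed.

Lemma cutD f g S : cut N (fun a b => f a b + g a b) S = cut N f S + cut N g S.
Proof. by rewrite /cut -big_split; apply: eq_bigr => u _; rewrite -big_split. Qed.

Lemma cut_arc s v S : s < N -> v < N ->
  cut N (fun a b => (a == s) && (b == v)) S = S s && ~~ S v.
Proof.
move=> sN vN; rewrite /cut; case Ss: (S s) => /=; last first.
  apply: big1 => u Su; apply: big1 => w _; case: eqP => //= E.
  by rewrite E Ss in Su.
rewrite (bigD1 (Ordinal sN)) //= [X in _ + X]big1 => [|u /andP[_ us]]; last first.
  apply: big1 => w _; case: eqP => //= E; case/negP: us; exact/eqP/val_inj.
rewrite addn0; case Sv: (S v) => /=.
  by apply: big1 => w Sw; rewrite ?eqxx /=; case: eqP => //= E; rewrite E Sv in Sw.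
rewrite (bigD1 (Ordinal vN)) ?Sv //= big1 ?eqxx // => w /andP[_ wv].
by rewrite ?eqxx /=; case: eqP => //= E; case/negP: wv; apply/eqP/val_inj.
Qed.

Fixpoint arcs (s : nat) (p : seq nat) (a b : nat) : nat :=
  if p is v :: p' then ((a == s) && (b == v)) + arcs v p' a b else 0.

Lemma path_arcE s p a b : path_arc (s :: p) a b = arcs s p a b.
Proof.
rewrite /path_arc /=; elim: p s => //= v p IH s.
rewrite -IH; congr (_ + _); first by rewrite !(eq_sym a) !(eq_sym b).
by rewrite -(addn0 1) iotaDl count_map; apply: eq_count => i.
Qed.

(** A walk leaves and enters [S] equally often, up to the difference made by its two ends. *)
Lemma cut_arcs S s p : s < N -> all (fun v => v < N) p ->
  cut N (arcs s p) S + S (last s p) = cut N (fun a b => arcs s p b a) S + S s.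
Proof.
elim: p s => [|v p IH] s sN /=; first by rewrite /cut !big1.
case/andP=> vN pN; rewrite !cutD cut_arc //.
have -> : cut N (fun a b => (b == s) && (a == v)) S = S v && ~~ S s.
  by rewrite -cut_arc //; apply: eq_cut => a b _ _; rewrite andbC.
have := IH v vN pN; case: (S s); case: (S v); case: (S (last v p)) => /=; lia.
Qed.

Lemma arcs_notin s p a b : a \notin s :: p -> arcs s p a b = 0.
Proof.
elim: p s => //= v p IH s; rewrite !inE !negb_or => /and3P[/negPf-> av ap] /=.
by apply: IH; rewrite inE negb_or av.
Qed.

Lemma arcs_le1 s p a b : uniq (s :: p) -> arcs s p a b <= 1.
Proof.
elim: p s => //= v p IH s /and3P[snp vnp pu]; case: (a =P s) => [->|_] /=.
  by rewrite arcs_notin // addn0; case: eqP.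
by rewrite IH //= vnp.
Qed.

Lemma arcs_gt0 c s p a b : path (fun a b => 0 < c a b) s p -> 0 < arcs s p a b -> 0 < c a b.
Proof.
elim: p s => //= v p IH s /andP[cv pp].
case: (a =P s) => [as_|_]; case: (b =P v) => [bv|_] /=; try by rewrite add0n; apply: (IH _ pp).
by rewrite as_ bv.
Qed.

(** This takes the place of flow conservation and duality: a unit augmentation lowers the capacity
    of every cut between the two ends by exactly one, so the comparison between such cuts never
    changes. *)
Lemma cut_augment c S s p : s < N -> all (fun v => v < N) p -> uniq (s :: p) ->
  path (fun a b => 0 < c a b) s p -> S s -> ~~ S (last s p) ->
  (cut N (fun a b => c a b - arcs s p a b + arcs s p b a) S).+1 = cut N c S.
Proof.
move=> sN pN pu pp Ss St.
have le a b : arcs s p a b <= c a b.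
  have := arcs_le1 a b pu; have := arcs_gt0 (a := a) (b := b) pp; lia.
have E : cut N c S = cut N (fun a b => c a b - arcs s p a b) S + cut N (arcs s p) S.
  by rewrite -cutD; apply: eq_cut => a b _ _; rewrite subnK.
rewrite E cutD; have := cut_arcs S sN pN; rewrite Ss (negPf St); lia.
Qed.

End Cut.

Section Bfs.
Variables (N : nat) (c : seq (seq nat)) (s : nat).
Hypothesis sN : s < N.

Let pos := (fun a b => 0 < get 0 c a b).
Let reached par v := nth N par v < N.

Lemma bfs_stepE par v : v < N -> nth N (bfs_step N c par) v =
  if reached par v then nth N par v else find (fun u => reached par u && pos u v) (iota 0 N).
Proof. by move=> vN; rewrite /bfs_step nth_mkrow. Qed.

(** [rk] records the round in which a node was reached. It is not computed by the search; its strict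
    decrease along parent pointers shows that they lead back to [s] without repetition. *)
Definition bfs_inv i (par : seq nat) (rk : nat -> nat) :=
  [/\ nth N par s = s, rk s = 0 &
   forall v, v < N -> reached par v -> rk v <= i /\
     (v != s -> [/\ reached par (nth N par v), pos (nth N par v) v & rk (nth N par v) < rk v])].

Lemma bfs_invP i : exists rk, bfs_inv i
  (iter i (bfs_step N c) (mkrow N (fun v => if v == s then s else N))) rk.
Proof.
elim: i => [|i [rk [E0 rs H]]] /=.
  exists (fun=> 0); split; rewrite ?nth_mkrow ?eqxx // => v vN.
  by rewrite /reached nth_mkrow //; case: eqP => //; rewrite ltnn.
set par := iter _ _ _ in E0 H *.
have rs' : reached par s by rewrite /reached E0.
exists (fun v => if reached par v then rk v else i.+1).
split; rewrite ?bfs_stepE // ?rs' // => v vN.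
have -> : reached (bfs_step N c par) v = ((if reached par v then nth N par v else
    find (fun u => reached par u && pos u v) (iota 0 N)) < N) by rewrite /reached bfs_stepE.
case rv: (reached par v) => fN.
  have [le H2] := H v vN rv; split=> [|vs]; first exact: leq_trans le _.
  have [r1 p1 l1] := H2 vs; rewrite bfs_stepE ?vN // rv; split=> //.
    by rewrite /reached bfs_stepE // r1.
  by rewrite r1.
split=> // vs; rewrite bfs_stepE // rv.
have hN : has (fun u => reached par u && pos u v) (iota 0 N) by rewrite has_find size_iota.
have := nth_find 0 hN; set u := find _ _ in fN *; rewrite nth_iota // add0n => /andP[ru pu].
split=> //; first by rewrite /reached bfs_stepE // ru.
by rewrite ru ltnS; have [] := H u fN ru.
Qed.

(** A round that changes anything reaches a new node. So after [i] rounds either the process is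
    stationary or more than [i] nodes are reached, and the latter is impossible for [i = N]. *)
Lemma bfs_stable : bfs_step N c (bfs N c s) = bfs N c s.
Proof.
pose p0 := mkrow N (fun v => if v == s then s else N).
pose R i v := reached (iter i (bfs_step N c) p0) v.
have mono i v : v < N -> R i v -> R i.+1 v.
  by rewrite /R /= /reached => vN r; rewrite bfs_stepE // /reached r.
suff key i : bfs_step N c (iter i (bfs_step N c) p0) = iter i (bfs_step N c) p0 \/
    i < count (R i) (iota 0 N).
  have [//|h] := key N.
  by have := count_size (R N) (iota 0 N); rewrite size_iota; lia.
elim: i => [|i [IH|IH]] /=.
- right; rewrite -has_count; apply/hasP; exists s; first by rewrite mem_iota.
  by rewrite /R /reached nth_mkrow // eqxx.
- by left; rewrite IH.
case: (bfs_step N c (iter i (bfs_step N c) p0) =P iter i (bfs_step N c) p0) => [e|ne]; first by left; rewrite e.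
right; apply: leq_ltn_trans IH _.
have [v vN [nr r]] : exists2 v, v < N & ~~ R i v /\ R i.+1 v.
  have sz0 : size (iter i (bfs_step N c) p0) = N by case: (i) => [|k] /=; rewrite size_map size_iota.
  have /hasP[v] : has (fun v => ~~ R i v && R i.+1 v) (iota 0 N).
    apply/negPn/negP => /hasPn h; apply: ne; apply: (@eq_from_nth _ N).
      by rewrite sz0 size_map size_iota.
    move=> v; rewrite {1}size_map size_iota => vN; rewrite bfs_stepE //.
    have := h v; rewrite mem_iota /= vN => /(_ isT); rewrite negb_and negbK -/(R i v) => /orP[->//|nr].
    have nri : ~~ R i v by apply: contra nr; apply: mono.
    have h2 : N <= nth N (iter i (bfs_step N c) p0) v by rewrite leqNgt.
    rewrite (negPf nri); move: nr; rewrite /R /= /reached bfs_stepE // -/(R i v) (negPf nri) -leqNgt => h1.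
    have := find_size (fun u => reached (iter i (bfs_step N c) p0) u && pos u v) (iota 0 N).
    rewrite size_iota => h3.
    have h4 : nth N (iter i (bfs_step N c) p0) v <= N.
      case: (i) => [|k] /=; first by rewrite nth_mkrow //; case: eqP => // _; apply: ltnW.
      rewrite bfs_stepE //; case: ifP => [/ltnW//|_].
      by apply: leq_trans (find_size _ _) _; rewrite size_iota.
    by apply/eqP; rewrite eqn_leq (leq_trans h3 h2) (leq_trans h4 h1).
  by rewrite mem_iota => /= vN /andP[? ?]; exists v.
have sub : subpred (R i) (fun v => R i.+1 v || (N <= v)).
  by move=> w rw; case: (ltnP w N) => [wN|]; rewrite ?orbT // mono.
have -> : count (R i.+1) (iota 0 N) = count (fun w => R i w) (iota 0 N) + count (fun w => ~~ R i w && R i.+1 w) (iota 0 N).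
  rewrite -count_predUI [X in _ = _ + X](_ : _ = 0) ?addn0.
    apply: eq_in_count => w; rewrite mem_iota /= => wN.
    by case Rw: (R i w) => //=; rewrite mono.
  by apply/eqP; rewrite -leqn0 leqNgt -has_count; apply/hasPn => w _ /=; case: (R i w).
rewrite -{1}[count _ _]addn0 ltn_add2l -has_count; apply/hasP; exists v; rewrite ?mem_iota //.
by rewrite nr r.
Qed.

Lemma bfs_closed u v : u < N -> v < N -> reached (bfs N c s) u -> pos u v -> reached (bfs N c s) v.
Proof.
move=> uN vN ru puv; case rv: (reached _ v) => //.
have := bfs_stepE (bfs N c s) vN; rewrite bfs_stable rv => E.
have : has (fun u => reached (bfs N c s) u && pos u v) (iota 0 N).
  by apply/hasP; exists u; rewrite ?mem_iota ?ru.
by rewrite has_find size_iota -E -/(reached _ v) rv.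
Qed.

Lemma bfs_source : reached (bfs N c s) s.
Proof. by rewrite /reached /bfs; have [rk [-> _ _]] := bfs_invP N. Qed.

Lemma bfs_pathP t : t < N -> reached (bfs N c s) t ->
  exists p, [/\ bfs_path N (bfs N c s) s t = s :: p, all (fun v => v < N) p,
    uniq (s :: p), path pos s p & last s p = t].
Proof.
move=> tN rt; have [rk] := bfs_invP N; rewrite -/(bfs N c s) => -[ps rs H].
(* After [i] steps either [s] is reached or the rank has dropped by at least [i]. Ranks are at most
   [N], and a reached node other than [s] has positive rank, so [N] steps suffice. *)
have key i : exists x p, [/\ iter i (fun l => if head s l == s then l else
      nth N (bfs N c s) (head s l) :: l) [:: t] = x :: p, x < N,
    reached (bfs N c s) x & [/\ all (fun v => v < N) p, sorted (fun a b => rk a < rk b) (x :: p),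
    path pos x p & last x p = t]] /\ (x = s \/ rk x + i <= rk t).
  elim: i => [|i [x [p [[/= -> xN rx [pN so pp lp]] h]]]] /=.
    by exists t, [::]; split=> //; right; rewrite addn0.
  case: (x =P s) => [xs|/eqP xs]; first by exists x, p; split=> //; left.
  have [_ /(_ xs)[r1 p1 l1]] := H x xN rx.
  exists (nth N (bfs N c s) x), (x :: p); split; first split=> //=.
  - by rewrite xN pN l1 p1; split.
  right; case: h => [xs'|]; first by rewrite xs' eqxx in xs.
  lia.
have [x [p [[E xN rx [pN so pp lp]] h]]] := key N.
have xs : x = s.
  case: h => // le; apply/eqP/negPn/negP => xs.
  by have [_ /(_ xs)[_ _]] := H x xN rx; have [] := H t tN rt; lia.
rewrite -xs in E *; exists p; split=> //; rewrite -?xs //.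
apply: (sorted_uniq (leT := fun a b => rk a < rk b)) => //.
  by move=> a b d; apply: ltn_trans.
by move=> a; apply: ltnn.
Qed.
End Bfs.

Lemma eq_bfs N c c' s : (forall a b, a < N -> b < N -> get 0 c a b = get 0 c' a b) ->
  bfs N c s = bfs N c' s.
Proof.
move=> E; rewrite /bfs; move: (mkrow _ _) => p0.
suff key i : iter i (bfs_step N c) p0 = iter i (bfs_step N c') p0 by [].
elim: i => //= i ->; rewrite /bfs_step /mkrow.
apply/eq_in_map => v; rewrite mem_iota /= => vN; case: ifP => // _.
by apply: eq_in_find => u; rewrite mem_iota /= => uN; rewrite E.
Qed.

Section Mincut.
Variables (N : nat) (c : seq (seq nat)) (s t : nat).
Hypotheses (sN : s < N) (tN : t < N).

(** All cuts between [s] and [t] have lost the same amount [i], so a cut that is minimum for the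
    residual capacities is minimum for the original ones. *)
Lemma mincut_iterP f : exists i, (forall S : nat -> bool, S s -> ~~ S t ->
    cut N (get 0 (iter f (augment N s t) c)) S + i = cut N (get 0 c) S) /\
  (i = f \/ ~~ (nth N (bfs N (iter f (augment N s t) c) s) t < N)).
Proof.
elim: f => [|f [i [H1 H2]]]; first by exists 0; split=> [S _ _|]; [rewrite addn0|left].
set cf := iter f _ _ in H1 H2 *; rewrite iterS -/cf.
case rt: (nth N (bfs N cf s) t < N); last first.
  exists i; split=> [S Ss St|].
    rewrite -H1 //; congr (_ + _); apply: eq_cut => a b aN bN.
    by rewrite get_mkmx // rt.
  right; rewrite (@eq_bfs N _ cf) ?rt // => a b aN bN.
  by rewrite get_mkmx // rt.
case: H2 => [Ei|]; last by rewrite rt.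
rewrite {}Ei in H1.
exists f.+1; split=> [S Ss St|]; last by left.
have [p [Ep pN pu pp lp]] := bfs_pathP sN tN rt.
rewrite -{}H1 // addnS; have <- := cut_augment (S := S) sN pN pu pp Ss; last by rewrite lp.
rewrite addSn; congr (_ + _).+1; apply: eq_cut => a b aN bN.
by rewrite get_mkmx // rt Ep !path_arcE.
Qed.

Lemma mincutP fuel : s != t -> cut N (get 0 c) (pred1 s) <= fuel ->
  let S := nth false (mincut N c s t fuel) in
  [/\ S s, ~~ S t & forall S' : nat -> bool, S' s -> ~~ S' t -> cut N (get 0 c) S <= cut N (get 0 c) S'].
Proof.
move=> st le S; have [i [H1 H2]] := mincut_iterP fuel.
set cf := iter fuel _ _ in H1 H2.
have SE v : v < N -> S v = (nth N (bfs N cf s) v < N) by move=> vN; rewrite /S nth_mkrow.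
(* If [t] were still reachable, all [fuel] rounds would have augmented and a further augmentation
   would be possible, whereas the cut around [s] alone has capacity at most [fuel]. *)
have nrt : ~~ (nth N (bfs N cf s) t < N).
  case: H2 => // E; apply/negP => rt.
  have [p [Ep pN pu pp lp]] := bfs_pathP sN tN rt.
  have ps : pred1 s s by rewrite /= eqxx.
  have pt : ~~ pred1 s t by rewrite /= eq_sym.
  have := cut_augment (S := pred1 s) sN pN pu pp ps; rewrite lp => /(_ pt).
  have := H1 _ ps pt; lia.
have Ss : S s by rewrite SE //; apply: bfs_source.
have St : ~~ S t by rewrite SE.
split=> // S' S's S't; rewrite -!H1 // leq_add2r.
rewrite [X in X <= _](_ : _ = 0) // /cut; apply: big1 => u Su; apply: big1 => v Sv.
apply/eqP; rewrite -leqn0 leqNgt; apply: contra Sv => puv.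
by rewrite SE //; apply: (bfs_closed sN (ltn_ord u) (ltn_ord v)) => //; rewrite -SE.
Qed.
End Mincut.

Lemma sz_nth_le Y (cY : codable Y) d (l : seq Y) i : sz (nth d l i) <= sz l + sz d.
Proof.
case: (ltnP i (size l)) => il; last by rewrite nth_default // leq_addl.
by apply: leq_trans (leq_addr _ _); apply: sz_mem_nth.
Qed.

Lemma get_le_sz (c : seq (seq nat)) a b : get 0 c a b <= sz c.
Proof.
have h1 := sz_nth_le code_nat 0 (nth [::] c a) b.
move: h1; rewrite -/(get 0 c a b) !sz_nat; case: (ltnP a (size c)) => ac.
  by have := sz_mem_nth (code_seq code_nat) [::] ac; lia.
by rewrite /get (nth_default _ ac) nth_nil.
Qed.

Lemma PT_bfs : PT (fun p : nat * (seq (seq nat) * nat) => bfs p.1 p.2.1 p.2.2).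
Proof.
rewrite /bfs; apply: (p_iter (B := fun p => p.1 * (2 * p.1).+2 + 1)).
- by rewrite /bfs_step; pt.
- by pt.
- by pt.
- assert (H : pbnd (fun p : nat * (seq (seq nat) * nat) => p.1)) by (apply: pbnd_nat; pt).
  by auto 10 with pbnd.
move=> -[N [c s]] i _ /=; case: i => [|i] /=; apply: sz_mkrow => v vN; rewrite sz_nat.
  by case: eqP => [<-|_]; lia.
case: ifP; first by lia.
have := find_size (fun u => (nth N (iter i (bfs_step N c) (mkrow N (fun v => if v == s then s else N))) u < N) && (0 < get 0 c u v)) (iota 0 N).
by rewrite size_iota; lia.
Qed.

Lemma p_bfs X (cX : codable X) (N : X -> nat) c s :
  PT N -> PT c -> PT s -> PT (fun x => bfs (N x) (c x) (s x)).
Proof. exact: p_app3 PT_bfs. Qed.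

Lemma bfs_path_size N par s t i :
  size (iter i (fun l => if head s l == s then l else nth N par (head s l) :: l) [:: t]) <= i.+1.
Proof. by elim: i => //= i IH; case: ifP => _ /=; lia. Qed.

Lemma PT_bfs_path :
  PT (fun p : (nat * seq nat) * (nat * nat) => bfs_path p.1.1 p.1.2 p.2.1 p.2.2).
Proof.
rewrite /bfs_path; pose Bd (p : (nat * seq nat) * (nat * nat)) := 2 * (p.1.1 + p.2.2) + @sz _ (code_seq code_nat) p.1.2 + 2.
apply: (p_iter (B := fun p => p.1.1.+1 * (Bd p).+1 + 1)).
- by pt.
- by pt.
- by pt.
- assert (H1 : pbnd (fun p : (nat * seq nat) * (nat * nat) => p.1.1)) by (apply: pbnd_nat; pt).
  assert (H2 : pbnd (fun p : (nat * seq nat) * (nat * nat) => p.2.2)) by (apply: pbnd_nat; pt).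
  assert (H3 : pbnd (fun p : (nat * seq nat) * (nat * nat) => sz p.1.2)) by (apply: PT_sz; pt).
  by rewrite /Bd; auto 10 with pbnd.
move=> -[[N par] [s t]] i iN /=; set l := iter _ _ _.
have sl : size l <= i.+1 by apply: bfs_path_size.
have hl : all (fun v => sz v <= Bd ((N, par), (s, t))) l.
  rewrite {sl}/l; elim: i {iN} => [|i IH] /=; first by rewrite andbT sz_nat /Bd /=; lia.
  case: ifP => // _ /=; rewrite IH andbT.
  have := sz_nth_le code_nat N par (head s (iter i (fun l => if head s l == s then l else nth N par (head s l) :: l) [:: t])).
  by rewrite [sz N]sz_nat /Bd /=; lia.
apply: leq_trans (@sz_seq_le _ _ _ (Bd ((N, par), (s, t))) _) _.
  by move=> j d jl; apply: (all_nthP d hl).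
by rewrite leq_add2r leq_mul2r (leq_trans sl) ?orbT.
Qed.

Lemma PT_augment :
  PT (fun p : (nat * nat) * (nat * seq (seq nat)) => augment p.1.1 p.1.2 p.2.1 p.2.2).
Proof.
assert (Hl : PT (fun p : (nat * nat) * (nat * seq (seq nat)) =>
    bfs_path p.1.1 (bfs p.1.1 p.2.2 p.1.2) p.1.2 p.2.1)).
  refine (@p_app2 _ _ _ _ _ _ _ _ (fun a b => bfs_path a.1 a.2 b.1 b.2)
    (fun p => (p.1.1, bfs p.1.1 p.2.2 p.1.2)) (fun p => (p.1.2, p.2.1)) PT_bfs_path _ _).
    by apply: PT_pair; [pt|apply: p_bfs; pt].
  by pt.
pose g (p : (nat * nat) * (nat * seq (seq nat))) (l : seq nat) := mkmx p.1.1 p.1.1 (fun a b =>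
  if nth p.1.1 (bfs p.1.1 p.2.2 p.1.2) p.2.1 < p.1.1
  then get 0 p.2.2 a b - path_arc l a b + path_arc l b a else get 0 p.2.2 a b).
apply: (@PT_ext _ _ _ _ (fun p => g p (bfs_path p.1.1 (bfs p.1.1 p.2.2 p.1.2) p.1.2 p.2.1))) => //.
apply: (@p_app2 _ _ _ _ _ _ _ _ g) Hl; last by pt.
rewrite /g /path_arc; apply: p_mkmx; [by pt|by pt|].
apply: PT_if; [|by pt|by pt].
by apply: p_leq; [apply: p_S; apply: p_nth; [pt|apply: p_bfs; pt|pt]|pt].
Qed.

Lemma PT_mincut : PT (fun p : (nat * seq (seq nat)) * ((nat * nat) * nat) =>
  mincut p.1.1 p.1.2 p.2.1.1 p.2.1.2 p.2.2).
Proof.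
pose Bd (p : (nat * seq (seq nat)) * ((nat * nat) * nat)) :=
  2 * (@sz _ (code_seq (code_seq code_nat)) p.1.2 + p.2.2 * p.1.1) + 1.
assert (H : PT (fun p : (nat * seq (seq nat)) * ((nat * nat) * nat) =>
    iter p.2.2 (augment p.1.1 p.2.1.1 p.2.1.2) p.1.2)); last first.
  rewrite /mincut; apply: p_mkrow; first by pt.
  by apply: p_leq; [apply: p_S; apply: p_nth; [pt|apply: p_bfs; [pt| |pt]|pt]|pt];
    apply: (PT_comp (p_fst (PT_id _)) H).
apply: (p_iter (B := fun p => p.1.1 * (p.1.1 * (Bd p).+1 + 2) + 1 + sz p.1.2)).
- exact: (@p_app2 _ _ _ _ _ _ _ _ (fun a b => augment a.1 a.2 b.1 b.2) (fun p => (_, _)) (fun p => (_, _))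
    PT_augment (PT_pair (p_fst (p_fst (p_fst (PT_id _)))) (p_fst (p_fst (p_snd (p_fst (PT_id _))))))
    (PT_pair (p_snd (p_fst (p_snd (p_fst (PT_id _))))) (p_snd (PT_id _)))).
- by pt.
- by pt.
- assert (H1 : pbnd (fun p : (nat * seq (seq nat)) * ((nat * nat) * nat) => p.1.1)) by (apply: pbnd_nat; pt).
  assert (H2 : pbnd (fun p : (nat * seq (seq nat)) * ((nat * nat) * nat) => p.2.2)) by (apply: pbnd_nat; pt).
  assert (H3 : pbnd (fun p : (nat * seq (seq nat)) * ((nat * nat) * nat) => sz p.1.2)) by (apply: PT_sz; pt).
  by rewrite /Bd; auto 12 with pbnd.
move=> -[[N c] [[s t] f]] i /= iF; case: i iF => [|i] iF; first by rewrite /= leq_addl.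
apply: leq_trans (leq_addr _ _); rewrite iterS {1}/augment.
(* An augmentation raises an entry by at most the number of arcs of the path, which is at most
   [N]. *)
have ent j a b : a < N -> b < N -> get 0 (iter j (augment N s t) c) a b <= sz c + j * N.
  elim: j => [|j IH] aN bN /=; first by rewrite mul0n addn0 get_le_sz.
  rewrite {1}/augment get_mkmx //; have := IH aN bN; case: ifP => _; last by lia.
  set l := bfs_path _ _ _ _; have := bfs_path_size N (bfs N (iter j (augment N s t) c) s) s t N.
  rewrite -/(bfs_path N _ s t) -/l => hl.
  have := count_size (fun i0 => (nth 0 l i0 == b) && (nth 0 l i0.+1 == a)) (iota 0 (size l).-1).
  by rewrite size_iota -/(path_arc l b a); lia.
apply: sz_mkmx => a b aN bN; rewrite sz_nat /Bd /=.
have := ent i.+1 a b aN bN; rewrite iterS {1}/augment get_mkmx //.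
have h : i.+1 * N <= f * N by rewrite leq_mul2r iF orbT.
by move: (if _ then _ else _) (i.+1 * N) h => e z; move: (f * N) => w; clear; lia.
Qed.

Lemma p_mincut X (cX : codable X) (N : X -> nat) c s t f :
  PT N -> PT c -> PT s -> PT t -> PT f -> PT (fun x => mincut (N x) (c x) (s x) (t x) (f x)).
Proof.
move=> HN Hc Hs Ht Hf.
exact: (@p_app2 _ _ _ _ _ _ _ _ (fun a b => mincut a.1 a.2 b.1.1 b.1.2 b.2) (fun p => (_, _)) (fun p => (_, _, _))
  PT_mincut (PT_pair HN Hc) (PT_pair (PT_pair Hs Ht) Hf)).
Qed.
Ltac pt_mc := first [pt_mx | lazymatch goal with
  | |- PT (fun x => mincut (@?N x) (@?c x) (@?s x) (@?t x) (@?f x)) => refine (p_mincut _ _ _ _ _)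
  end].
Ltac pt_user ::= pt_mc.

(** * Strength of hypergraphs *)

(** The arithmetic of [strength_gain]. The letters p, q, c, f are the numbers of blocks of two
    partitions and of their uncrossed versions, those with prefix s the touch sums over the old
    elements, those with prefix e the touches of the new element. Products are generalised so that
    the rest is linear. *)
Lemma exchange_gain t w p q c f sP sQ sC sF eP eQ eC s : q <= w -> p <= w -> c <= w -> f <= w ->
  c + f = p + q -> sC + sF <= sP + sQ -> sQ + t * (w - q) <= sC + t * (w - c) ->
  s <= sF + t.+1 * (w - f) -> c + eQ <= eC + q -> eC <= eP ->
  s + eQ <= eP + sP + t.+1 * (w - p).
Proof.
move=> qw pw cw fw e; have := congr1 (muln t) e; rewrite !mulnDr !mulSn !mulnBr.
have := leq_mul (leqnn t) qw; have := leq_mul (leqnn t) pw.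
have := leq_mul (leqnn t) cw; have := leq_mul (leqnn t) fw.
by move: (t * q) (t * p) (t * c) (t * f) (t * w) => *; lia.
Qed.

Lemma exchange_loss t w p q c f sP sQ sC sF eQ eC eF s : q <= w -> p <= w -> c <= w -> f <= w ->
  c + f = p + q -> sC + sF <= sP + sQ -> s <= eC + sC + t * (w - c) ->
  eQ + sQ + t.+1 * (w - q) <= eF + sF + t.+1 * (w - f) -> q + eF <= eQ + f -> eC <= eQ ->
  s <= sP + t * (w - p) + eQ.
Proof.
move=> qw pw cw fw e; have := congr1 (muln t) e; rewrite !mulnDr !mulSn !mulnBr.
have := leq_mul (leqnn t) qw; have := leq_mul (leqnn t) pw.
have := leq_mul (leqnn t) cw; have := leq_mul (leqnn t) fw.
by move: (t * q) (t * p) (t * c) (t * f) (t * w) => *; lia.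
Qed.

(* A partition of the vertex set [W] is given by a labelling [f] of its
   vertices; its number of blocks is [#|f @: W|], and a hyperedge [e] touches
   [#|f @: h e|] of them. *)
Section Hypergraph.
Variables (V E : finType) (h : E -> {set V}) (W : {set V}).
Implicit Types (A : {set E}) (S B : {set V}) (t : nat).

Definition pval (L : finType) t A (f : V -> L) :=
  \sum_(e in A) #|f @: h e| + t * (#|W| - #|f @: W|).

Definition strength t A :=
  pval t A [arg min_(f < [ffun v => v] : {ffun V -> V}) pval t A f].

Lemma card_imset_ker (L L' : finType) (f : V -> L) (g : V -> L') S :
  {in S &, forall u v, (f u == f v) = (g u == g v)} -> #|f @: S| = #|g @: S|.
Proof.
move=> H; have le (L1 L2 : finType) (f1 : V -> L1) (g1 : V -> L2) :
    {in S &, forall u v, (f1 u == f1 v) = (g1 u == g1 v)} -> #|f1 @: S| <= #|g1 @: S|.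
  move=> H1; have [->|[u0 u0S]] := set_0Vmem S; first by rewrite !imset0 !cards0.
  pose k (y : L2) := f1 (odflt u0 [pick u in S | g1 u == y]).
  apply: leq_trans (leq_imset_card k _); apply: subset_leq_card.
  apply/subsetP => _ /imsetP[u uS ->]; apply/imsetP; exists (g1 u); first exact: imset_f.
  rewrite /k; case: pickP => [w /andP[wS]|/(_ u)]; last by rewrite uS eqxx.
  by rewrite -H1 // eq_sym => /eqP.
by apply/eqP; rewrite eqn_leq !le // => u v uS vS; rewrite H.
Qed.

Lemma card_imset_le (L : finType) (f : V -> L) S : #|f @: S| <= #|S|.
Proof. exact: leq_imset_card. Qed.

Hypothesis hW : forall e, h e \subset W.

Lemma pval_ker (L L' : finType) t A (f : V -> L) (g : V -> L') :
  {in W &, forall u v, (f u == f v) = (g u == g v)} -> pval t A f = pval t A g.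
Proof.
move=> H; rewrite /pval; congr (_ + _ * (_ - _)); last exact: card_imset_ker.
apply: eq_bigr => e _; apply: card_imset_ker => u v uS vS; apply: H; exact: (subsetP (hW e)).
Qed.

(** A block can be named by one of its members in [W], so that allowing other types of labels does
    not lower the minimum. *)
Lemma strength_le (L : finType) t A (f : V -> L) : strength t A <= pval t A f.
Proof.
pose p v := [pick u in W | f u == f v].
pose g : {ffun V -> V} := [ffun v => odflt v (p v)].
have -> : pval t A f = pval t A g.
  apply: pval_ker => u v uW vW; rewrite !ffunE.
  have fp w : w \in W -> f (odflt w (p w)) = f w.
    by rewrite /p; case: pickP => [a /andP[_ /eqP]|].
  apply/eqP/eqP => [uv|ab]; last by rewrite -(fp u) // -(fp v) // ab.
  have pE : p u = p v by apply: eq_pick => w; rewrite uv.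
  by rewrite pE /p; case: pickP => // /(_ v); rewrite vW eqxx.
by rewrite /strength; case: arg_minnP => // i _; apply.
Qed.

Lemma strengthP t A : exists f : {ffun V -> V}, strength t A = pval t A f.
Proof.
by eexists. Qed.

(** A block of [g] missed by [S] contains a block of [f] missed by [S]; hence coarsening costs [S]
    no more blocks than it costs [W]. *)
Lemma coarsen_le (L L' : finType) (f : V -> L) (g : V -> L') S : S \subset W ->
  {in W &, forall u v, f u = f v -> g u = g v} ->
  #|g @: W| + #|f @: S| <= #|g @: S| + #|f @: W|.
Proof.
move=> SW H; have [W0|[w0 w0W]] := set_0Vmem W.
  by move: SW; rewrite W0 subset0 => /eqP->; rewrite !imset0 !cards0.
pose k (y : L) := g (odflt w0 [pick u in W | f u == y]).
have kE u : u \in W -> k (f u) = g u.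
  move=> uW; rewrite /k; case: pickP => [a /andP[aW /eqP au]|/(_ u)]; last by rewrite uW eqxx.
  exact: H.
have sub : g @: W \subset g @: S :|: k @: (f @: W :\: f @: S).
  apply/subsetP => _ /imsetP[u uW ->]; rewrite inE; case: (boolP (f u \in f @: S)) => fu.
    by case/imsetP: fu => v vS fuv; rewrite (H _ _ uW (subsetP SW _ vS) fuv) imset_f.
  by apply/orP; right; apply/imsetP; exists (f u); rewrite ?kE // inE fu imset_f.
have := subset_leq_card sub; have := (leq_card_setU (g @: S) (k @: (f @: W :\: f @: S))).1.
have := leq_imset_card k (f @: W :\: f @: S); rewrite cardsD.
have -> : f @: W :&: f @: S = f @: S by apply/setIidPr/imsetS.
have : #|f @: S| <= #|f @: W| by apply: subset_leq_card; apply: imsetS.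
lia.
Qed.

Lemma coarser_card (L L' : finType) (f : V -> L) (g : V -> L') S :
  {in S &, forall u v, f u = f v -> g u = g v} -> #|g @: S| <= #|f @: S|.
Proof.
move=> H; have [->|[w0 w0W]] := set_0Vmem S; first by rewrite !imset0 !cards0.
pose k (y : L) := g (odflt w0 [pick u in S | f u == y]).
apply: leq_trans (leq_imset_card k (f @: S)); apply: subset_leq_card.
apply/subsetP => _ /imsetP[u uW ->]; apply/imsetP; exists (f u); rewrite ?imset_f //.
rewrite /k; case: pickP => [a /andP[aW /eqP au]|/(_ u)]; last by rewrite uW eqxx.
by apply: H.
Qed.

(** [F] cannot be the common refinement, whose blocks touched by a subset may be too many. Instead
    the blocks of [Q] are treated one after the other: each is cut only by the current [C], which is
    already coarser than [P], and then merges the blocks of [C] that it meets. The counts balance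
    exactly on [W], and on a subset they can only fall. *)
Lemma uncross (L1 L2 : finType) (P : V -> L1) (Q : V -> L2) :
  exists (C : V -> L1) (F : V -> L2 * L1),
    [/\ {in W &, forall u v, P u = P v -> C u = C v},
        {in W &, forall u v, Q u = Q v -> C u = C v},
        forall v, (F v).1 = Q v,
        forall S, S \subset W -> #|C @: S| + #|F @: S| <= #|P @: S| + #|Q @: S| &
        #|C @: W| + #|F @: W| = #|P @: W| + #|Q @: W|].
Proof.
suff [C [F [H1 H2 H3 H4 H5]]] : exists (C : V -> L1) (F : V -> L2 * L1),
    let Qs := [set v | Q v \in enum L2] in
    [/\ {in W &, forall u v, P u = P v -> C u = C v},
        {in W &, forall u v, Q u = Q v -> Q u \in enum L2 -> C u = C v},
        forall v, (F v).1 = Q v,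
        forall S, S \subset W -> #|C @: S| + #|F @: (S :&: Qs)| <= #|P @: S| + #|Q @: (S :&: Qs)| &
        #|C @: W| + #|F @: (W :&: Qs)| = #|P @: W| + #|Q @: (W :&: Qs)|].
  have T S : S :&: [set v | Q v \in enum L2] = S by apply/setP => v; rewrite !inE mem_enum andbT.
  exists C, F; rewrite T in H5; split=> // [u v uW vW e|S SW].
    by apply: H2; rewrite ?mem_enum.
  by have := H4 S SW; rewrite T.
have := enum_uniq L2; elim: (enum L2) => [_|q s IH /= /andP[qs us]].
  exists P, (fun v => (Q v, P v)); split=> //= [S SW|].
    by have -> : S :&: [set v | Q v \in [::]] = set0 by [apply/setP => v; rewrite !inE andbF]; rewrite !imset0 !cards0.
  by have -> : W :&: [set v | Q v \in [::]] = set0 by [apply/setP => v; rewrite !inE andbF]; rewrite !imset0 !cards0.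
have {IH us} [C [F [H1 H2 H3 H4 H5]]] := IH us.
pose Qs := [set v | Q v \in s]; pose Qq := [set v | Q v == q]; rewrite -/Qs in H4 H5.
(* The blocks of [C] met by the block [q]: they stay separate as the pieces of [q] in [F'] and
   become one block in [C']. Thus [F] gains [#|M|] blocks, [C] loses [#|M| - 1], and the processed
   part of [Q] gains one, unless [M] is empty. *)
pose M := C @: (W :&: Qq).
pose C' v := if C v \in M then odflt (C v) [pick y in M] else C v.
pose F' v := if Q v == q then (q, C v) else F v.
have C'M v : C v \in M -> C' v \in M.
  by rewrite /C' => cv; rewrite cv; case: pickP => [//|/(_ (C v))]; rewrite cv.
have C'C u v : C u = C v -> C' u = C' v.
  rewrite /C' => ->; case: ifP => // cv; case: pickP => [//|/(_ (C v))]; rewrite cv.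
have C'C2 u v : C u \in M -> C v \in M -> C' u = C' v.
  by rewrite /C' => cu cv; rewrite cu cv; case: pickP => [//|/(_ (C v))]; rewrite cv.
have SQ S : S :&: [set v | Q v \in q :: s] = (S :&: Qs) :|: (S :&: Qq).
  by apply/setP => v; rewrite !inE; case: (v \in S); rewrite //= orbC.
have imF S : #|F' @: (S :&: [set v | Q v \in q :: s])| = #|F @: (S :&: Qs)| + #|C @: (S :&: Qq)|.
  rewrite SQ imsetU cardsU.
  have -> : F' @: (S :&: Qs) = F @: (S :&: Qs).
    apply: eq_in_imset => v; rewrite !inE /F' => /andP[_ vs].
    by case: eqP => // vq; rewrite vq (negPf qs) in vs.
  have -> : #|F' @: (S :&: Qq)| = #|C @: (S :&: Qq)|.
    apply: card_imset_ker => u v; rewrite !inE /F' => /andP[_ uq] /andP[_ vq].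
    by rewrite uq vq xpair_eqE eqxx.
  rewrite (_ : F @: (S :&: Qs) :&: F' @: (S :&: Qq) = set0) ?cards0 ?subn0 //; apply/setP => y; rewrite !inE.
  apply/negP => /andP[/imsetP[u]]; rewrite !inE => /andP[_ us] -> /imsetP[v].
  rewrite !inE /F' => /andP[_ vq]; rewrite vq => EE.
  by have := H3 u; rewrite EE /= => E'; rewrite -E' (negPf qs) in us.
have imQ S : #|Q @: (S :&: [set v | Q v \in q :: s])| = #|Q @: (S :&: Qs)| + (S :&: Qq != set0).
  rewrite SQ imsetU cardsU.
  have -> : #|Q @: (S :&: Qq)| = (S :&: Qq != set0).
    have [->|[w wS]] := set_0Vmem (S :&: Qq); first by rewrite imset0 cards0 eqxx.
    have -> : Q @: (S :&: Qq) = [set q].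
      apply/setP => y; rewrite inE; apply/imsetP/eqP => [[u]|->].
        by rewrite !inE => /andP[_ /eqP<-].
      by exists w => //; move: wS; rewrite !inE => /andP[_ /eqP].
    by rewrite cards1; case: eqP wS => // ->; rewrite inE.
  rewrite (_ : Q @: (S :&: Qs) :&: Q @: (S :&: Qq) = set0) ?cards0 ?subn0 //; apply/setP => y; rewrite !inE.
  apply/negP => /andP[/imsetP[u]]; rewrite !inE => /andP[_ us] -> /imsetP[v].
  by rewrite !inE => /andP[_ /eqP->] uq; rewrite uq (negPf qs) in us.
have imC S : S \subset W -> #|C' @: S| = #|C @: S :\: M| + (C @: S :&: M != set0).
  move=> SW; have [E0|[y yM]] := set_0Vmem (C @: S :&: M).
    rewrite E0 eqxx addn0; congr #|pred_of_set _|; apply/setP => z.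
    have nM v : v \in S -> C v \notin M.
      move=> vS; apply/negP => cM; have : C v \in C @: S :&: M by rewrite inE cM imset_f.
      by rewrite E0 inE.
    rewrite inE; apply/imsetP/andP => [[v vS ->]|[zM /imsetP[v vS zE]]].
      by rewrite /C' (negPf (nM v vS)) nM ?imset_f.
    by exists v => //; rewrite /C' (negPf (nM v vS)).
  move: (yM); rewrite inE => /andP[/imsetP[w wS yE] wM]; rewrite yE in yM wM.
  have -> : C' @: S = C' w |: (C @: S :\: M).
    apply/setP => z; rewrite !inE; apply/imsetP/orP => [[v vS ->]|[/eqP->|]].
    - case: (boolP (C v \in M)) => cM; first by left; rewrite (C'C2 v w).
      by right; rewrite /C' (negPf cM) cM imset_f.
    - by exists w.
    by case/andP=> zM /imsetP[v vS zE]; exists v => //; rewrite /C' -zE (negPf zM).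
  rewrite cardsU1 !inE C'M //=; have -> : C @: S :&: M != set0 by apply/set0Pn; exists (C w).
  by rewrite addnC.
exists C', F'; split=> /=.
- by move=> u v uW vW /(H1 _ _ uW vW); apply: C'C.
- move=> u v uW vW uv; rewrite inE => /orP[/eqP uq|us]; last by apply: C'C; apply: H2.
  by apply: C'C2; apply: imset_f; rewrite !inE ?uW ?vW -?uv uq eqxx.
- by move=> v; rewrite /F'; case: eqP => [->|_].
- move=> S SW; have := H4 S SW; rewrite imF imQ imC // -(cardsID M (C @: S)).
  have sub : C @: (S :&: Qq) \subset C @: S :&: M.
    apply/subsetP => z /imsetP[v]; rewrite !inE => /andP[vS vq] ->.
    by rewrite imset_f //= imset_f // !inE (subsetP SW) // vq.
  have := subset_leq_card sub; rewrite -!card_gt0.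
  have : 0 < #|S :&: Qq| -> 0 < #|C @: (S :&: Qq)|.
    by rewrite !card_gt0 imset_eq0.
  have : #|S :&: Qq| = 0 -> #|C @: (S :&: Qq)| = 0.
    by move/eqP; rewrite cards_eq0 => /eqP->; rewrite imset0 cards0.
  by case: (#|S :&: Qq|) => [|a]; case: (#|C @: S :&: M|) => [|b] /=; lia.
- rewrite imF imQ imC // -/M -(cardsID M (C @: W)) in H5 *.
  have -> : C @: W :&: M = M by apply/setIidPr; apply: imsetS; apply: subsetIl.
  have -> : (W :&: Qq != set0) = (M != set0) by rewrite imset_eq0.
  have := H5; rewrite (_ : C @: W :&: M = M); first by lia.
  by apply/setIidPr; apply: imsetS; apply: subsetIl.
Qed.

Lemma sum_uncross (L1 L2 L3 L4 : finType) (P : V -> L1) (Q : V -> L2) (C : V -> L3) (F : V -> L4) A :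
  (forall S, S \subset W -> #|C @: S| + #|F @: S| <= #|P @: S| + #|Q @: S|) ->
  \sum_(e in A) #|C @: h e| + \sum_(e in A) #|F @: h e| <=
  \sum_(e in A) #|P @: h e| + \sum_(e in A) #|Q @: h e|.
Proof. by move=> H; rewrite -!big_split; apply: leq_sum => e _; apply: H. Qed.

(** Uncross [Q] with an optimum [P] of the enlarged set at level [t.+1]. The coarse partition
    competes with [Q] at level [t], the fine one bounds the strength of [A] at level [t.+1]. The
    difference of the levels leaves one unit for each block lost from [Q] to the coarse partition,
    which pays for the blocks touched by [e] that were merged. *)
Lemma strength_gain t A e (Q : {ffun V -> V}) : e \notin A -> strength t A = pval t A Q ->
  strength t.+1 A + #|Q @: h e| <= strength t.+1 (e |: A).
Proof.
move=> eA EQ; have [P ->] := strengthP t.+1 (e |: A).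
have [C [F [CP CQ FQ le eq]]] := uncross P Q.
have s1 := sum_uncross A le; have s2 := strength_le t A C; have s3 := strength_le t.+1 A F.
have c1 := coarsen_le (hW e) CQ.
have c2 : #|C @: h e| <= #|P @: h e|.
  by apply: coarser_card => u v /(subsetP (hW e)) uW /(subsetP (hW e)) vW; apply: CP.
move: s2 s3; rewrite EQ /pval big_setU1 //= => s2 s3.
by apply: (exchange_gain (card_imset_le Q W) (card_imset_le P W) (card_imset_le C W)
  (card_imset_le F W) eq s1 s2 s3 c1 c2).
Qed.

(** The same exchange with the levels interchanged: the optimum [P] of the reduced set is at level
    [t], so the fine partition competes with [Q] at level [t.+1] and the coarse one bounds the
    strength of [A]. *)
Lemma strength_loss t A e (Q : {ffun V -> V}) : e \in A -> strength t.+1 A = pval t.+1 A Q ->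
  strength t A <= strength t (A :\ e) + #|Q @: h e|.
Proof.
move=> eA EQ; have [P ->] := strengthP t (A :\ e).
have [C [F [CP CQ FQ le eq]]] := uncross P Q.
have s1 := sum_uncross (A :\ e) le; have s2 := strength_le t A C; have s3 := strength_le t.+1 A F.
have FQ' : {in W &, forall u v, F u = F v -> Q u = Q v} by move=> u v _ _ uv; rewrite -!FQ uv.
have c1 := coarsen_le (hW e) FQ'.
have c2 : #|C @: h e| <= #|Q @: h e|.
  by apply: coarser_card => u v /(subsetP (hW e)) uW /(subsetP (hW e)) vW; apply: CQ.
move: s2 s3; rewrite EQ /pval !(big_setD1 e eA) /= => s2 s3.
by apply: (exchange_loss (card_imset_le Q W) (card_imset_le P W) (card_imset_le C W)
  (card_imset_le F W) eq s1 s2 s3 c1 c2).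
Qed.

Lemma sum_fibers (L : finType) (f : V -> L) A :
  \sum_(a in f @: W) #|[set e in A | a \in f @: h e]| = \sum_(e in A) #|f @: h e|.
Proof.
transitivity (\sum_(a in f @: W) \sum_(e in A) (a \in f @: h e : nat)).
  by apply: eq_bigr => a _; rewrite -sum1dep_card big_mkcondr.
rewrite exchange_big; apply: eq_bigr => e _; rewrite -sum1_card [RHS]big_mkcond /= [LHS]big_mkcond /=.
apply: eq_bigr => a _; case: (boolP (a \in f @: W)) => aW; case: ifP => // /imsetP[v vh av].
by case/negP: aW; rewrite av imset_f // (subsetP (hW e)).
Qed.

Hypothesis hne : forall e, h e != set0.

Lemma touch_gt0 (L : finType) (f : V -> L) e : 0 < #|f @: h e|.
Proof. by rewrite card_gt0 imset_eq0 hne. Qed.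

(** If there are at least two blocks, each is one side of a cut and is crossed by [q0] elements; an
    element touching c >= 2 blocks crosses c <= 2(c - 1) of these cuts. *)
Lemma cut_touch q0 A (L : finType) (f : V -> L) :
  (forall Y : {set V}, Y \subset W -> Y != set0 -> Y != W ->
    q0 <= #|[set e in A | (h e :&: Y != set0) && (h e :&: (W :\: Y) != set0)]|) ->
  q0 * (#|f @: W| - 1) + 2 * #|A| <= 2 * \sum_(e in A) #|f @: h e|.
Proof.
move=> Hq; have [le1|gt1] := leqP #|f @: W| 1.
  have -> : #|f @: W| - 1 = 0 by lia.
  rewrite muln0 leq_mul2l /= -sum1_card leq_sum // => e _; exact: touch_gt0.
pose X a := [set e in A | (h e :&: [set v in W | f v == a] != set0) &&
  (h e :&: (W :\: [set v in W | f v == a]) != set0)].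
have H1 : q0 * #|f @: W| <= \sum_(a in f @: W) #|X a|.
  rewrite mulnC -sum_nat_const; apply: leq_sum => a /imsetP[v vW av]; apply: Hq.
  - by apply/subsetP => u; rewrite inE => /andP[].
  - by apply/set0Pn; exists v; rewrite inE vW av eqxx.
  apply/negP => /eqP EW; move: gt1; rewrite ltnNge => /negP; apply.
  rewrite (_ : f @: W = [set a]) ?cards1 //; apply/setP => b; rewrite inE.
  apply/imsetP/eqP => [[u uW ->]|->]; last by exists v.
  by move: uW; rewrite -EW inE => /andP[_ /eqP].
have H2 : \sum_(a in f @: W) #|X a| <= \sum_(e in A) 2 * (#|f @: h e| - 1).
  have -> : \sum_(a in f @: W) #|X a| = \sum_(e in A) \sum_(a in f @: W) (e \in X a : nat).
    rewrite exchange_big; apply: eq_bigr => a _; rewrite -sum1_card.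
    rewrite [LHS]big_mkcond [RHS]big_mkcond /=; apply: eq_bigr => e _.
    by rewrite !inE; case: (e \in A); rewrite //=; case: ifP.
  apply: leq_sum => e eA.
  have XP a : e \in X a -> a \in f @: h e /\ 1 < #|f @: h e|.
    rewrite inE eA /= => /andP[/set0Pn[u]]; rewrite !inE => /and3P[uh uW /eqP ua] /set0Pn[v].
    rewrite !inE => /and3P[vh]; case: (v \in W); rewrite //= => va _.
    split; first by rewrite -ua imset_f.
    rewrite (cardD1 (f u)) imset_f //= (cardD1 (f v)) !inE imset_f // andbT ua va /=; lia.
  have [le1|gt2] := leqP #|f @: h e| 1.
    by rewrite big1 // => a _; case: (boolP (e \in X a)) => // /XP[_]; lia.
  apply: (@leq_trans #|f @: h e|); last by lia.
  rewrite -sum1_card [X in X <= _]big_mkcond [X in _ <= X]big_mkcond /=; apply: leq_sum => a _.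
  by case: (boolP (e \in X a)) => [/XP[-> _]|_]; case: ifP => //; case: ifP.
have H3 : \sum_(e in A) 2 * (#|f @: h e| - 1) + 2 * #|A| = 2 * \sum_(e in A) #|f @: h e|.
  rewrite -sum1_card !big_distrr -big_split; apply: eq_bigr => e _ /=.
  by have := touch_gt0 f e; lia.
have := leq_trans H1 H2; rewrite -H3 leq_add2r mulnBr; lia.
Qed.

(** Comparison of [Q] with the partition into a single block, which every element touches once. *)
Lemma strength_opt_sum t A (Q : {ffun V -> V}) : 0 < #|W| -> strength t A = pval t A Q ->
  \sum_(e in A) #|Q @: h e| <= #|A| + t * (#|Q @: W| - 1).
Proof.
move=> W0 EQ; have := strength_le t A (fun=> tt); rewrite EQ /pval.
have c1 S : S != set0 -> #|(fun _ : V => tt) @: S| = 1.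
  move=> /set0Pn[v vS]; apply/eqP; rewrite eqn_leq card_gt0 imset_eq0.
  by apply/andP; split; [apply: leq_trans (max_card _) _; rewrite card_unit|apply/set0Pn; exists v].
rewrite c1 -?card_gt0 //.
have -> : \sum_(e in A) #|(fun _ : V => tt) @: h e| = #|A|.
  by rewrite -sum1_card; apply: eq_bigr => e _; apply: c1.
have := card_imset_le Q W.
have : 0 < #|Q @: W| by rewrite card_gt0 imset_eq0 -card_gt0.
by move=> a b; have -> : #|W| - 1 = (#|W| - #|Q @: W|) + (#|Q @: W| - 1) by [lia]; rewrite mulnDr; lia.
Qed.

End Hypergraph.

(** * Local maxima of the potential *)

Section LocalSearch.
Variables (V E : finType) (h : E -> {set V}) (W : {set V}) (E0 : {set E}).
Hypotheses (hW : forall e, h e \subset W) (hne : forall e, h e != set0) (W0 : 0 < #|W|).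
Variables (r q q0 : nat).
Hypothesis cutW : forall Y : {set V}, Y \subset W -> Y != set0 -> Y != W ->
    q0 <= #|[set e in E0 | (h e :&: Y != set0) && (h e :&: (W :\: Y) != set0)]|.

Definition colour_class (chi : E -> 'I_r) j := [set e in E0 | chi e == j].
Definition recolour (chi : E -> 'I_r) e j := fun x => if x == e then j else chi x.
Definition potential chi :=
  \sum_(j < r) \sum_(t < q) 4 ^ (q - t.+1) * strength h W t.+1 (colour_class chi j).

Variable chi : E -> 'I_r.
Hypothesis opt : forall e j, e \in E0 -> potential (recolour chi e j) <= potential chi.

Let A := colour_class chi.
Let Q t j : {ffun V -> V} := [arg min_(f < [ffun v => v] : {ffun V -> V}) pval h W t (A j) f].
Let QE t j : strength h W t (A j) = pval h W t (A j) (Q t j) := erefl.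
Let w t := 4 ^ (q - t.+1).
(** Vanishes when the chosen optimum at level [t] is a single block; a disconnected class [j] has
    [n 1 j > 0]. *)
Let n t j := #|Q t j @: W| - 1.
Let N t := \sum_(j < r) n t j.

(** Moving [e] to [j] does not pay. At level [t.+1] the new class gains at least what its optimum at
    level [t] sees of [e], and the old class loses at most what its optimum at level [t.+2] sees. *)
Lemma local_opt_element e j : e \in E0 -> e \notin A j ->
  \sum_(t < q) w t * #|Q t j @: h e| <= \sum_(t < q) w t * #|Q t.+2 (chi e) @: h e|.
Proof.
move=> eE eAj; set i := chi e.
have ij : i != j by apply: contra eAj => /eqP ij; rewrite !inE eE -ij eqxx.
have eAi : e \in A i by rewrite !inE eE eqxx.
have Aj : colour_class (recolour chi e j) j = e |: A j.
  by apply/setP => x; rewrite !inE /recolour; case: (x =P e) => [->|_]; rewrite ?eE ?eqxx.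
have Ai : colour_class (recolour chi e j) i = A i :\ e.
  apply/setP => x; rewrite !inE /recolour; case: (x =P e) => [->|_] //=.
  by rewrite eq_sym (negPf ij) andbF.
have := opt j eE; rewrite /potential (bigD1 j) //= (bigD1 i) //=.
rewrite [X in _ <= X](bigD1 j) //= [X in _ <= _ + X](bigD1 i) //= !addnA Aj Ai.
under [X in _ + X <= _]eq_bigr => l /andP[lj li].
  rewrite (_ : colour_class (recolour chi e j) l = A l); last first.
    apply/setP => x; rewrite !inE /recolour; case: (x =P e) => [->|//].
    by rewrite [j == l]eq_sym (negPf lj) [chi e == l]eq_sym -/i (negPf li).
  over.
rewrite leq_add2r -!big_split /= => le.
suff : \sum_(t < q) (w t * strength h W t.+1 (A j) + w t * strength h W t.+1 (A i)) + \sum_(t < q) w t * #|Q t j @: h e| <=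
  \sum_(t < q) (w t * strength h W t.+1 (e |: A j) + w t * strength h W t.+1 (A i :\ e)) + \sum_(t < q) w t * #|Q t.+2 i @: h e|.
  have le' : \sum_(t < q) (w t * strength h W t.+1 (e |: A j) + w t * strength h W t.+1 (A i :\ e)) <=
    \sum_(t < q) (w t * strength h W t.+1 (A j) + w t * strength h W t.+1 (A i)) := le.
  by move=> h2; have := leq_trans h2 (leq_add le' (leqnn _)); rewrite leq_add2l.
rewrite -!big_split; apply: leq_sum => t _ /=; rewrite -!mulnDr leq_mul2l; apply/orP; right.
have := strength_gain hW eAj (QE t j); have := strength_loss hW eAi (QE t.+2 i); lia.
Qed.

Lemma sum_class (F : E -> nat) : \sum_(e in E0) F e = \sum_(i < r) \sum_(e in A i) F e.
Proof.
rewrite (partition_big chi predT) //=; apply: eq_bigr => i _.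
by apply: eq_bigl => e; rewrite !inE.
Qed.

(** Sum of [local_opt_element] over the elements not coloured [j]. The large cuts bound the left
    side from below, the optimality of the partitions bounds the right side from above, and the
    number of these elements occurs in both bounds and cancels. *)
Lemma local_opt_class j :
  \sum_(t < q) w t * (q0 * n t j) <=
  2 * (\sum_(t < q) w t * (t * n t j) + \sum_(t < q) w t * (t.+2 * N t.+2)).
Proof.
have H : \sum_(e in E0 :\: A j) \sum_(t < q) w t * #|Q t j @: h e| <=
         \sum_(e in E0 :\: A j) \sum_(t < q) w t * #|Q t.+2 (chi e) @: h e|.
  by apply: leq_sum => e; rewrite inE => /andP[eA eE]; apply: local_opt_element.
rewrite [X in X <= _]exchange_big [X in _ <= X]exchange_big /= in H.
have AE : A j \subset E0 by apply/subsetP => e; rewrite inE => /andP[].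
have splitA (F : E -> nat) : \sum_(e in E0) F e = \sum_(e in A j) F e + \sum_(e in E0 :\: A j) F e.
  by rewrite (big_setID (A j)) /=; congr (_ + _); apply: eq_bigl => e; rewrite (setIidPr AE).
pose a := #|E0 :\: A j|.
have aE : #|E0| = #|A j| + a by rewrite -(cardsID (A j) E0) (setIidPr AE).
have L t : q0 * n t j + 2 * a <= 2 * \sum_(e in E0 :\: A j) #|Q t j @: h e| + 2 * (t * n t j).
  have := cut_touch hne (Q t j) cutW; rewrite splitA -/(n t j) aE.
  have := strength_opt_sum hW hne W0 (QE t j); rewrite -/(n t j); lia.
have U t : \sum_(e in E0 :\: A j) #|Q t (chi e) @: h e| <= a + t * N t.
  have H1 : \sum_(e in E0 :\: A j) #|Q t (chi e) @: h e| + \sum_(e in A j) #|Q t (chi e) @: h e| =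
      \sum_(i < r) \sum_(e in A i) #|Q t (chi e) @: h e| by rewrite addnC -splitA sum_class.
  have H2 i : \sum_(e in A i) #|Q t (chi e) @: h e| <= #|A i| + t * n t i.
    have := strength_opt_sum hW hne W0 (QE t i); rewrite -/(n t i); apply: leq_trans.
    by apply: leq_sum => e; rewrite !inE => /andP[_ /eqP->].
  have H3 : #|A j| <= \sum_(e in A j) #|Q t (chi e) @: h e|.
    by rewrite -sum1_card; apply: leq_sum => e _; apply: touch_gt0.
  have H4 : \sum_(i < r) \sum_(e in A i) #|Q t (chi e) @: h e| <= #|E0| + t * N t.
    have -> : #|E0| = \sum_(i < r) #|A i|.
      by rewrite -sum1_card sum_class; apply: eq_bigr => i _; rewrite sum1_card.
    by rewrite /N big_distrr -big_split; apply: leq_sum.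
  by rewrite aE in H4; lia.
have HL : \sum_(t < q) w t * (q0 * n t j) + \sum_(t < q) w t * (2 * a) <=
  2 * \sum_(t < q) \sum_(e in E0 :\: A j) w t * #|Q t j @: h e| + 2 * \sum_(t < q) w t * (t * n t j).
  rewrite !big_distrr /= -!big_split; apply: leq_sum => t _ /=.
  rewrite -big_distrr /=; have := leq_mul (leqnn (w t)) (L t).
  by move: (w t) (n t j) (\sum_(e in _) _) => x y z; lia.
have HU : \sum_(t < q) \sum_(e in E0 :\: A j) w t * #|Q t.+2 (chi e) @: h e| <=
  \sum_(t < q) w t * a + \sum_(t < q) w t * (t.+2 * N t.+2).
  rewrite -big_split; apply: leq_sum => t _ /=.
  by rewrite -big_distrr /= -mulnDr leq_mul2l U orbT.
have Ha : \sum_(t < q) w t * (2 * a) = 2 * \sum_(t < q) w t * a.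
  by rewrite big_distrr /=; apply: eq_bigr => t _; rewrite mulnCA.
have arith x b y y' z u : y <= y' -> x + 2 * b <= 2 * y + 2 * z -> y' <= b + u -> x <= 2 * (z + u).
  by lia.
by apply: (arith _ _ _ _ _ _ H _ HU); rewrite -Ha.
Qed.

(** The ratio 4 of consecutive weights turns a shift by two levels into a factor 16; only the two
    levels above the range are left over. *)
Lemma geometric_shift (F : nat -> nat) m :
  \sum_(t < m) 4 ^ (m - t.+1) * F t.+2 <= 16 * (\sum_(t < m) 4 ^ (m - t.+1) * F t) + 4 * F m + F m.+1.
Proof.
have rec (G : nat -> nat) m' : \sum_(t < m'.+1) 4 ^ (m'.+1 - t.+1) * G t =
    4 * (\sum_(t < m') 4 ^ (m' - t.+1) * G t) + G m'.
  rewrite big_ord_recr /= subnn expn0 mul1n; congr (_ + _); rewrite big_distrr /=.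
  by apply: eq_bigr => t _; rewrite subSS mulnA -expnS; congr (4 ^ _ * _); have := ltn_ord t; lia.
elim: m => [|m IH]; first by rewrite big_ord0.
by rewrite (rec (fun t => F t.+2)) rec; lia.
Qed.

(** Let S and T be the weighted sums of N(t) and N(t+2). The bound on [q0] gives 32 S <= T, and the
    shift gives T <= 16 S + 5 r |W|; so 16 S <= 5 r |W|. The term of level 1 in S has weight
    4^(q-2), whence 4^q N(1) <= 5 r |W| and then 2 N(1) <= r. Every bad class contributes at least 1
    to N(1). *)
Lemma local_opt_good : 0 < r -> 128 * r * q.+1 <= q0 -> 10 * #|W| <= 4 ^ q -> 1 < q ->
  2 * #|[set j | strength h W 1 (A j) < #|A j| + #|W| - 1]| <= r.
Proof.
move=> r0 hq0 h4 q1.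
have S1 : \sum_(t < q) w t * (q0 * N t) <=
    2 * (\sum_(t < q) w t * (t * N t) + r * \sum_(t < q) w t * (t.+2 * N t.+2)).
  have E1 (F : nat -> nat) : \sum_(t < q) w t * (F t * N t) = \sum_(j < r) \sum_(t < q) w t * (F t * n t j).
    by rewrite exchange_big; apply: eq_bigr => t _; rewrite /N !big_distrr.
  rewrite (E1 (fun=> q0)) (E1 id).
  have := @leq_sum _ (index_enum 'I_r) predT _ _ (fun j _ => local_opt_class j).
  by rewrite -big_distrr big_split /= sum_nat_const card_ord.
have S2 : \sum_(t < q) w t * (q0 * N t) <= 2 * (q * \sum_(t < q) w t * N t + r * (q.+1 * \sum_(t < q) w t * N t.+2)).
  apply: leq_trans S1 _; rewrite leq_mul2l /=; apply: leq_add.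
    rewrite big_distrr; apply: leq_sum => t _ /=; rewrite (mulnCA q) leq_mul2l.
    by rewrite leq_mul2r (ltnW (ltn_ord t)) !orbT.
  rewrite leq_mul2l big_distrr; apply/orP; right; apply: leq_sum => t _ /=; rewrite (mulnCA q.+1) leq_mul2l.
  by rewrite leq_mul2r ltnS (ltn_ord t) !orbT.
set S := \sum_(t < q) w t * N t in S2; set T := \sum_(t < q) w t * N t.+2 in S2.
have E3 : \sum_(t < q) w t * (q0 * N t) = q0 * S.
  by rewrite /S big_distrr; apply: eq_bigr => t _; rewrite mulnCA.
rewrite E3 in S2.
have Nle t : N t <= r * #|W|.
  rewrite -[r]card_ord -sum_nat_const; apply: leq_sum => j _; rewrite /n.
  by have := card_imset_le (Q t j) W; lia.
have TS : T <= 16 * S + 5 * (r * #|W|).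
  apply: leq_trans (geometric_shift N q) _; rewrite -/S; have := Nle q; have := Nle q.+1; lia.
have S3 : 32 * S <= T.
  have : 64 * (r * q.+1) * S <= 2 * (r * q.+1) * T.
    have le1 : 128 * (r * q.+1) * S <= q0 * S by rewrite leq_mul2r mulnA hq0 orbT.
    have le2 : 2 * (q * S) <= 64 * (r * q.+1) * S.
      by rewrite mulnA leq_mul2r; apply/orP; right; nia.
    have E4 : 2 * (r * (q.+1 * T)) = 2 * (r * q.+1) * T by lia.
    by move: S2; rewrite mulnDr E4; lia.
  have rq : 0 < r * q.+1 by rewrite muln_gt0 r0.
  by move: (r * q.+1) rq => x x0; nia.
have SN : 4 ^ (q - 2) * N 1 <= S.
  rewrite /S (bigD1 (Ordinal q1)) //= /w; exact: leq_addr.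
have E4 : 4 ^ q = 16 * 4 ^ (q - 2) by rewrite -{1}(subnKC q1) expnD.
have N1 : 2 * N 1 <= r.
  have h5 : 4 ^ q * N 1 <= 5 * (r * #|W|) by rewrite E4 -mulnA; lia.
  have h6 : 10 * #|W| * N 1 <= 5 * (r * #|W|) by apply: leq_trans h5; rewrite leq_mul2r h4 orbT.
  have h7 : #|W| * (2 * N 1) <= #|W| * r by lia.
  by rewrite leq_pmul2l in h7.
apply: leq_trans N1; rewrite leq_mul2l /= -sum1dep_card /N big_mkcond /=; apply: leq_sum => j _.
rewrite QE /pval; case: ltnP => // lt.
have := card_imset_le (Q 1 j) W; have : #|A j| <= \sum_(e in A j) #|Q 1 j @: h e|.
  by rewrite -sum1_card; apply: leq_sum => e _; apply: touch_gt0.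
by rewrite /n; lia.
Qed.

End LocalSearch.

(** * The greedy algorithm behind the computation of the strength *)

Section Greedy.
Variables (V E : finType) (h : E -> {set V}) (t : nat) (A : {set E}).

Definition deg (B : {set V}) := #|[set e in A | h e :&: B != set0]|.

Lemma deg_submod B C : deg (B :|: C) + deg (B :&: C) <= deg B + deg C.
Proof.
rewrite /deg -[X in _ <= X]cardsUI; apply: leq_add; apply: subset_leq_card; apply/subsetP => e; rewrite !inE.
  case/andP=> -> /set0Pn[v]; rewrite !inE => /andP[vh /orP[vB|vC]]; apply/orP; [left|right];
  by apply/set0Pn; exists v; rewrite inE vh.
case/andP=> -> /set0Pn[v]; rewrite !inE => /and3P[vh vB vC].
by apply/andP; split; apply/set0Pn; exists v; rewrite inE vh.
Qed.

Lemma deg_le (B C : {set V}) : B \subset C -> deg B <= deg C.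
Proof.
move=> BC; apply: subset_leq_card; apply/subsetP => e; rewrite !inE => /andP[-> /set0Pn[v]].
by rewrite inE => /andP[vh vB]; apply/set0Pn; exists v; rewrite inE vh (subsetP BC).
Qed.

Variables (y : V -> nat) (vs : seq V).
Let ysum (B : {set V}) := \sum_(v in B) y v.

Hypothesis vsu : uniq vs.
(* [y] is computed greedily along [vs], each value being a minimum cut. *)
Hypothesis ymin : forall s1 v s2, vs = s1 ++ v :: s2 ->
  (forall B : {set V}, B \subset [set x in s1] ->
    y v + ysum B <= deg (v |: B) + t * #|B|) /\
  (exists2 B : {set V}, B \subset [set x in s1] & y v + ysum B = deg (v |: B) + t * #|B|).

Let W := [set x in vs].
Hypothesis hW : forall e, h e \subset W.

(** The constraint for [B] was imposed when the member of [B] that is last in [vs] received its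
    value. *)
Lemma greedy_feasible (B : {set V}) : B \subset W -> B != set0 -> ysum B <= deg B + t * (#|B| - 1).
Proof.
move=> BW B0; pose m := \max_(v in B) index v vs.
have [v vB vm] : exists2 v, v \in B & m = index v vs.
  have /eq_bigmax_cond-/(_ (index^~ vs))[v vB e] : 0 < #|B| by rewrite card_gt0.
  by exists v.
have vvs : v \in vs by have := subsetP BW v vB; rewrite inE.
have E1 : vs = take m vs ++ v :: drop m.+1 vs.
  by rewrite -{1}(cat_take_drop m vs) vm (drop_nth v) ?index_mem // nth_index.
have [H _] := ymin E1.
have sub : B :\ v \subset [set x in take m vs].
  apply/subsetP => x; rewrite !inE => /andP[xv xB].
  have xvs : x \in vs by have := subsetP BW x xB; rewrite inE.
  have lt : index x vs < m.
    rewrite ltn_neqAle (leq_bigmax_cond _ xB) andbT vm; apply: contra xv => /eqP e.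
    by rewrite -(nth_index v xvs) e nth_index.
  by rewrite in_take_leq // ltnW // vm index_mem.
have := H _ sub; rewrite setD1K // /ysum (big_setD1 v vB) /= (cardsD1 v B) vB; lia.
Qed.

(** This is Dilworth truncation: the function deg B + t (|B| - 1) is submodular on pairs of
    intersecting sets, and the value of a partition is its sum over the blocks. Feasibility of [y],
    applied to the blocks, gives one inequality. For the other, the union of two intersecting tight
    sets is tight, so the maximal tight sets form a partition of [W], on which equality holds. *)
Lemma greedy_strength : ysum W = strength h W t A.
Proof.
pose fib (L : finType) (f : V -> L) a := [set v in W | f v == a].
have ysumE (L : finType) (f : V -> L) : ysum W = \sum_(a in f @: W) ysum (fib L f a).
  rewrite /ysum (partition_big f (fun a => a \in f @: W)) => [|v vW]; last exact: imset_f.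
  by apply: eq_bigr => a _; apply: eq_bigl => v; rewrite !inE.
have fib0 (L : finType) (f : V -> L) a : a \in f @: W -> fib L f a != set0.
  by move=> /imsetP[v vW av]; apply/set0Pn; exists v; rewrite inE vW av eqxx.
have pvalE (L : finType) (f : V -> L) :
    pval h W t A f = \sum_(a in f @: W) (deg (fib L f a) + t * (#|fib L f a| - 1)).
  rewrite /pval -(sum_fibers hW) big_split -big_distrr /=; congr (_ + _ * _).
    apply: eq_bigr => a _; apply: eq_card => e; rewrite !inE; case: (e \in A) => //=.
    apply/imsetP/set0Pn => [[v vh ->]|[v]].
      by exists v; have := subsetP (hW e) v vh; rewrite !inE vh eqxx andbT.
    by rewrite !inE => /and3P[vh _ /eqP<-]; exists v.
  have cW : #|W| = \sum_(a in f @: W) #|fib L f a|.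
    rewrite -sum1_card (partition_big f (fun a => a \in f @: W)) => [|v vW]; last exact: imset_f.
    by apply: eq_bigr => a _; rewrite -sum1_card; apply: eq_bigl => v; rewrite !inE.
  by rewrite cW -[X in _ - X]sum1_card -sumnB // => a aW; rewrite card_gt0 fib0.
have le1 (L : finType) (f : V -> L) : ysum W <= pval h W t A f.
  rewrite (ysumE L f) pvalE; apply: leq_sum => a aW; apply: greedy_feasible; last exact: fib0.
  by apply/subsetP => u; rewrite inE => /andP[].
apply/eqP; rewrite eqn_leq {1}/strength le1 /=.
pose tight (B : {set V}) := [&& B \subset W, B != set0 & ysum B == deg B + t * (#|B| - 1)].
have tightU B C : tight B -> tight C -> B :&: C != set0 -> tight (B :|: C).
  move=> /and3P[BW B0 /eqP tB] /and3P[CW C0 /eqP tC] BC0; apply/and3P; split.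
  - by rewrite subUset BW.
  - by apply: contra B0; rewrite setU_eq0 => /andP[].
  have f1 := greedy_feasible (_ : B :|: C \subset W) (_ : B :|: C != set0).
  have f2 := greedy_feasible (subset_trans (subsetIl B C) BW) BC0.
  have f1' : ysum (B :|: C) <= deg (B :|: C) + t * (#|B :|: C| - 1).
    by apply: f1; rewrite ?subUset ?BW //; apply: contra B0; rewrite setU_eq0 => /andP[].
  have ys : ysum (B :|: C) + ysum (B :&: C) = ysum B + ysum C.
    rewrite /ysum [X in _ = X + _](big_setID C) /= [X in X + _](big_setID C) /=.
    have -> : (B :|: C) :&: C = C by apply/setIidPr; apply: subsetUr.
    by rewrite setDUl setDv setU0 addnC addnA addnAC.
  have := deg_submod B C; have cUI := cardsUI B C.
  have := card_gt0 B; have := card_gt0 C; have := card_gt0 (B :&: C); rewrite B0 C0 BC0.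
  move=> i0 c0 b0; have u0 : #|B| <= #|B :|: C| by apply: subset_leq_card; apply: subsetUl.
  have : t * (#|B :|: C| - 1) + t * (#|B :&: C| - 1) = t * (#|B| - 1) + t * (#|C| - 1).
    by rewrite -!mulnDr; congr (_ * _); lia.
  by rewrite eqn_leq f1' /=; lia.
have tightV v : v \in W -> exists2 B, tight B & v \in B.
  rewrite inE => vvs; have E1 : vs = take (index v vs) vs ++ v :: drop (index v vs).+1 vs.
    by rewrite -{1}(cat_take_drop (index v vs) vs) (drop_nth v) ?index_mem // nth_index.
  have [_ [B BW e]] := ymin E1; exists (v |: B); last by rewrite setU11.
  have vB : v \notin B.
    apply/negP => /(subsetP BW); rewrite inE => vt; move: vsu; rewrite E1 cat_uniq /= vt.
    by rewrite andbF.
  apply/and3P; split.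
  - rewrite subUset sub1set inE vvs; apply/subsetP => x /(subsetP BW); rewrite !inE.
    exact: mem_take.
  - by apply/set0Pn; exists v; rewrite setU11.
  by rewrite /ysum big_setU1 //= cardsU1 vB e add1n subn1.
pose M v := \bigcup_(B : {set V} | tight B && (v \in B)) B.
have MP v : v \in W -> tight (M v) /\ v \in M v.
  move=> vW; have [B tB vB] := tightV v vW.
  have vM : v \in M v by apply/bigcupP; exists B; rewrite ?tB.
  suff : M v = set0 \/ tight (M v) /\ v \in M v by case=> // e; rewrite e inE in vM.
  rewrite {vM}/M; elim/big_ind: _ => [|X Y [->|[tX vX]] [->|[tY vY]]|X /andP[tX vX]].
  - by left.
  - by left; rewrite setU0.
  - by right; rewrite set0U.
  - by right; rewrite setU0.
  - right; split; last by rewrite inE vX.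
    by apply: tightU => //; apply/set0Pn; exists v; rewrite inE vX.
  by right.
have Msub B v : tight B -> v \in B -> B \subset M v.
  by move=> tB vB; apply: bigcup_sup; rewrite tB.
have ME u v : u \in W -> v \in M u -> M v = M u.
  move=> uW vu; have [tu uu] := MP u uW.
  have vW : v \in W by case/and3P: tu => /subsetP/(_ v vu).
  have [tv vv] := MP v vW; apply/eqP; rewrite eqEsubset (Msub _ v tu) // andbT.
  by apply: (Msub _ _ tv); apply: (subsetP (Msub _ v tu vu)).
have fibM u : u \in W -> fib _ M (M u) = M u.
  move=> uW; apply/setP => v; rewrite inE; apply/andP/idP => [[vW /eqP<-]|vu].
    by case: (MP v vW).
  by rewrite (ME u) // eqxx; have [/and3P[/subsetP/(_ v vu)]] := MP u uW.
apply: leq_trans (strength_le hW t A M) _; rewrite (ysumE _ M) pvalE.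
apply: leq_sum => _ /imsetP[u uW ->]; rewrite fibM //.
by have [/and3P[_ _ /eqP->]] := MP u uW.
Qed.

End Greedy.

(** * Element cuts *)

Section ElementCuts.
Variable V : finType.
Implicit Types (adj : rel V) (TT : seq {set V}) (A B S T W : {set V}) (k : nat).

Definition black TT x := has (fun T : {set V} => x \in T) TT.

Definition splits T A B := (T :&: A != set0) && (T :&: B != set0).

(** The separator is the complement of [A :|: B]; it consists of white nodes, since all terminals
    lie in [A :|: B]. *)
Definition sepcut adj TT A B : Prop :=
  [/\ [disjoint A & B], forall x y, x \in A -> y \in B -> ~~ adj x y,
      forall T, T \in TT -> T \subset A :|: B & has (fun T => splits T A B) TT].

Definition kcut k adj TT := forall A B, sepcut adj TT A B -> k <= #|~: (A :|: B)|.

Lemma splitsP T A B : reflect (exists x y, [/\ x \in T, x \in A, y \in T & y \in B]) (splits T A B).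
Proof.
apply: (iffP andP) => [[/set0Pn[x] + /set0Pn[y]]|[x [y [xT xA yT yB]]]].
  by rewrite !inE => /andP[? ?] /andP[? ?]; exists x, y.
by split; apply/set0Pn; [exists x|exists y]; rewrite inE ?xT ?yT.
Qed.

(** Opposite corners of two crossing cuts have separators of the same total size as the cuts. The
    first cut may be spoiled by edges between [A] and [B], but both ends of such an edge lie in the
    second separator, so no corner is incident to it. Either the two corners of one diagonal or
    those of the other both split a terminal set. *)
Lemma kcut_uncross k adj TT A B A' B' :
  symmetric adj -> kcut k adj TT ->
  [disjoint A & B] -> [disjoint A' & B'] ->
  (forall T, T \in TT -> T \subset A :|: B) -> (forall T, T \in TT -> T \subset A' :|: B') ->
  has (fun T => splits T A B) TT -> has (fun T => splits T A' B') TT ->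
  (forall x y, x \in A' -> y \in B' -> ~~ adj x y) ->
  (forall x y, x \in A -> y \in B -> adj x y -> (x \notin A' :|: B') && (y \notin A' :|: B')) ->
  2 * k <= #|~: (A :|: B)| + #|~: (A' :|: B')|.
Proof.
move=> sa kc dAB dAB' cAB cAB' sp sp' nE' nE.
have dP (X Y : {set V}) x : [disjoint X & Y] -> x \in X -> x \in Y -> False.
  by move=> d xX xY; have := disjointFr d xX; rewrite xY.
have card4 : #|~: ((A :&: A') :|: (B :|: B'))| + #|~: ((B :&: B') :|: (A :|: A'))| =
    #|~: (A :|: B)| + #|~: (A' :|: B')|.
  have cU (X Y : {set V}) : [disjoint X & Y] -> #|~: (X :|: Y)| + #|X| + #|Y| = #|V|.
    move=> d; rewrite -addnA -cardsUI (disjoint_setI0 d) cards0 addn0 addnC; exact: cardsC.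
  have d1 : [disjoint A :&: A' & B :|: B'].
    apply/pred0P => x /=; apply/negP; rewrite !inE => /andP[/andP[xA xA']] /orP[xB|xB].
      exact: dP dAB xA xB.
    exact: dP dAB' xA' xB.
  have d2 : [disjoint B :&: B' & A :|: A'].
    apply/pred0P => x /=; apply/negP; rewrite !inE => /andP[/andP[xB xB']] /orP[xA|xA].
      exact: dP dAB xA xB.
    exact: dP dAB' xA xB'.
  have := cU _ _ d1; have := cU _ _ d2; have := cU _ _ dAB; have := cU _ _ dAB'.
  have := cardsUI A A'; have := cardsUI B B'; lia.
have card4' : #|~: ((A :&: B') :|: (B :|: A'))| + #|~: ((B :&: A') :|: (A :|: B'))| =
    #|~: (A :|: B)| + #|~: (A' :|: B')|.
  have cU (X Y : {set V}) : [disjoint X & Y] -> #|~: (X :|: Y)| + #|X| + #|Y| = #|V|.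
    move=> d; rewrite -addnA -cardsUI (disjoint_setI0 d) cards0 addn0 addnC; exact: cardsC.
  have d1 : [disjoint A :&: B' & B :|: A'].
    apply/pred0P => x /=; apply/negP; rewrite !inE => /andP[/andP[xA xB']] /orP[xB|xA'].
      exact: dP dAB xA xB.
    exact: dP dAB' xA' xB'.
  have d2 : [disjoint B :&: A' & A :|: B'].
    apply/pred0P => x /=; apply/negP; rewrite !inE => /andP[/andP[xB xA']] /orP[xA|xB'].
      exact: dP dAB xA xB.
    exact: dP dAB' xA' xB'.
  have := cU _ _ d1; have := cU _ _ d2; have := cU _ _ dAB; have := cU _ _ dAB'.
  have := cardsUI A B'; have := cardsUI B A'; lia.
have corner (X Y X' Y' : {set V}) : [disjoint X & Y] -> [disjoint X' & Y'] ->
    (forall T, T \in TT -> T \subset X :|: Y) -> (forall T, T \in TT -> T \subset X' :|: Y') ->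
    (forall x y, x \in X -> y \in Y -> adj x y -> (x \notin X' :|: Y')) ->
    (forall x y, x \in X' -> y \in Y' -> ~~ adj x y) ->
    has (fun T => splits T (X :&: X') (Y :|: Y')) TT -> k <= #|~: ((X :&: X') :|: (Y :|: Y'))|.
  move=> dX dX' cX cX' eX eX' sX; apply: kc; split=> //.
  - apply/pred0P => x /=; apply/negP; rewrite !inE => /andP[/andP[xA xA']] /orP[xB|xB].
      exact: dP dX xA xB.
    exact: dP dX' xA' xB.
  - move=> x y; rewrite !inE => /andP[xX xX'] /orP[yY|yY']; last exact: eX'.
    by apply/negP => axy; have := eX x y xX yY axy; rewrite inE xX'.
  move=> T TT'; apply/subsetP => x xT; have := subsetP (cX T TT') x xT; have := subsetP (cX' T TT') x xT.
  by rewrite !inE => /orP[]->; case/orP=> ->; rewrite ?orbT.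
have dBA : [disjoint B & A] by rewrite disjoint_sym.
have dBA' : [disjoint B' & A'] by rewrite disjoint_sym.
have cBA T : T \in TT -> T \subset B :|: A by rewrite setUC; apply: cAB.
have cBA' T : T \in TT -> T \subset B' :|: A' by rewrite setUC; apply: cAB'.
have e1 x y : x \in A -> y \in B -> adj x y -> x \notin A' :|: B'.
  by move=> xA yB /(nE x y xA yB)/andP[].
have e1' x y : x \in A -> y \in B -> adj x y -> x \notin B' :|: A' by rewrite setUC; apply: e1.
have e2 x y : x \in B -> y \in A -> adj x y -> x \notin A' :|: B'.
  by rewrite sa => xB yA /(nE y x yA xB)/andP[].
have e2' x y : x \in B -> y \in A -> adj x y -> x \notin B' :|: A' by rewrite setUC; apply: e2.
have nE2 x y : x \in B' -> y \in A' -> ~~ adj x y by rewrite sa => xB yA; apply: nE'.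
have c1 := corner A B A' B' dAB dAB' cAB cAB' e1 nE'.
have c2 := corner A B B' A' dAB dBA' cAB cBA' e1' nE2.
have c3 := corner B A A' B' dBA dAB' cBA cAB' e2 nE'.
have c4 := corner B A B' A' dBA dBA' cBA cBA' e2' nE2.
have {}c1 : has (fun T => splits T (A :&: A') (B :|: B')) TT -> has (fun T => splits T (B :&: B') (A :|: A')) TT ->
    2 * k <= #|~: (A :|: B)| + #|~: (A' :|: B')|.
  by move=> /c1 h1 /c4 h4; rewrite -card4; lia.
have {}c2 : has (fun T => splits T (A :&: B') (B :|: A')) TT -> has (fun T => splits T (B :&: A') (A :|: B')) TT ->
    2 * k <= #|~: (A :|: B)| + #|~: (A' :|: B')|.
  by move=> /c2 h1 /c3 h4; rewrite -card4'; lia.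
case/hasP: sp => T1 T1T /splitsP[a1 [b1 [a1T a1A b1T b1B]]].
case/hasP: sp' => T2 T2T /splitsP[a2 [b2 [a2T a2A b2T b2B]]].
have loc T x : T \in TT -> x \in T -> (x \in A') || (x \in B').
  by move=> TTT xT; have := subsetP (cAB' T TTT) x xT; rewrite inE.
have loc' T x : T \in TT -> x \in T -> (x \in A) || (x \in B).
  by move=> TTT xT; have := subsetP (cAB T TTT) x xT; rewrite inE.
have mk T (X Y : {set V}) x y : T \in TT -> x \in T -> y \in T -> x \in X -> y \in Y ->
    has (fun T => splits T X Y) TT.
  by move=> TTT xT yT xX yY; apply/hasP; exists T => //; apply/splitsP; exists x, y.
(* The sixteen positions of two split terminals of each cut with respect to the other cut; in each
   of them one of the diagonals works. *)
have [a1q|a1q] := orP (loc _ _ T1T a1T); have [b1q|b1q] := orP (loc _ _ T1T b1T);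
have [a2q|a2q] := orP (loc' _ _ T2T a2T); have [b2q|b2q] := orP (loc' _ _ T2T b2T);
first [ apply: c1; [apply: (mk T1 _ _ a1 b1) => //|apply: (mk T1 _ _ b1 a1) => //]; rewrite !inE; by [apply/andP|apply/orP; auto]
      | apply: c2; [apply: (mk T1 _ _ a1 b1) => //|apply: (mk T1 _ _ b1 a1) => //]; rewrite !inE; by [apply/andP|apply/orP; auto]
      | apply: c1; [apply: (mk T1 _ _ a1 b1) => //|apply: (mk T2 _ _ b2 a2) => //]; rewrite !inE; by [apply/andP|apply/orP; auto]
      | apply: c1; [apply: (mk T2 _ _ a2 b2) => //|apply: (mk T1 _ _ b1 a1) => //]; rewrite !inE; by [apply/andP|apply/orP; auto]
      | apply: c2; [apply: (mk T1 _ _ a1 b1) => //|apply: (mk T2 _ _ a2 b2) => //]; rewrite !inE; by [apply/andP|apply/orP; auto]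
      | apply: c2; [apply: (mk T2 _ _ b2 a2) => //|apply: (mk T1 _ _ b1 a1) => //]; rewrite !inE; by [apply/andP|apply/orP; auto]].
Qed.

Definition del_edge adj p q : rel V := fun x y =>
  adj x y && ~~ ((x == p) && (y == q) || (x == q) && (y == p)).

(** The type of nodes does not change: [q] remains as an isolated node. *)
Definition contract_edge adj p q : rel V := fun x y =>
  [&& x != y, x != q, y != q & [|| adj x y, (x == p) && adj q y | (y == p) && adj x q]].

(** Suppose both operations create separators smaller than [k]. After the contraction the separator
    must contain [p], as otherwise [q] could join the side of [p] and give a small separator of
    [adj]. With [q] added it has at most [k] nodes and contains both ends of the deleted edge, so
    [kcut_uncross] gives 2k <= (k - 1) + k. *)
Lemma reduction_step k adj TT p q :
  symmetric adj -> p != q -> ~~ black TT p -> ~~ black TT q ->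
  kcut k adj TT -> ~ kcut k (del_edge adj p q) TT -> kcut k (contract_edge adj p q) TT.
Proof.
move=> sa pq pw qw kc nk A' B' [d' nE' c' s'].
have wh x T : ~~ black TT x -> T \in TT -> x \notin T.
  by move=> bx TTT; apply: contra bx => xT; apply/hasP; exists T.
rewrite leqNgt; apply/negP => lt.
apply: nk => A B [d nE c s]; rewrite leqNgt; apply/negP => lt2.
have side (X Y : {set V}) : [disjoint X & Y] -> (forall x y, x \in X -> y \in Y -> ~~ contract_edge adj p q x y) ->
    (forall T, T \in TT -> T \subset X :|: Y) -> has (fun T => splits T X Y) TT ->
    #|~: (X :|: Y)| < k -> p \in X -> False.
  move=> dX eX cX sX ltX pX.
  have dP x : x \in X -> x \in Y -> False by move=> xX xY; have := disjointFr dX xX; rewrite xY.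
  suff : k <= #|~: ((q |: X) :|: (Y :\ q))|.
    apply/negP; rewrite -ltnNge; apply: leq_ltn_trans ltX; apply: subset_leq_card.
    by apply/subsetP => x; rewrite !inE; case: (x == q) => //=.
  apply: kc; split.
  - apply/pred0P => x /=; apply/negP; rewrite !inE; case: (x =P q) => //= _ /andP[xX xY].
    exact: dP xX xY.
  - move=> x y; rewrite !inE => /orP[/eqP->|xX] /andP[yq yY].
      apply/negP => aqy; have := eX p y pX yY; rewrite /contract_edge pq yq aqy eqxx orbT /= andbT.
      by case: eqP => // py; case: (dP p) => //; rewrite py.
    apply/negP => axy; case: (x =P q) => [xq|/eqP xq].
      have := eX p y pX yY; rewrite /contract_edge pq yq -xq axy eqxx orbT /= andbT.
      by case: eqP => // py; case: (dP p) => //; rewrite py.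
    have := eX x y xX yY; rewrite /contract_edge xq yq axy /= andbT.
    by case: eqP => // xy; case: (dP x) => //; rewrite xy.
  - move=> T TTT; apply/subsetP => x xT; have := subsetP (cX T TTT) x xT; rewrite !inE.
    have xq : x != q by apply: contra (wh q T qw TTT) => /eqP<-.
    by rewrite xq (negPf xq).
  case/hasP: sX => T TTT /splitsP[x [y [xT xX yT yY]]]; apply/hasP; exists T => //.
  have yq : y != q by apply: contra (wh q T qw TTT) => /eqP<-.
  by apply/splitsP; exists x, y; rewrite !inE xX yY yq orbT.
have symC x y : contract_edge adj p q x y = contract_edge adj p q y x.
  by rewrite /contract_edge (eq_sym x y) (sa x y) (sa q y) (sa x q); case: (y != x); case: (x != q); case: (y != q); rewrite //= orbCA; case: (adj y x) => //=; rewrite orbC.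
have pA' : p \notin A' by apply/negP => /(side _ _ d' nE' c' s' lt).
have pB' : p \notin B'.
  apply/negP => pB; apply: (side B' A') pB => //.
  - by rewrite disjoint_sym.
  - by move=> x y xB yA; rewrite symC; apply: nE'.
  - by move=> T TTT; rewrite setUC; apply: c'.
  - case/hasP: s' => T TTT /splitsP[x [y [xT xX yT yY]]]; apply/hasP; exists T => //.
    by apply/splitsP; exists y, x.
  by rewrite setUC.
have dq : [disjoint A' :\ q & B' :\ q].
  apply/pred0P => x /=; apply/negP; rewrite !inE => /andP[/andP[_ xA] /andP[_ xB]].
  by have := disjointFr d' xA; rewrite xB.
have cq T : T \in TT -> T \subset (A' :\ q) :|: (B' :\ q).
  move=> TTT; apply/subsetP => x xT; have := subsetP (c' T TTT) x xT; rewrite !inE.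
  by have -> : x != q by apply: contra (wh q T qw TTT) => /eqP<-.
have sq : has (fun T => splits T (A' :\ q) (B' :\ q)) TT.
  case/hasP: s' => T TTT /splitsP[x [y [xT xX yT yY]]]; apply/hasP; exists T => //.
  have xq : x != q by apply: contra (wh q T qw TTT) => /eqP<-.
  have yq : y != q by apply: contra (wh q T qw TTT) => /eqP<-.
  by apply/splitsP; exists x, y; rewrite !inE xX yY xq yq.
have := @kcut_uncross k adj TT A B (A' :\ q) (B' :\ q) sa kc d dq c cq s sq.
have H1 x y : x \in A' :\ q -> y \in B' :\ q -> ~~ adj x y.
  rewrite !inE => /andP[xq xA] /andP[yq yB]; apply/negP => axy.
  have := nE' x y xA yB; rewrite /contract_edge xq yq axy /= andbT.
  by case: eqP => // xy; have := disjointFr d' xA; rewrite xy yB.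
have H2 x y : x \in A -> y \in B -> adj x y ->
    (x \notin (A' :\ q) :|: (B' :\ q)) && (y \notin (A' :\ q) :|: (B' :\ q)).
  move=> xA yB axy; have := nE x y xA yB; rewrite /del_edge axy /= negbK.
  by case/orP=> /andP[/eqP-> /eqP->]; rewrite !inE !eqxx /= (negPf pA') (negPf pB') !andbF.
move=> /(_ H1 H2).
have le : #|~: ((A' :\ q) :|: (B' :\ q))| <= #|~: (A' :|: B')| + 1.
  rewrite -(cards1 q); apply: leq_trans (leq_card_setU _ _).1; apply: subset_leq_card.
  by apply/subsetP => x; rewrite !inE; case: (x == q); rewrite ?orbT ?orbF.
lia.
Qed.

Definition elim_vertex adj x : rel V := fun a b =>
  [&& a != x, b != x, a != b & adj a b || adj a x && adj x b].

(** Mere deletion of [x] could destroy connections that pass through it. Once the neighbours of [x]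
    are joined to each other, they cannot occur on both sides of a cut, so [x] can be put on the
    side where it has neighbours and the separator does not grow. *)
Lemma kcut_elim k adj TT x : symmetric adj -> (forall T, T \in TT -> x \in T -> T = [set x]) ->
  kcut k adj TT -> kcut k (elim_vertex adj x) [seq T :\ x | T <- TT].
Proof.
move=> sa hx kc A B [d nE c s].
have dP y : y \in A -> y \in B -> False by move=> yA yB; have := disjointFr d yA; rewrite yB.
have cT T : T \in TT -> T :\ x \subset A :|: B by move=> TTT; apply: c; apply: map_f.
have sT : has (fun T => splits T (A :\ x) (B :\ x)) TT.
  case/hasP: s => _ /mapP[T TTT ->] /splitsP[a [b]]; rewrite !inE => -[/andP[ax aT] aA /andP[bx bT] bB].
  by apply/hasP; exists T => //; apply/splitsP; exists a, b; rewrite !inE ax bx.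
have key (X Y : {set V}) : [disjoint X & Y] -> x \in X -> x \notin Y -> X \subset x |: A :|: B -> 
    (forall a b, a \in X -> b \in Y -> ~~ adj a b) -> (A :|: B) :\ x \subset X :|: Y ->
    has (fun T => splits T X Y) TT -> k <= #|~: (A :|: B)|.
  move=> dXY xX xY _ eXY sub sp; apply: leq_trans (kc X Y _) _; last first.
    apply: subset_leq_card; apply/subsetP => a; rewrite !inE !negb_or => /andP[aX aY].
    have ax : a != x by apply: contra aX => /eqP->.
    apply/andP; split; apply/negP => h; have := subsetP sub a; rewrite !inE ax h ?orbT /= => /(_ isT);
    by rewrite (negPf aX) (negPf aY).
  split=> // T TTT; apply/subsetP => a aT; case: (a =P x) => [->|/eqP ax]; first by rewrite inE xX.
  by apply: (subsetP sub); rewrite !inE ax -in_setU; apply: (subsetP (cT T TTT)); rewrite !inE ax.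
case: (boolP [exists a in A :\ x, adj a x]) => [/existsP[a /andP[]]|/existsPn nA].
  rewrite !inE => /andP[ax aA] aax.
  apply: (key (x |: A) (B :\ x)).
  - apply/pred0P => y /=; apply/negP; rewrite !inE; case: (y =P x) => //= _ /andP[]; exact: dP.
  - by rewrite setU11.
  - by rewrite !inE eqxx.
  - by apply/subsetP => y; rewrite !inE => /orP[]->; rewrite ?orbT.
  - move=> y b; rewrite !inE => /orP[/eqP->|yA] /andP[bx bB].
      apply/negP => xb; have := nE a b aA bB; rewrite /elim_vertex ax bx aax xb orbT andbT /= negbK.
      by move/eqP=> ab; apply: (dP a) => //; rewrite ab.
    apply/negP => yb; case: (y =P x) => [yx|/eqP yx].
      have := nE a b aA bB; rewrite /elim_vertex ax bx aax -yx yb orbT andbT /= negbK.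
      by move/eqP=> ab; apply: (dP a) => //; rewrite ab.
    have := nE y b yA bB; rewrite /elim_vertex yx bx yb andbT /= negbK.
    by move/eqP=> e; apply: (dP y) => //; rewrite e.
  - by apply/subsetP => y; rewrite !inE => /andP[->] /orP[]->; rewrite ?orbT.
  case/hasP: sT => T TTT /splitsP[u [v]]; rewrite !inE => -[uT /andP[_ uA] vT /andP[vx vB]].
  by apply/hasP; exists T => //; apply/splitsP; exists u, v; rewrite !inE uA vx orbT.
apply: (key (x |: B) (A :\ x)).
- apply/pred0P => y /=; apply/negP; rewrite !inE; case: (y =P x) => //= _ /andP[yB yA]; exact: dP yA yB.
- by rewrite setU11.
- by rewrite !inE eqxx.
- by apply/subsetP => y; rewrite !inE => /orP[]->; rewrite ?orbT.
- move=> y b; rewrite !inE => /orP[/eqP->|yB] /andP[bx bA].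
    by have := nA b; rewrite !inE bx bA /= sa.
  case: (y =P x) => [->|/eqP yx]; first by have := nA b; rewrite !inE bx bA /= sa.
  apply/negP => yb; have := nE b y bA yB; rewrite /elim_vertex yx bx sa yb andbT /= negbK.
  by move/eqP=> e; apply: (dP b) => //; rewrite e.
- by apply/subsetP => y; rewrite !inE => /andP[->] /orP[]->; rewrite ?orbT.
case/hasP: sT => T TTT /splitsP[u [v]]; rewrite !inE => -[uT /andP[ux uA] vT /andP[vx vB]].
by apply/hasP; exists T => //; apply/splitsP; exists v, u; rewrite !inE uA vB ux orbT.
Qed.

Definition contract_set adj W (I : {set V}) w : rel V := fun a b =>
  [&& a != b, a \notin I, b \notin I, (a \notin W) || (a == w), (b \notin W) || (b == w) &
    [|| adj a b, (a == w) && [exists x in W, adj x b] | (b == w) && [exists x in W, adj a x]]].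

Definition contract_terms W w T := if T :&: W == set0 then T else w |: (T :\: W).

(** A cut is pulled back along the map that sends [W] to [w]. The nodes of [I] have neighbours in
    [W] only and join the side of [w], which is on a side because it is a terminal. *)
Lemma kcut_contract k adj TT W (I : {set V}) w : symmetric adj -> w \in W -> 
  (forall x, x \in W -> black TT x) -> (forall g, g \in I -> ~~ black TT g) ->
  (forall g x, g \in I -> adj g x -> x \in W) ->
  kcut k adj TT -> kcut k (contract_set adj W I w) [seq contract_terms W w T | T <- TT].
Proof.
move=> sa wW bW wI IW kc A B [d nE c s].
have dP y : y \in A -> y \in B -> False by move=> yA yB; have := disjointFr d yA; rewrite yB.
pose f y := if y \in W then w else y.
pose X := if w \in A then I else set0; pose Y := if w \in A then set0 else I.
have IW0 g : g \in I -> g \notin W by move=> gI; apply: contra (wI g gI); apply: bW.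
have wAB : (w \in A) || (w \in B).
  have /hasP[T TTT wT] := bW w wW; have := c _ (map_f (contract_terms W w) TTT).
  rewrite /contract_terms; have -> : (T :&: W == set0) = false.
    by apply/negbTE/set0Pn; exists w; rewrite inE wT.
  by move/subsetP/(_ w); rewrite setU11 inE; apply.
pose A1 := [set y | (y \notin I) && (f y \in A)] :|: X.
pose B1 := [set y | (y \notin I) && (f y \in B)] :|: Y.
have sub1 : #|~: (A1 :|: B1)| <= #|~: (A :|: B)|.
  apply: subset_leq_card; apply/subsetP => y; rewrite !inE !negb_or.
  case/andP=> /andP[h1 h2] /andP[h3 h4].
  have yI : y \notin I.
    by apply/negP => yI; move: h2 h4; rewrite /X /Y; case: (w \in A); rewrite ?inE ?yI.
  rewrite yI /= in h1 h3; rewrite /f in h1 h3; case: ifP h1 h3 => yW h1 h3; last by rewrite h1.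
  by move: wAB; rewrite (negPf h1) (negPf h3).
apply: leq_trans sub1; apply: kc.
have XP y : y \in X -> y \in I /\ w \in A by rewrite /X; case: ifP; rewrite ?inE.
have YP y : y \in Y -> y \in I /\ w \in B.
  by rewrite /Y; case: ifP => // wA; rewrite ?inE // => yI; move: wAB; rewrite wA.
split.
- apply/pred0P => y /=; apply/negP; rewrite !inE => /andP[/orP[/andP[yI yA]|/XP[yI wA]] /orP[/andP[yI' yB]|/YP[yI' wB]]].
  + exact: dP yA yB.
  + by rewrite yI' in yI.
  + by rewrite yI in yI'.
  + exact: dP wA wB.
- move=> a b; rewrite !inE => /orP[/andP[aI aA]|/XP[aI wA]] /orP[/andP[bI bB]|/YP[bI wB]]; apply/negP => ab.
  + have := nE _ _ aA bB; rewrite /contract_set.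
    have fI z : z \notin I -> f z \notin I.
      by move=> zI; rewrite /f; case: ifP => // _; apply: contraTN wW => wI'; apply: IW0.
    have fW z : (f z \notin W) || (f z == w) by rewrite /f; case: ifP => [_|->]; rewrite ?eqxx ?orbT.
    rewrite !fI // !fW /= negb_and negbK => /orP[/eqP e|].
      by apply: (dP (f a)) => //; rewrite e.
    rewrite /f; case: ifP => aW; case: ifP => bW'; rewrite ?eqxx /=.
    * by move=> _; apply: (dP w); [rewrite /f aW in aA|rewrite /f bW' in bB].
    * by rewrite !negb_or => /and3P[_ /existsPn/(_ a)]; rewrite aW ab.
    * by rewrite !negb_or => /and3P[_ _ /existsPn/(_ b)]; rewrite bW' ab.
    * by rewrite ab.
  + have aW : a \in W by apply: (IW b) => //; rewrite sa.
    by rewrite /f aW in aA; apply: (dP w).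
  + have bW' : b \in W by apply: (IW a).
    by rewrite /f bW' in bB; apply: (dP w).
  + exact: dP wA wB.
- move=> T TTT; apply/subsetP => y yT; rewrite !inE.
  have yI : y \notin I by apply/negP => /wI/negP; apply; apply/hasP; exists T.
  rewrite yI /=; have := c _ (map_f (contract_terms W w) TTT); rewrite /contract_terms /f.
  case: ifP => [/eqP TW|_] /subsetP cT.
    case: ifP => yW; first by have : y \in T :&: W by [rewrite inE yT]; rewrite TW inE.
    by have := cT y yT; rewrite inE => /orP[]->; rewrite ?orbT.
  case: ifP => yW; first by move/orP: wAB => [->|->]; rewrite ?orbT.
  by have := cT y; rewrite !inE yW yT orbT => /(_ isT)/orP[]->; rewrite ?orbT.
case/hasP: s => _ /mapP[T TTT ->] /splitsP[a [b [aT aA bT bB]]]; apply/hasP; exists T => //.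
have pre y : y \in contract_terms W w T -> exists2 z, z \in T & f z = y.
  rewrite /contract_terms /f; case: ifP => [/eqP TW yT|TW].
    exists y => //; case: ifP => // yW; have : y \in T :&: W by rewrite inE yT.
    by rewrite TW inE.
  rewrite !inE => /orP[/eqP->|/andP[yW yT]]; last by exists y => //; rewrite (negPf yW).
  by have /set0Pn[z] := negbT TW; rewrite inE => /andP[zT zW]; exists z => //; rewrite zW.
have [a' a'T a'E] := pre a aT; have [b' b'T b'E] := pre b bT.
have nI y : y \in T -> y \notin I by move=> yT; apply/negP => /wI/negP; apply; apply/hasP; exists T.
by apply/splitsP; exists a', b'; rewrite !inE !nI // a'E b'E aA bB.
Qed.

End ElementCuts.

(** * Lifting connectivity to the original graph *)

Lemma disjointsU (T : finType) (A B C : {set T}) :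
  [disjoint A & C] -> [disjoint B & C] -> [disjoint A :|: B & C].
Proof. by rewrite -!setI_eq0 setIUl setU_eq0 => -> ->. Qed.

Lemma bigcup_disjoint_l (T I : finType) (P : pred I) (F : I -> {set T}) (B : {set T}) :
  (forall i, P i -> [disjoint F i & B]) -> [disjoint \bigcup_(i | P i) F i & B].
Proof. by move=> H; rewrite disjoint_sym; apply/bigcup_disjointP => i Pi; rewrite disjoint_sym H. Qed.

Section Lifting.
Variables (V : finType) (adj0 : rel V) (TT0 : seq {set V}) (r : nat).
Hypothesis sym0 : symmetric adj0.
Implicit Types (adj : rel V) (TT : seq {set V}) (D : V -> {set V}) (C : nat -> {set V}) (U W : {set V}).

Let T0 := [set x | black TT0 x].

Definition gam U : rel V := fun x y => [&& adj0 x y, x \in T0 :|: U & y \in T0 :|: U].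

Lemma gam_sym U : connect_sym (gam U).
Proof. by apply: sym_connect_sym => x y; rewrite /gam sym0; congr (_ && _); rewrite andbC. Qed.

Lemma conn_mono U U' a b : U \subset U' -> connect (gam U) a b -> connect (gam U') a b.
Proof.
move=> s; apply: connect_sub => x y /and3P[xy xU yU]; apply: connect1; rewrite /gam xy /=.
by rewrite !(subsetP (setUS T0 s)).
Qed.

(** Nodes that were merged away or removed persist as isolated nodes with their old contents, so
    disjointness can be claimed only for white nodes that still have a neighbour. *)
Definition wnode adj TT x := ~~ black TT x && [exists y, adj x y].

(* [D x] is the set of original nodes merged into [x], [C j] the [j]-th class. *)
Record linv adj TT D C : Prop := Linv {
  li_sz : size TT = size TT0;
  li_sym : symmetric adj;
  li_irr : irreflexive adj;
  li_bip : forall x y, black TT x -> black TT y -> ~~ adj x y;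
  li_blk : forall x, black TT x -> D x \subset T0;
  li_in : forall j U x a b, j < r -> C j \subset U -> D x \subset T0 :|: U ->
    a \in D x -> b \in D x -> connect (gam U) a b;
  li_adj : forall j U x y, j < r -> C j \subset U -> adj x y -> D x \subset T0 :|: U ->
    D y \subset T0 :|: U -> exists a b, [/\ a \in D x, b \in D y & connect (gam U) a b];
  li_term : forall i, i < size TT0 ->
    (forall a, a \in nth set0 TT0 i -> exists2 x, x \in nth set0 TT i & a \in D x) \/
    (forall j a b, j < r -> a \in nth set0 TT0 i -> b \in nth set0 TT0 i -> connect (gam (C j)) a b);
  li_dis : forall x y, wnode adj TT x -> wnode adj TT y -> x != y -> [disjoint D x & D y];
  li_disC : forall x j, j < r -> wnode adj TT x -> [disjoint D x & C j];
  li_CC : forall i j, i < r -> j < r -> i != j -> [disjoint C i & C j] }.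

Lemma linv_init : irreflexive adj0 -> (forall x y, black TT0 x -> black TT0 y -> ~~ adj0 x y) ->
  linv adj0 TT0 (fun x => [set x]) (fun=> set0).
Proof.
move=> irr bip; split=> //.
- by move=> x bx; rewrite sub1set inE.
- by move=> j U x a b _ _ _ /set1P-> /set1P->.
- move=> j U x y _ _ xy; rewrite !sub1set => xU yU; exists x, y; rewrite !set11; split=> //.
  by apply: connect1; rewrite /gam xy xU.
- by move=> i _; left=> a aT; exists a => //; rewrite set11.
- by move=> x y _ _ xy; rewrite disjoints1 inE.
- by move=> x j _ _; rewrite disjoint_sym disjoints_subset sub0set.
by move=> i j _ _ _; rewrite disjoints_subset sub0set.
Qed.

Lemma linv_sub adj adj' TT D C : symmetric adj' -> subrel adj' adj ->
  linv adj TT D C -> linv adj' TT D C.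
Proof.
move=> sa' sub [h1 h2 h3 h4 h5 h6 h7 h8 h9 h10 h11].
have wn x : wnode adj' TT x -> wnode adj TT x.
  by case/andP=> bx /existsP[y xy]; rewrite /wnode bx; apply/existsP; exists y; apply: sub.
split=> //.
- by move=> x; apply/negP => /sub; rewrite h3.
- by move=> x y bx yb; apply: contra (h4 x y bx yb); apply: sub.
- by move=> j U x y jr CU /sub; apply: (h7 j).
- by move=> x y /wn wx /wn wy; apply: h9.
by move=> x j jr /wn; apply: h10.
Qed.

Lemma linv_contract_edge adj TT D C p q : p != q -> ~~ black TT p -> ~~ black TT q -> adj p q ->
  linv adj TT D C ->
  linv (contract_edge adj p q) TT (fun x => if x == p then D p :|: D q else D x) C.
Proof.
move=> pq pw qw apq [h1 h2 h3 h4 h5 h6 h7 h8 h9 h10 h11].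
have nb x y : black TT x -> ~~ black TT y -> x != y by move=> bx; apply: contra => /eqP<-.
have symc : symmetric (contract_edge adj p q).
  move=> x y; rewrite /contract_edge (eq_sym x y) (h2 x y) (h2 q y) (h2 x q).
  by case: (y != x); case: (x != q); case: (y != q); rewrite //= orbCA; case: (adj y x) => //=; rewrite orbC.
have inpq j U a b : j < r -> C j \subset U -> D p :|: D q \subset T0 :|: U ->
    a \in D p :|: D q -> b \in D p :|: D q -> connect (gam U) a b.
  move=> jr CU; rewrite subUset => /andP[sp sq].
  have [c [d [cp dq cd]]] := h7 j U p q jr CU apq sp sq.
  have pc a' : a' \in D p :|: D q -> connect (gam U) a' c.
    rewrite inE => /orP[ap|aq]; first exact: (h6 j U p).
    by apply: connect_trans (h6 j U q a' d jr CU sq aq dq) _; rewrite gam_sym.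
  by move=> aD bD; apply: connect_trans (pc a aD) _; rewrite gam_sym pc.
have key j U x y : j < r -> C j \subset U -> [|| adj x y, (x == p) && adj q y | (y == p) && adj x q] ->
    (if x == p then D p :|: D q else D x) \subset T0 :|: U ->
    (if y == p then D p :|: D q else D y) \subset T0 :|: U ->
    exists a b, [/\ a \in (if x == p then D p :|: D q else D x),
      b \in (if y == p then D p :|: D q else D y) & connect (gam U) a b].
  move=> jr CU axy.
  have sD z z' : z' \in (if z == p then D p :|: D q else D z) \/ True -> D z \subset (if z == p then D p :|: D q else D z).
    by case: (z =P p) => [->|_] _; rewrite ?subsetUl.
  have sDz z : D z \subset (if z == p then D p :|: D q else D z) by apply: (sD z z); right.
  have sDq z : z == p -> D q \subset (if z == p then D p :|: D q else D z) by move=> ->; rewrite subsetUr.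
  move=> sx sy; case/or3P: axy => [axy|/andP[xp axy]|/andP[yp axy]].
  - have [a [b [aD bD ab]]] := h7 j U x y jr CU axy (subset_trans (sDz x) sx) (subset_trans (sDz y) sy).
    by exists a, b; split=> //; [apply: (subsetP (sDz x))|apply: (subsetP (sDz y))].
  - have [a [b [aD bD ab]]] := h7 j U q y jr CU axy (subset_trans (sDq x xp) sx) (subset_trans (sDz y) sy).
    by exists a, b; split=> //; [apply: (subsetP (sDq x xp))|apply: (subsetP (sDz y))].
  have [a [b [aD bD ab]]] := h7 j U x q jr CU axy (subset_trans (sDz x) sx) (subset_trans (sDq y yp) sy).
  by exists a, b; split=> //; [apply: (subsetP (sDz x))|apply: (subsetP (sDq y yp))].
have wn x : wnode (contract_edge adj p q) TT x -> wnode adj TT x && (x != q).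
  case/andP=> bx /existsP[y /and4P[xy xq yq axy]]; rewrite /wnode bx xq andbT; apply/existsP.
  by case/or3P: axy => [axy|/andP[/eqP xp _]|/andP[_ axq]]; [exists y|exists q; rewrite xp|exists q].
have wp : wnode adj TT p by rewrite /wnode pw; apply/existsP; exists q.
have wq : wnode adj TT q by rewrite /wnode qw; apply/existsP; exists p; rewrite h2.
split=> //.
- by move=> x; rewrite /contract_edge eqxx.
- move=> x y bx yb; apply/negP => /and4P[_ _ _].
  rewrite (negPf (nb _ _ bx pw)) (negPf (nb _ _ yb pw)) /= orbF => axy.
  by have := h4 x y bx yb; rewrite axy.
- by move=> x bx; rewrite (negPf (nb _ _ bx pw)); apply: h5.
- move=> j U x a b jr CU; case: ifP => _; first exact: (inpq j U).
  exact: (h6 j U x).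
- by move=> j U x y jr CU /and4P[_ _ _ axy]; apply: (key j U).
- move=> i iT; have [H|H] := h8 i iT; [left|by right].
  move=> a /H[x xT ax]; exists x => //; case: eqP => // xp.
  by rewrite inE -xp ax.
- move=> x y /wn/andP[wx xq] /wn/andP[wy yq] xy.
  case: (x =P p) => [xp|/eqP xp]; case: (y =P p) => [yp|/eqP yp]; last exact: h9.
  + by rewrite xp yp eqxx in xy.
  + by rewrite disjointsU // h9 // eq_sym.
  + by rewrite disjoint_sym disjointsU // h9 // eq_sym.
move=> x j jr /wn/andP[wx xq]; case: ifP => xp; last exact: h10.
by rewrite disjointsU // h10.
Qed.

(** A new edge stands for a passage through [x]. Since [D x] consists of terminals, which every
    class contains, all classes may use this passage at once. *)
Lemma linv_elim adj TT D C x : black TT x -> (forall T, T \in TT -> x \in T -> T = [set x]) ->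
  linv adj TT D C -> linv (elim_vertex adj x) [seq T :\ x | T <- TT] D C.
Proof.
move=> bx hx [h1 h2 h3 h4 h5 h6 h7 h8 h9 h10 h11].
have bl y : black [seq T :\ x | T <- TT] y = (y != x) && black TT y.
  rewrite /black has_map; case: (y =P x) => [->|/eqP yx] /=.
    by apply/negbTE/hasPn => T _ /=; rewrite !inE eqxx.
  by apply: eq_has => T /=; rewrite !inE yx.
have Dx : D x \subset T0 by apply: h5.
have wn y : wnode (elim_vertex adj x) [seq T :\ x | T <- TT] y -> wnode adj TT y.
  rewrite /wnode bl => /andP[by' /existsP[z /and4P[yx zx yz ayz]]]; rewrite yx /= in by'; rewrite by' /=.
  by apply/existsP; case/orP: ayz => [ayz|/andP[ayx _]]; [exists z|exists x].
split=> //.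
- by rewrite size_map.
- move=> a b; rewrite /elim_vertex (eq_sym a b) (h2 a b) (h2 a x) (h2 x b).
  by case: (a != x); case: (b != x); rewrite //= (andbC (adj x a)).
- by move=> a; rewrite /elim_vertex eqxx !andbF.
- move=> a b; rewrite !bl => /andP[ax ba] /andP[bx' bb]; apply/negP => /and4P[_ _ _ /orP[ab|/andP[ab _]]].
    by have := h4 a b ba bb; rewrite ab.
  by have := h4 a x ba bx; rewrite ab.
- by move=> y; rewrite bl => /andP[_]; apply: h5.
- move=> j U a b jr CU /and4P[ax bx' _ /orP[ab|/andP[ab ab']]] sa sb; first exact: (h7 j U).
  have sx : D x \subset T0 :|: U by apply: subset_trans Dx (subsetUl _ _).
  have [c [d [c1 d1 cd]]] := h7 j U a x jr CU ab sa sx.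
  have [c' [d' [c1' d1' cd']]] := h7 j U x b jr CU ab' sx sb.
  exists c, d'; split=> //; apply: connect_trans cd _; apply: connect_trans cd'.
  exact: (h6 j U x).
- move=> i iT; have iT' : i < size TT by rewrite h1.
  rewrite (nth_map set0) //; have [H|H] := h8 i iT; [|by right].
  case: (boolP (x \in nth set0 TT i)) => [xT|xT].
    (* [x] is all that is left of its terminal set, so the original terminals of the set lie in
       [D x] and are connected in every class. *)
    right=> j a b jr aT bT; have E := hx _ (mem_nth set0 iT') xT; rewrite E in H.
    have [x1 /set1P-> ax] := H a aT; have [x2 /set1P-> bx'] := H b bT.
    by apply: (h6 j (C j) x) => //; apply: subset_trans Dx (subsetUl _ _).
  left=> a /H[y yT ay]; exists y => //; rewrite !inE yT andbT.
  by apply: contra xT => /eqP<-.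
- by move=> a b /wn wa /wn wb; apply: h9.
by move=> y j jr /wn; apply: h10.
Qed.

Definition link adj (A W : {set V}) : rel V := fun x y =>
  [&& x \in W, y \in W & [exists g in A, adj g x && adj g y]].

(** Each class receives its own connector [A j] of [W], so the merged terminal is connected within
    every class. The connectors lie in [I], which becomes isolated; this keeps the contents of the
    remaining white nodes disjoint from the classes. *)
Lemma linv_contract_set adj TT D C W (I : {set V}) w (A : nat -> {set V}) :
  w \in W -> (forall x, x \in W -> black TT x) -> (forall g, g \in I -> ~~ black TT g) ->
  (forall g x, g \in I -> adj g x -> x \in W) ->
  (forall T, T \in TT -> T \subset W \/ [disjoint T & W]) ->
  (forall j, A j \subset I) -> (forall i j, i != j -> [disjoint A i & A j]) ->
  (forall j g, g \in A j -> [exists y, adj g y]) ->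
  (forall j x y, j < r -> x \in W -> y \in W -> connect (link adj (A j) W) x y) ->
  linv adj TT D C ->
  linv (contract_set adj W I w) [seq contract_terms W w T | T <- TT]
    (fun x => if x == w then \bigcup_(y in W) D y else D x)
    (fun j => C j :|: \bigcup_(g in A j) D g).
Proof.
move=> wW bW wI IW tW AI dA nA lA [h1 h2 h3 h4 h5 h6 h7 h8 h9 h10 h11].
set D' := (X in linv _ _ X _); set C' := (X in linv _ _ _ X); set TT' := map _ _; set adj' := contract_set _ _ _ _.
have IW0 g : g \in I -> g \notin W by move=> gI; apply: contra (wI g gI); apply: bW.
have bl y : black TT' y = (y == w) || (y \notin W) && black TT y.
  rewrite /black has_map; case: (y =P w) => [->|/eqP yw] /=.
    have /hasP[T TTT wT] := bW w wW; apply/hasP; exists T => //=; rewrite /contract_terms.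
    case: ifP => [/eqP TW|_]; last by rewrite setU11.
    by have : w \in T :&: W by [rewrite inE wT]; rewrite TW inE.
  case: (boolP (y \in W)) => yW /=.
    apply/negbTE/hasPn => T _ /=; rewrite /contract_terms; case: ifP => [/eqP TW|_].
      by apply/negP => yT; have : y \in T :&: W by [rewrite inE yT]; rewrite TW inE.
    by rewrite !inE negb_or yw yW.
  apply: eq_has => T /=; rewrite /contract_terms; case: ifP => // _.
  by rewrite !inE yW (negPf yw).
have CC' j : C j \subset C' j by apply: subsetUl.
have DW j U x : C' j \subset U -> D' w \subset T0 :|: U -> x \in W -> D x \subset T0 :|: U.
  by move=> _; rewrite /D' eqxx => /subsetP s xW; apply/subsetP => a ax; apply: s; apply/bigcupP; exists x.
(* Induction along a chain of links: consecutive terminals have a common neighbour [g] in [A j], and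
   [D g] has been added to the class. *)
have inW j U a b x y : j < r -> C' j \subset U -> D' w \subset T0 :|: U -> x \in W -> y \in W ->
    a \in D x -> b \in D y -> connect (gam U) a b.
  move=> jr CU sw xW yW ax yb.
  have CU0 : C j \subset U by apply: subset_trans (CC' j) CU.
  have sD z : z \in W -> D z \subset T0 :|: U by apply: (DW j).
  case/connectP: (lA j x y jr xW yW) => p; elim: p x xW a ax => [|z p IH] x xW a ax /=.
    by move=> _ yx; apply: h6 jr CU0 (sD x xW) ax _; rewrite -yx.
  case/andP=> /and3P[_ zW /existsP[g /and3P[gA gx gz]]] pz yE.
  have sg : D g \subset T0 :|: U.
    apply: subset_trans (subsetUr _ _); apply: subset_trans CU; apply: subset_trans (subsetUr _ _).
    by apply/subsetP => c cg; apply/bigcupP; exists g.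
  have [c [d [cg dx cd]]] := h7 j U g x jr CU0 gx sg (sD x xW).
  have [c' [d' [cg' dz' cd']]] := h7 j U g z jr CU0 gz sg (sD z zW).
  apply: connect_trans (h6 j U x a d jr CU0 (sD x xW) ax dx) _.
  apply: (connect_trans (y := c)); first by rewrite gam_sym.
  apply: connect_trans (h6 j U g c c' jr CU0 sg cg cg') _.
  by apply: connect_trans cd' _; apply: IH pz yE.
have wn x : wnode adj' TT' x -> [&& wnode adj TT x, x \notin I & x \notin W].
  rewrite /wnode bl negb_or => /andP[/andP[xw nx] /existsP[y]].
  rewrite /adj' /contract_set (negPf xw) orbF /= => /and5P[xy xI yI xW /andP[_ axy]].
  rewrite xI xW andbT; rewrite xW /= in nx; rewrite nx /= andbT.
  by case/orP: axy => [axy|/andP[_ /existsP[z /andP[_ xz]]]]; apply/existsP; [exists y|exists z].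
have symc : symmetric adj'.
  move=> a b; rewrite /adj' /contract_set (eq_sym a b) (h2 a b).
  have E1 : [exists x in W, adj x b] = [exists x in W, adj b x] by apply: eq_existsb => x; rewrite h2.
  have E2 : [exists x in W, adj a x] = [exists x in W, adj x a] by apply: eq_existsb => x; rewrite h2.
  rewrite E1 E2; case: (b != a) => //=; case: (a \notin I); rewrite ?andbF //=; case: (b \notin I) => //=.
  rewrite [RHS]andbCA; congr (_ && (_ && _)); case: (adj b a) => //=; exact: orbC.
have wnA j g : g \in A j -> wnode adj TT g.
  by move=> gA; rewrite /wnode (nA j g gA) wI // (subsetP (AI j)).
split=> //.
- by rewrite size_map.
- by move=> x; rewrite /adj' /contract_set eqxx.
- have nbw y : black TT y -> ~~ [exists x in W, adj x y].
    by move=> by'; apply/existsPn => x; apply/negP => /andP[xW xy]; have := h4 x y (bW x xW) by'; rewrite xy.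
  have nbw' y : black TT y -> ~~ [exists x in W, adj y x].
    by move=> by'; apply/existsPn => x; apply/negP => /andP[xW xy]; have := h4 y x by' (bW x xW); rewrite xy.
  have bT y : black TT' y -> black TT y by rewrite bl => /orP[/eqP->|/andP[_]//]; apply: bW.
  move=> x y /bT bx /bT by'; apply/negP => /and5P[_ _ _ _ /andP[_]].
  by rewrite (negPf (h4 x y bx by')) (negPf (nbw y by')) (negPf (nbw' x bx)) !andbF.
- move=> x; rewrite bl /D'; case: eqP => [_ _|_ /= /andP[_]]; last exact: h5.
  by apply/bigcupsP => y yW; apply: h5; apply: bW.
- move=> j U x a b jr CU; case: (x =P w) => [->|/eqP xw] sx.
    rewrite {1 2}/D' eqxx => /bigcupP[y yW ay] /bigcupP[z zW bz]; exact: (inW j U a b y z).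
  rewrite /D' (negPf xw) in sx *; apply: h6 jr _ sx; exact: subset_trans (CC' j) CU.
- move=> j U x y jr CU /and5P[xy xI yI xW /andP[yW axy]] sx sy.
  have CU0 : C j \subset U by apply: subset_trans (CC' j) CU.
  have sW z : z \in W -> D z \subset D' w.
    by move=> zW; rewrite /D' eqxx; apply/subsetP => a az; apply/bigcupP; exists z.
  have sE z : z != w -> D z \subset D' z by move=> zw; rewrite /D' (negPf zw).
  have sE' z : D z \subset D' z by case: (z =P w) => [->|/eqP/sE//]; apply: sW.
  have fin x1 y1 : adj x1 y1 -> D x1 \subset D' x -> D y1 \subset D' y ->
      exists a b, [/\ a \in D' x, b \in D' y & connect (gam U) a b].
    move=> a1 s1 s2; have [a [b [aD bD ab]]] := h7 j U x1 y1 jr CU0 a1 (subset_trans s1 sx) (subset_trans s2 sy).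
    by exists a, b; split=> //; [apply: (subsetP s1)|apply: (subsetP s2)].
  case/or3P: axy => [axy|/andP[/eqP xw /existsP[z /andP[zW zy]]]|/andP[/eqP yw /existsP[z /andP[zW zy]]]].
  + exact: fin axy _ _.
  + by apply: fin zy _ _ => //; rewrite xw sW.
  + by apply: fin zy _ _ => //; rewrite yw sW.
- move=> i iT; have iT' : i < size TT by rewrite h1.
  rewrite (nth_map set0) //; have [H|H] := h8 i iT; last first.
    right=> j a b jr aT bT; apply: conn_mono (CC' j) _; exact: H.
  left=> a /H[x xT ax]; rewrite /contract_terms; case: ifP => TW.
    exists x => //; rewrite /D'; case: eqP => // xw; apply/bigcupP; exists w => //.
    by rewrite -xw.
  case: (boolP (x \in W)) => xW.
    by exists w; rewrite ?setU11 // /D' eqxx; apply/bigcupP; exists x.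
  exists x; first by rewrite !inE xT xW orbT.
  by rewrite /D'; case: eqP => // xw; rewrite xw wW in xW.
- move=> x y /wn/and3P[wx xI xW] /wn/and3P[wy yI yW] xy.
  have nw z : z \notin W -> z != w by apply: contra => /eqP->.
  by rewrite /D' (negPf (nw x xW)) (negPf (nw y yW)); apply: h9.
- move=> x j jr /wn/and3P[wx xI xW].
  have xw : x != w by apply: contra xW => /eqP->.
  rewrite /D' (negPf xw) disjoint_sym disjointsU //; first by rewrite disjoint_sym h10.
  apply: bigcup_disjoint_l => g gA; apply: h9 => //; first exact: wnA gA.
  by apply: contra xI => /eqP<-; apply: (subsetP (AI j)).
move=> i j ir jr ij; rewrite disjointsU //.
  rewrite disjoint_sym disjointsU //; first by rewrite h11 // eq_sym.
  by apply: bigcup_disjoint_l => g gA; apply: h10 => //; apply: wnA gA.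
apply: bigcup_disjoint_l => g gA; rewrite disjoint_sym disjointsU //.
  by rewrite disjoint_sym; apply: h10 => //; apply: wnA gA.
apply: bigcup_disjoint_l => g' gA'; apply: h9; [exact: wnA gA'|exact: wnA gA|].
by apply/eqP => e; have := disjointFr (dA i j ij) gA; rewrite -e gA'.
Qed.

End Lifting.

(** * Searching for a well-connected union of terminal sets *)

Section Search.
Variables (V : finType) (adj : rel V) (TT : seq {set V}).
Hypotheses (sa : symmetric adj) (bip : forall x y, black TT x -> black TT y -> ~~ adj x y)
  (bipw : forall x y, ~~ black TT x -> ~~ black TT y -> ~~ adj x y).
Implicit Types (W Y A B : {set V}).

Definition internal W := [set g | ~~ black TT g && [forall y, adj g y ==> (y \in W)]].

Definition adj_in W : rel V := fun x y =>
  adj x y && ((x \in W) && (y \in internal W) || (y \in W) && (x \in internal W)).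

Definition bdry W := [set g | [&& ~~ black TT g, [exists x in W, adj g x] & [exists x, adj g x && (x \notin W)]]].

Definition nbr g := [set x | adj g x].

Lemma sepcut_in W A B : sepcut (adj_in W) [:: W] A B ->
  let Y := W :&: A in [/\ Y != set0, W :\: Y != set0 &
   [set g in internal W | (nbr g :&: Y != set0) && (nbr g :&: (W :\: Y) != set0)] \subset ~: (A :|: B)].
Proof.
case=> d nE c s Y.
have WAB := c W (mem_head _ _).
move: s; rewrite has_seq1 => /splitsP[x [y [xW xA yW yB]]]; split.
- by apply/set0Pn; exists x; rewrite inE xW.
- by apply/set0Pn; exists y; rewrite !inE yW (disjointFl d yB).
apply/subsetP => g; rewrite inE => /and3P[gI /set0Pn[a] + /set0Pn[b]].
rewrite !inE => /and3P[ga aW aA] /and3P[gb + bW]; rewrite bW /= => bA.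
have bB : b \in B by have := subsetP WAB b bW; rewrite inE (negPf bA).
rewrite negb_or; apply/andP; split; apply/negP => gX.
  by have := nE g b gX bB; rewrite /adj_in gb gI bW orbT.
by have := nE a g aA gX; rewrite /adj_in sa ga gI aW.
Qed.

(** Translates node separators into cuts of the hypergraph. Given [Y], a node outside [W] goes to
    the side of [Y] unless it sees [W :\: Y], and to the other side if it sees only [W :\: Y]; the
    rest, which is the separator, consists of internal nodes crossing the cut. *)
Lemma kcut_in W q0 : W \subset [set x | black TT x] -> kcut q0 (adj_in W) [:: W] -> forall Y, Y \subset W -> Y != set0 -> Y != W ->
  q0 <= #|[set g in internal W | (nbr g :&: Y != set0) && (nbr g :&: (W :\: Y) != set0)]|.
Proof.
move=> bW kc Y YW Y0 YnW.
have WI g : g \in internal W -> g \notin W.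
  by rewrite inE => /andP[bg _]; apply: contra bg => /(subsetP bW); rewrite inE.
pose Z := W :\: Y.
pose A := Y :|: [set g | (g \notin W) && ~~ [exists z in Z, adj_in W g z]].
pose B := Z :|: [set g | [&& g \notin W, [exists z in Z, adj_in W g z] & ~~ [exists z in Y, adj_in W g z]]].
have ain x y : adj_in W x y -> (x \in W) = (y \notin W).
  by case/andP=> _ /orP[/andP[-> /WI->]|/andP[-> /WI/negPf->]].
have sin x y : adj_in W x y = adj_in W y x by rewrite /adj_in sa orbC.
apply: leq_trans (kc A B _) _.
  split.
  - apply/pred0P => x /=; apply/negP; rewrite !inE.
    case/andP=> /orP[xY|/andP[xW nx]] /orP[/andP[xY' xW']|/and3P[xW' ex _]].
    + by rewrite xY in xY'.
    + by rewrite (subsetP YW) in xW'.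
    + by rewrite xW' in xW.
    + by rewrite ex in nx.
  - move=> x y; rewrite !inE => /orP[xY|/andP[xW nx]] /orP[/andP[yY yW]|/and3P[yW ey ny]]; apply/negP => axy.
    + by have := ain x y axy; rewrite yW (subsetP YW).
    + by case/existsP: ny; exists x; rewrite xY sin.
    + by case/existsP: nx; exists y; rewrite !inE yY yW.
    + by have := ain x y axy; rewrite yW (negPf xW).
  - move=> T; rewrite inE => /eqP->; apply/subsetP => x xW; rewrite !inE xW.
    by case: (x \in Y).
  rewrite has_seq1; have [y yY] := set0Pn _ Y0.
  have /set0Pn[z zZ] : Z != set0.
    by apply: contra YnW => /eqP Z0; rewrite eqEsubset YW -setD_eq0 -/Z Z0 eqxx.
  apply/splitsP; exists y, z; rewrite !inE (subsetP YW) // yY.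
  by move: zZ; rewrite !inE => /andP[-> ->].
apply: subset_leq_card; apply/subsetP => g; rewrite !inE !negb_or !negb_and !negbK.
case/andP=> /andP[gY h1] /andP[h2 h3].
have gW : g \notin W by apply/negP => gW; move: h2; rewrite gW (negPf gY).
rewrite (negPf gW) /= in h1; case/existsP: (h1) => z /andP[zZ gz].
case/or3P: h3 => [gW'|/existsP[]|/existsP[y /andP[yY gy]]]; [by rewrite gW' in gW|by exists z; rewrite zZ|].
have : g \in internal W by move: gz; rewrite /adj_in (negPf gW) /= => /andP[_ /andP[_]].
rewrite inE => -> /=; apply/andP; split; apply/set0Pn; [exists y|exists z]; rewrite !inE.
  by rewrite yY andbT; case/andP: gy.
by move: zZ; rewrite !inE => ->; rewrite andbT; case/andP: gz.
Qed.

Definition weight W := count (fun T : {set V} => (T != set0) && (T \subset W)) TT.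

(** [s] is the number of cuts made so far. As [W] always contains a nonempty terminal set, the last
    condition bounds [s] by the logarithm of the number of sets ([winv_weight]). *)
Definition winv q0 s W := [/\ W != set0, W \subset [set x | black TT x],
  forall T, T \in TT -> T \subset W \/ [disjoint T & W], #|bdry W| <= s * q0 & 2 ^ s * weight W <= size TT].

Lemma winv_init q0 : [set x | black TT x] != set0 -> winv q0 0 [set x | black TT x].
Proof.
move=> b0; split=> //.
- move=> T TTT; left; apply/subsetP => x xT; rewrite inE; apply/hasP; by exists T.
- rewrite mul0n leqn0 cards_eq0; apply/eqP/setP => g; rewrite !inE; apply/negbTE; rewrite !negb_and negbK.
  case: (boolP (black TT g)) => //= bg; apply/orP; right; apply/existsPn => x; rewrite inE.
  by apply/negP => /andP[gx bx]; have := bipw bg bx; rewrite gx.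
by rewrite mul1n /weight count_size.
Qed.

Lemma winv_weight q0 s W : winv q0 s W -> 2 ^ s <= size TT.
Proof.
case=> /set0Pn[x xW] bW tW _; apply: leq_trans; rewrite leq_pmulr // -has_count.
have := subsetP bW x xW; rewrite inE => /hasP[T TTT xT]; apply/hasP; exists T => //.
have -> : T != set0 by apply/set0Pn; exists x.
by have [//|dT] := tW T TTT; rewrite (disjointFr dT xT) in xW.
Qed.

(** A boundary node of either side is a boundary node of [W] or one of the fewer than [q0] internal
    nodes crossing the cut. The boundary thus has at most s q0 + q0 - 1 nodes, fewer than [k], and
    is too small to separate two terminals of a common set. *)
Lemma winv_step k q0 s W A B : kcut k adj TT -> s.+1 * q0 <= k -> winv q0 s W ->
  sepcut (adj_in W) [:: W] A B -> #|~: (A :|: B)| < q0 ->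
  winv q0 s.+1 (if weight (W :&: A) <= weight (W :\: A) then W :&: A else W :\: A).
Proof.
move=> kc sk [W0 bW tW dW wW] sc lt.
have [Y0 Z0 sub] := sepcut_in sc.
have WDA : W :\: (W :&: A) = W :\: A by rewrite setDIr setDv set0U.
rewrite WDA in Z0 sub.
have {sub lt} lt : #|[set g in internal W | (nbr g :&: (W :&: A) != set0) && (nbr g :&: (W :\: A) != set0)]| < q0.
  by apply: leq_ltn_trans lt; apply: subset_leq_card.
set Y := W :&: A in Y0 lt *; set Z := W :\: A in Z0 lt *.
set X := [set g in _ | _] in lt.
have YZ : Y :|: Z = W by rewrite /Y /Z -setDDr setDv setD0 || (apply/setP => x; rewrite !inE; case: (x \in W); case: (x \in A)).
have bd (P Q : {set V}) : P :|: Q = W -> (forall g, g \in internal W -> nbr g :&: P != set0 -> nbr g :&: Q != set0 -> g \in X) ->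
    bdry P \subset bdry W :|: X.
  move=> PQ PQX; apply/subsetP => g; rewrite inE => /and3P[bg /existsP[x /andP[xP gx]] /existsP[y /andP[gy yP]]].
  have xW : x \in W by rewrite -PQ inE xP.
  rewrite inE; case: (boolP (g \in bdry W)) => //= ng.
  have gI : g \in internal W.
    rewrite inE bg; apply/forallP => z; apply/implyP => gz; apply/negPn/negP => zW; case/negP: ng.
    by rewrite inE bg /=; apply/andP; split; apply/existsP; [exists x; rewrite xW|exists z; rewrite gz].
  apply: PQX => //; apply/set0Pn; [exists x|exists y]; rewrite !inE ?gx //= gy /=.
  have : y \in W by move: gI; rewrite inE => /andP[_ /forallP/(_ y)]; rewrite gy.
  by rewrite -PQ inE (negPf yP).
have bdY : #|bdry Y| <= s * q0 + q0.-1.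
  apply: leq_trans (subset_leq_card (bd Y Z YZ _)) _.
    by move=> g gI gY gZ; rewrite inE gI gY.
  by apply: leq_trans (leq_card_setU _ _).1 _; apply: leq_add => //; lia.
have bdZ : #|bdry Z| <= s * q0 + q0.-1.
  apply: leq_trans (subset_leq_card (bd Z Y _ _)) _; first by rewrite setUC.
    by move=> g gI gZ gY; rewrite inE gI gY.
  by apply: leq_trans (leq_card_setU _ _).1 _; apply: leq_add => //; lia.
have bWP x : x \in W -> black TT x by move=> /(subsetP bW); rewrite inE.
(* A terminal set split by [P] would give a cut of the whole graph that is too small. *)
have nosplit (P : {set V}) : P \subset W -> #|bdry P| <= s * q0 + q0.-1 ->
    forall T, T \in TT -> T \subset P \/ [disjoint T & P].
  move=> PW bP T TTT; case: (boolP (T \subset P)) => [|TnP]; [by left|right].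
  apply/negPn/negP => /pred0Pn[x /andP[/= xT xP]].
  have [y yT yP] := subsetPn TnP.
  suff : k <= #|bdry P| by move: lt bP sk; rewrite mulSn; case: (q0) => [|q1]; lia.
  pose A0 := P :|: [set g | ~~ black TT g && [forall z, adj g z ==> (z \in P)]].
  (* Isolated white nodes belong to [A0] vacuously and have to be kept out of [B0]. *)
  pose B0 := [set z | black TT z && (z \notin P)] :|: [set g | [&& ~~ black TT g, ~~ [exists z in P, adj g z] & [exists z, adj g z]]].
  have wP z : z \in P -> black TT z by move=> zP; apply: bWP; apply: (subsetP PW).
  apply: leq_trans (kc A0 B0 _) _.
    split.
    - apply/pred0P => z /=; apply/negP; rewrite !inE.
      case/andP=> /orP[zP|/andP[bz /forallP za]] /orP[/andP[bz' zP']|/and3P[bz' nz /existsP[w zw]]].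
      + by rewrite zP in zP'.
      + by rewrite (wP z zP) in bz'.
      + by rewrite bz' in bz.
      + by case/existsP: nz; exists w; have := za w; rewrite zw /= => ->.
    - move=> a b; rewrite !inE => /orP[aP|/andP[ba /forallP aa]] /orP[/andP[bb bP']|/and3P[bb nb _]]; apply/negP => ab.
      + by have := bip (wP a aP) bb; rewrite ab.
      + by case/existsP: nb; exists a; rewrite aP sa.
      + by have := aa b; rewrite ab (negPf bP').
      + by have := bipw ba bb; rewrite ab.
    - move=> T' TT'; apply/subsetP => z zT; have bz : black TT z by apply/hasP; exists T'.
      by rewrite !inE bz; case: (z \in P).
    have yb : black TT y by apply/hasP; exists T.
    by apply/hasP; exists T => //; apply/splitsP; exists x, y; rewrite !inE xP yb yP.
  apply: subset_leq_card; apply/subsetP => g; rewrite !inE !negb_or !negb_and !negbK.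
  case/andP=> /andP[gP h1] /andP[h2 h3].
  have bg : ~~ black TT g by apply/negP => bg; move: h2; rewrite bg (negPf gP).
  rewrite bg /=; rewrite (negPf bg) /= in h1 h3; case/existsP: (h1) => z; rewrite negb_imply => gz.
  rewrite andbC; apply/andP; split; first by apply/existsP; exists z.
  by case/orP: h3 => // /existsP[]; exists z; case/andP: gz.
have YW : Y \subset W by apply: subsetIl.
have ZW : Z \subset W by apply: subsetDl.
have wYZ : weight Y + weight Z <= weight W.
  rewrite /weight -count_predUI [X in _ + X <= _](_ : _ = 0) ?addn0.
    apply: sub_count => T /= /orP[/andP[-> TY]|/andP[-> TZ]] /=; [exact: subset_trans TY YW|exact: subset_trans TZ ZW].
  apply/eqP; rewrite -leqn0 leqNgt -has_count; apply/hasPn => T _ /=.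
  apply/negP => /andP[/andP[/set0Pn[x xT] /subsetP TY] /andP[_ /subsetP TZ]].
  by have := TY x xT; have := TZ x xT; rewrite !inE => /andP[/negPf-> _]; rewrite andbF.
have q1 : s * q0 + q0.-1 <= s.+1 * q0 by rewrite mulSn; lia.
have e2 : 2 ^ s.+1 = 2 ^ s + 2 ^ s by rewrite expnS mul2n addnn.
case: ifP => cmp; split=> //.
- exact: subset_trans YW bW.
- exact: nosplit.
- exact: leq_trans bdY q1.
- by apply: leq_trans wW; rewrite e2 mulnDl -mulnDr leq_mul2l; apply/orP; right; apply: leq_trans wYZ; rewrite leq_add2l.
- exact: subset_trans ZW bW.
- exact: nosplit.
- exact: leq_trans bdZ q1.
apply: leq_trans wW; rewrite e2 mulnDl -mulnDr leq_mul2l; apply/orP; right; apply: leq_trans wYZ.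
by rewrite leq_add2r; move: cmp; lia.
Qed.

End Search.

(** * Masks and adjacency matrices as sets and relations *)

Definition rl N (M : seq (seq bool)) : rel 'I_N := fun x y => get false M x y.
Definition st N (l : seq bool) : {set 'I_N} := [set x : 'I_N | nth false l x].
Arguments rl : clear implicits.
Arguments st : clear implicits.

Section Reify.
Variable N : nat.

Lemma rl_mkmx f (x y : 'I_N) : rl N (mkmx N N f) x y = f x y.
Proof. by rewrite /rl get_mkmx. Qed.

Lemma st_mkrow f : st N (mkrow N f) = [set x : 'I_N | f x].
Proof. by apply/setP => x; rewrite !inE nth_mkrow. Qed.

Lemma has_iota (P : pred nat) : has P (iota 0 N) = [exists x : 'I_N, P x].
Proof.
apply/hasP/existsP => [[x]|[x Px]]; last by exists (val x); rewrite ?mem_iota /=.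
by rewrite mem_iota => /= xN Px; exists (Ordinal xN).
Qed.

Lemma all_iota (P : pred nat) : all P (iota 0 N) = [forall x : 'I_N, P x].
Proof.
apply/allP/forallP => [H x|H x]; first by apply: H; rewrite mem_iota /=.
by rewrite mem_iota => /= xN; apply: (H (Ordinal xN)).
Qed.

Lemma count_iota (P : pred nat) : count P (iota 0 N) = #|[set x : 'I_N | P x]|.
Proof.
have -> : iota 0 N = index_iota 0 N by rewrite /index_iota subn0.
by rewrite -sum1_count -sum1_card big_mkord; apply: eq_bigl => x; rewrite inE.
Qed.

Lemma find_iota (P : pred nat) (i := find P (iota 0 N)) : (i < N) = [exists x : 'I_N, P x].
Proof. by rewrite -has_iota has_find size_iota. Qed.

Lemma find_iotaP (P : pred nat) (i := find P (iota 0 N)) : i < N -> P i.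
Proof. by move=> iN; have := nth_find 0 (a := P) (s := iota 0 N); rewrite nth_iota // has_find size_iota; apply. Qed.

Lemma sumn_iota (f : nat -> nat) : sumn [seq f i | i <- iota 0 N] = \sum_(x < N) f x.
Proof.
have -> : iota 0 N = index_iota 0 N by rewrite /index_iota subn0.
by rewrite sumnE big_map big_mkord.
Qed.
End Reify.

Lemma p_sumn X (cX : codable X) (l : X -> seq nat) : PT l -> PT (fun x => sumn (l x)).
Proof.
move=> Hl.
have E s n : foldl addn n s = n + sumn s.
  by elim: s n => [|y s IH] n /=; rewrite ?addn0 // IH addnA.
apply: (@PT_ext _ _ _ _ (fun x => foldl addn 0 (l x))) => [x|]; first by rewrite E.
apply: (PT_foldl (B := fun x => 2 * @sz _ (code_seq code_nat) (l x) + 1)) => //; [by pt|by pt| |].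
  assert (H : pbnd (fun x => sz (l x))) by exact: PT_sz.
  by auto with pbnd.
move=> x i; rewrite E add0n sz_nat.
have le s : sumn s <= @sz _ (code_seq code_nat) s.
  by elim: s => // y s IH; rewrite sz_cons sz_nat /=; lia.
by have := le (take i (l x)); have := sz_take code_nat (l x) i; lia.
Qed.
Ltac pt_al := first [pt_mc | lazymatch goal with
  | |- PT (fun x => sumn (@?l x)) => refine (p_sumn _)
  end].
Ltac pt_user ::= pt_al.

(** * Deciding and finding small element cuts *)

(* Node [x] is split into its entry [x] and its exit [N + x]. *)
Definition split_cap N (adj : seq (seq bool)) (bl : seq bool) a b :=
  if a < N then (if b == N + a then (if nth false bl a then N.+1 else 1) else 0)
  else (if (b < N) && get false adj (a - N) b then N.+1 else 0).

Definition split_net N adj bl := mkmx (N + N) (N + N) (split_cap N adj bl).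

(** The capacity N + 1 acts as infinity, a separator having at most N nodes. No more than that
    leaves the entry of [u], so it is also enough fuel. *)
Definition sep_cut N adj bl u v := mincut (N + N) (split_net N adj bl) u (N + v) N.+1.

(** Certifies a cut directly: no infinite arc is cut, and fewer than [k] white nodes are. The
    minimality of the cut is needed only for completeness, in [sep_cutP]. *)
Definition sep_ok N adj bl k S :=
  [&& all (fun x => all (fun y => (nth false S (N + x) && ~~ nth false S y) ==> ~~ get false adj x y) (iota 0 N)) (iota 0 N),
     all (fun x => nth false bl x && nth false S x ==> nth false S (N + x)) (iota 0 N) &
     count (fun x => nth false S x && ~~ nth false S (N + x)) (iota 0 N) < k].

Definition small_sep N adj bl k T u v :=
  [&& nth false T u, nth false T v, u != v & sep_ok N adj bl k (sep_cut N adj bl u v)].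

Definition blacks N Ts := mkrow N (fun x => has (fun T => nth false T x) Ts).

Definition kcutb N adj Ts k :=
  ~~ has (fun T => has (fun u => has (fun v => small_sep N adj (blacks N Ts) k T u v) (iota 0 N)) (iota 0 N)) Ts.

Definition side_of N adj bl k T :=
  let u := find (fun u => has (fun v => small_sep N adj bl k T u v) (iota 0 N)) (iota 0 N) in
  let v := find (fun v => small_sep N adj bl k T u v) (iota 0 N) in
  mkrow N (fun x => nth false (sep_cut N adj bl u v) (N + x)).

Section SplitNetwork.
Variables (N : nat) (adj : seq (seq bool)) (bl : seq bool).
Let c := get 0 (split_net N adj bl).

Lemma big_cut_split (F : nat -> nat) (S : pred nat) :
  \sum_(u < N + N | S u) F u = \sum_(x < N | S x) F x + \sum_(x < N | S (N + x)) F (N + x).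
Proof.
rewrite big_mkcond big_split_ord /=; congr (_ + _); rewrite [RHS]big_mkcond; exact: eq_bigr.
Qed.

Lemma cut_split S : cut (N + N) c S =
  \sum_(x < N | S x && ~~ S (N + x)) (if nth false bl x then N.+1 else 1) +
  \sum_(x < N | S (N + x)) \sum_(y < N | ~~ S y) (if get false adj x y then N.+1 else 0).
Proof.
rewrite /cut (big_cut_split (fun u => \sum_(v < N + N | ~~ S v) c u v)); congr (_ + _).
  rewrite [RHS]big_mkcondr; apply: eq_bigr => x Sx.
  rewrite (big_cut_split (c x) (predC S)) /= [X in X + _]big1 ?add0n => [|y _]; last first.
    rewrite /c get_mkmx ?ltn_addr // /split_cap ltn_ord; case: eqP => // e.
    by have := ltn_ord y; lia.
  rewrite big_mkcond (bigD1 x) //= big1 ?addn0 => [|y yx].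
    by case: ifP => // _; have xN := ltn_ord x; rewrite /c get_mkmx; [rewrite /split_cap xN eqxx|lia|lia].
  case: ifP => // _; have xN := ltn_ord x; have yN := ltn_ord y; rewrite /c get_mkmx; [rewrite /split_cap xN eqn_add2l|lia|lia].
  by have -> : (y == x :> nat) = false by apply/negbTE.
apply: eq_bigr => x Sx; rewrite (big_cut_split (c (N + x)) (predC S)) /= [X in _ + X]big1 ?addn0 => [|y _].
  apply: eq_bigr => y _; have xN := ltn_ord x; have yN := ltn_ord y.
  by rewrite /c get_mkmx; [rewrite /split_cap ltnNge leq_addr /= yN addnC addnK|lia|lia].
have xN := ltn_ord x; have yN := ltn_ord y; rewrite /c get_mkmx; [|lia|lia].
by rewrite /split_cap ltnNge leq_addr /= ltnNge leq_addr.
Qed.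

Lemma sep_cutP k u v (A B : {set 'I_N}) : nth false bl u -> nth false bl v -> u != v ->
  [disjoint A & B] -> (forall x y, x \in A -> y \in B -> ~~ rl N adj x y) ->
  (forall x : 'I_N, nth false bl x -> x \in A :|: B) ->
  (exists2 x : 'I_N, x \in A & val x = u) -> (exists2 y : 'I_N, y \in B & val y = v) ->
  #|~: (A :|: B)| < k -> sep_ok N adj bl k (sep_cut N adj bl u v).
Proof.
move=> bu bv uv d nE bAB [x0 x0A ux] [y0 y0B vy] lt.
have uN : u < N by rewrite -ux ltn_ord.
have vN : v < N by rewrite -vy ltn_ord.
subst u v.
pose inA a := [exists x in A, val x == a]; pose inB a := [exists x in B, val x == a].
have inAE (x : 'I_N) : inA x = (x \in A).
  by apply/existsP/idP => [[y /andP[yA /eqP/val_inj<-]]//|xA]; exists x; rewrite xA eqxx.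
have inBE (x : 'I_N) : inB x = (x \in B).
  by apply/existsP/idP => [[y /andP[yA /eqP/val_inj<-]]//|xA]; exists x; rewrite xA eqxx.
(* The cut of the network that corresponds to [(A, B)]: entries outside [B] and exits in [A], so
   that exactly the arcs of the separating nodes are cut. *)
pose S' a := if a < N then ~~ inB a else inA (a - N).
have S1 (x : 'I_N) : S' x = (x \notin B) by rewrite /S' ltn_ord inBE.
have S2 (x : 'I_N) : S' (N + x) = (x \in A) by rewrite /S' ltnNge leq_addr /= addnC addnK inAE.
have cS' : cut (N + N) c S' = #|~: (A :|: B)|.
  rewrite cut_split [X in _ + X]big1 ?addn0 => [|x]; last first.
    rewrite S2 => xA; apply: big1 => y; rewrite S1 negbK => yB.
    by have := nE x y xA yB; rewrite /rl => /negPf->.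
  rewrite -sum1_card big_mkcond [RHS]big_mkcond; apply: eq_bigr => x _.
  rewrite S1 S2 !inE negb_or andbC; case: ifP => // /andP[xA xB].
  case: ifP => // bx; have := bAB x bx; by rewrite inE (negPf xA) (negPf xB).
have leN : cut (N + N) c S' <= N by rewrite cS' -[X in _ <= X]card_ord; apply: max_card.
have := @mincutP (N + N) (split_net N adj bl) (val x0) (N + val y0) _ _ N.+1 _ _.
rewrite -/c -/(sep_cut N adj bl (val x0) (val y0)); move: (sep_cut N adj bl _ _) => Sq; set S := nth false Sq.
case; first by rewrite ltn_addr.
- by rewrite ltn_add2l.
- by apply/eqP => e; move: uN; rewrite e ltnNge leq_addr.
- rewrite cut_split [X in _ + X]big1 ?addn0 => [|x /=]; last by move=> /eqP e; have := ltn_ord x0; rewrite -e ltnNge leq_addr.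
  rewrite (bigD1 x0) /=; last by rewrite eqxx; apply/eqP => e; have := ltn_ord x0; rewrite -e ltnNge leq_addr.
  rewrite big1 ?addn0; first by case: ifP.
  by move=> x /andP[/andP[/eqP xu _] /eqP]; case; apply: val_inj.
move=> Su Sv /(_ S'); rewrite S1 (disjointFr d x0A) S2 (disjointFl d y0B) => /(_ isT isT) le.
have leN' : cut (N + N) c S <= N by apply: leq_trans le leN.
rewrite cut_split in leN'.
have big0 : \sum_(x < N | S (N + x)) \sum_(y < N | ~~ S y) (if get false adj x y then N.+1 else 0) = 0.
  apply: big1 => x Sx; apply: big1 => y Sy; case: ifP => // a; exfalso; move: leN'; apply/negP; rewrite -ltnNge.
  apply: leq_trans (leq_addl _ _); rewrite (bigD1 x) //= (bigD1 y) //= a -addnA; exact: leq_addr.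
apply/and3P; split.
- rewrite all_iota; apply/forallP => x; rewrite all_iota; apply/forallP => y; apply/implyP => /andP[Sx Sy].
  by apply/negP => a; move: big0; rewrite (bigD1 x) //= (bigD1 y) //= a !addSn.
- rewrite all_iota; apply/forallP => x; apply/implyP => /andP[bx Sx]; apply/negPn/negP => Sx'.
  have Sxx : S x && ~~ S (N + x) by rewrite /S Sx.
  by move: leN'; rewrite (bigD1 x Sxx) /= bx -!addnA addSn ltnNge leq_addr.
rewrite count_iota; apply: leq_ltn_trans lt; rewrite -cS'; apply: leq_trans le.
rewrite cut_split -sum1_card; apply: leq_trans (leq_addr _ _).
rewrite big_mkcond [X in _ <= X]big_mkcond; apply: leq_sum => x _; rewrite inE -/S.
by case: ifP => // _; case: ifP.
Qed.

Lemma sep_okP k S : sep_ok N adj bl k S ->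
  let A := [set x : 'I_N | nth false S (N + x)] in
  let B := [set x : 'I_N | ~~ nth false S x && ~~ nth false S (N + x)] in
  [/\ [disjoint A & B], forall x y, x \in A -> y \in B -> ~~ rl N adj x y,
    forall x : 'I_N, nth false bl x -> x \in A :|: B & #|~: (A :|: B)| < k].
Proof.
case/and3P; rewrite !all_iota count_iota => /forallP h1 /forallP h2 h3 A B; split.
- by apply/pred0P => x /=; rewrite !inE; case: (nth false S (N + x)); rewrite ?andbF.
- move=> x y; rewrite !inE => Sx /andP[Sy _]; have := h1 x; rewrite all_iota => /forallP/(_ y).
  by rewrite Sx Sy.
- by move=> x bx; rewrite !inE; have := h2 x; rewrite bx /=; case: (nth false S x); case: (nth false S (N + x)).
apply: leq_ltn_trans h3; apply: subset_leq_card; apply/subsetP => x; rewrite !inE.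
by case: (nth false S x); case: (nth false S (N + x)).
Qed.

End SplitNetwork.

Section DecideCuts.
Variables (N : nat) (adj : seq (seq bool)) (Ts : seq (seq bool)) (k : nat).
Let TT := [seq st N T | T <- Ts].

Lemma blacksE (x : 'I_N) : nth false (blacks N Ts) x = black TT x.
Proof. by rewrite nth_mkrow // /black has_map; apply: eq_has => T /=; rewrite inE. Qed.

Lemma small_sepP T u v : T \in Ts -> u < N -> v < N -> small_sep N adj (blacks N Ts) k T u v ->
  let A := st N (mkrow N (fun x => nth false (sep_cut N adj (blacks N Ts) u v) (N + x))) in
  exists2 B, sepcut (rl N adj) TT A B /\ splits (st N T) A B & #|~: (A :|: B)| < k.
Proof.
move=> TTs uN vN /and4P[Tu Tv uv ok].
have := sep_okP ok; rewrite /= st_mkrow; set S := sep_cut _ _ _ _ _ in ok *.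
set A := [set x | _]; set B := [set x | _ && _] => -[d nE c lt]; exists B => //.
have uB : nth false (blacks N Ts) u by rewrite nth_mkrow //; apply/hasP; exists T.
have vB : nth false (blacks N Ts) v by rewrite nth_mkrow //; apply/hasP; exists T.
have cT T' : T' \in TT -> T' \subset A :|: B.
  by move=> /mapP[T1 T1T ->]; apply/subsetP => x xT; apply: c; rewrite blacksE; apply/hasP; exists (st N T1) => //; apply: map_f.
have [Su Sv] : nth false S u /\ ~~ nth false S (N + v).
  have := @mincutP (N + N) (split_net N adj (blacks N Ts)) u (N + v) _ _ N.+1 _ _.
  case=> //; first by rewrite ltn_addr.
  - by rewrite ltn_add2l.
  - by apply/eqP => e; lia.
  rewrite cut_split [X in _ + X]big1 ?addn0 => [|x /=]; last by move=> /eqP e; lia.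
  rewrite (bigD1 (Ordinal uN)) /=; last by rewrite eqxx; apply/eqP => e; lia.
  rewrite big1 ?addn0; first by case: ifP.
  by move=> x /andP[/andP[/eqP xu _] /eqP]; case; apply: val_inj.
have sp : splits (st N T) A B.
  apply/splitsP; exists (Ordinal uN), (Ordinal vN); rewrite !inE /=.
  have /and3P[_ + _] := ok; rewrite all_iota => /forallP h2.
  have := h2 (Ordinal uN); rewrite /= uB Su => /= ->; split=> //; rewrite Sv andbT.
  by have := h2 (Ordinal vN); rewrite /= vB (negPf Sv) implybF.
by split=> //; split=> //; apply/hasP; exists (st N T) => //; apply: map_f.
Qed.

Lemma kcutP : reflect (kcut k (rl N adj) TT) (kcutb N adj Ts k).
Proof.
apply: (iffP idP) => [/hasPn H A B [d nE c /hasP[_ /mapP[T TTs ->]]]|kc].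
  case/splitsP=> u [v]; rewrite !inE => -[Tu uA Tv vB].
  rewrite leqNgt; apply/negP => lt; have := H T TTs; rewrite has_iota => /existsPn/(_ u).
  rewrite has_iota => /existsPn/(_ v); apply/negP/negPn.
  have uv : u != v :> nat by apply/eqP => /val_inj e; have := disjointFr d uA; rewrite e vB.
  rewrite /small_sep Tu Tv uv /=; apply: (@sep_cutP N adj _ k u v A B) => //.
  - by rewrite blacksE; apply/hasP; exists (st N T); [apply: map_f|rewrite inE].
  - by rewrite blacksE; apply/hasP; exists (st N T); [apply: map_f|rewrite inE].
  - by move=> x; rewrite blacksE => /hasP[T' TT' xT']; apply: (subsetP (c T' TT')).
  - by exists u.
  - by exists v.
apply/hasPn => T TTs; rewrite has_iota; apply/existsPn => u; rewrite has_iota; apply/existsPn => v.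
apply/negP => /(small_sepP TTs (ltn_ord u) (ltn_ord v))[B [sc _]].
by rewrite ltnNge kc.
Qed.
End DecideCuts.

Lemma side_ofP N adj T k : ~~ kcutb N adj [:: T] k ->
  let A := st N (side_of N adj (blacks N [:: T]) k T) in
  exists2 B, sepcut (rl N adj) [:: st N T] A B & #|~: (A :|: B)| < k.
Proof.
rewrite /kcutb negbK has_seq1 has_find size_iota => uN.
rewrite /side_of; set u := find _ _ in uN *.
have := find_iotaP uN; rewrite has_find size_iota; set v := find _ _ => vN.
by have [//|B [sc _] lt] := @small_sepP N adj [:: T] k T u v _ uN vN (find_iotaP vN); [rewrite inE|exists B].
Qed.

Lemma PT_sep_cut : PT (fun p : (nat * seq (seq bool)) * (seq bool * (nat * nat)) =>
  sep_cut p.1.1 p.1.2 p.2.1 p.2.2.1 p.2.2.2).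
Proof. by rewrite /sep_cut /split_net /split_cap; pt. Qed.

Lemma p_sep_cut X (cX : codable X) (N : X -> nat) adj bl u v :
  PT N -> PT adj -> PT bl -> PT u -> PT v -> PT (fun x => sep_cut (N x) (adj x) (bl x) (u x) (v x)).
Proof.
move=> HN Ha Hb Hu Hv.
exact: (PT_comp (PT_pair (PT_pair HN Ha) (PT_pair Hb (PT_pair Hu Hv))) PT_sep_cut).
Qed.

Lemma p_sep_ok X (cX : codable X) (N : X -> nat) adj bl k S :
  PT N -> PT adj -> PT bl -> PT k -> PT S -> PT (fun x => sep_ok (N x) (adj x) (bl x) (k x) (S x)).
Proof. by move=> HN Ha Hb Hk HS; rewrite /sep_ok; pt. Qed.

Lemma p_small_sep X (cX : codable X) (N : X -> nat) adj bl k T u v :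
  PT N -> PT adj -> PT bl -> PT k -> PT T -> PT u -> PT v ->
  PT (fun x => small_sep (N x) (adj x) (bl x) (k x) (T x) (u x) (v x)).
Proof.
move=> HN Ha Hb Hk HT Hu Hv; rewrite /small_sep.
assert (Hs := p_sep_ok HN Ha Hb Hk (p_sep_cut HN Ha Hb Hu Hv)); pt.
Qed.

Ltac pt_al1 := first [pt_al | lazymatch goal with
  | |- PT (fun x => small_sep (@?N x) (@?a x) (@?b x) (@?k x) (@?T x) (@?u x) (@?v x)) => refine (p_small_sep _ _ _ _ _ _ _)
  | |- PT (fun x => sep_cut (@?N x) (@?a x) (@?b x) (@?u x) (@?v x)) => refine (p_sep_cut _ _ _ _ _)
  end].
Ltac pt_user ::= pt_al1.

Lemma p_blacks X (cX : codable X) (N : X -> nat) Ts : PT N -> PT Ts -> PT (fun x => blacks (N x) (Ts x)).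
Proof. by move=> HN HT; rewrite /blacks; pt. Qed.

Ltac pt_al1b := first [pt_al1 | lazymatch goal with
  | |- PT (fun x => blacks (@?N x) (@?T x)) => refine (p_blacks _ _)
  end].
Ltac pt_user ::= pt_al1b.

Lemma p_kcutb X (cX : codable X) (N : X -> nat) adj Ts k :
  PT N -> PT adj -> PT Ts -> PT k -> PT (fun x => kcutb (N x) (adj x) (Ts x) (k x)).
Proof.
move=> HN Ha HT Hk; rewrite /kcutb; pt.
Qed.

Lemma p_side_of X (cX : codable X) (N : X -> nat) adj bl k T :
  PT N -> PT adj -> PT bl -> PT k -> PT T -> PT (fun x => side_of (N x) (adj x) (bl x) (k x) (T x)).
Proof. by move=> HN Ha Hb Hk HT; rewrite /side_of; pt. Qed.

Ltac pt_al2 := first [pt_al1b | lazymatch goal with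
  | |- PT (fun x => kcutb (@?N x) (@?a x) (@?T x) (@?k x)) => refine (p_kcutb _ _ _ _)
  | |- PT (fun x => side_of (@?N x) (@?a x) (@?b x) (@?k x) (@?T x)) => refine (p_side_of _ _ _ _ _)
  end].
Ltac pt_user ::= pt_al2.

(** * One phase of the algorithm, on matrices *)

Definition del_mx N adj p q := mkmx N N (fun x y =>
  get false adj x y && ~~ ((x == p) && (y == q) || (x == q) && (y == p))).

Definition contract_mx N adj p q := mkmx N N (fun x y =>
  [&& x != y, x != q, y != q & [|| get false adj x y, (x == p) && get false adj q y | (y == p) && get false adj x q]]).

Definition merge_mx N pay p q := mkmx N N (fun x a =>
  if x == p then get false pay p a || get false pay q a else get false pay x a).

Definition wwedge (adj : seq (seq bool)) bl p q := [&& ~~ nth false bl p, ~~ nth false bl q & get false adj p q].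

Definition reduce_step N Ts k (s : seq (seq bool) * seq (seq bool)) :=
  let bl := blacks N Ts in
  let p := find (fun p => has (fun q => wwedge s.1 bl p q) (iota 0 N)) (iota 0 N) in
  let q := find (fun q => wwedge s.1 bl p q) (iota 0 N) in
  if p < N then
    if kcutb N (del_mx N s.1 p q) Ts k then (del_mx N s.1 p q, s.2)
    else (contract_mx N s.1 p q, merge_mx N s.2 p q)
  else s.

Definition reduce N Ts k s := iter (N.+1 * (N * N).+1) (reduce_step N Ts k) s.

Definition internal_mask N adj bl W := mkrow N (fun g =>
  ~~ nth false bl g && all (fun y => get false adj g y ==> nth false W y) (iota 0 N)).

Definition adj_in_mx N adj I W := mkmx N N (fun x y =>
  get false adj x y && (nth false W x && nth false I y || nth false W y && nth false I x)).

Definition weight_mask N (Ts : seq (seq bool)) W := count (fun T =>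
  has (fun x => nth false T x) (iota 0 N) && all (fun x => nth false T x ==> nth false W x) (iota 0 N)) Ts.

Definition search_step N adj Ts q0 W :=
  let aw := adj_in_mx N adj (internal_mask N adj (blacks N Ts) W) W in
  if kcutb N aw [:: W] q0 then W else
  let A := side_of N aw (blacks N [:: W]) q0 W in
  let Y := mkrow N (fun x => nth false W x && nth false A x) in
  let Z := mkrow N (fun x => nth false W x && ~~ nth false A x) in
  if weight_mask N Ts Y <= weight_mask N Ts Z then Y else Z.

Definition search N adj Ts q0 L := iter L.+1 (search_step N adj Ts q0) (blacks N Ts).

Definition elim_mx N adj x := mkmx N N (fun a b =>
  [&& a != x, b != x, a != b & get false adj a b || get false adj a x && get false adj x b]).

Definition elim_masks N Ts x := [seq mkrow N (fun y => (y != x) && nth false T y) | T <- Ts].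

Definition contract_set_mx N adj W I w := mkmx N N (fun a b =>
  [&& a != b, ~~ nth false I a, ~~ nth false I b, ~~ nth false W a || (a == w), ~~ nth false W b || (b == w) &
    [|| get false adj a b, (a == w) && has (fun x => nth false W x && get false adj x b) (iota 0 N)
      | (b == w) && has (fun x => nth false W x && get false adj a x) (iota 0 N)]]).

Definition contract_masks N Ts W w := [seq mkrow N (fun y =>
  if has (fun x => nth false T x && nth false W x) (iota 0 N) then (y == w) || ~~ nth false W y && nth false T y
  else nth false T y) | T <- Ts].

Definition union_mx N pay W w := mkmx N N (fun x a =>
  if x == w then has (fun y => nth false W y && get false pay y a) (iota 0 N) else get false pay x a).

(* [cls] lists the elements of each of the [r] classes to be added. *)
Definition extend_mx N r C pay cls := mkmx r N (fun j a =>
  get false C j a || has (fun g => get false cls j g && get false pay g a) (iota 0 N)).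

Definition py N (pay : seq (seq bool)) (x : 'I_N) : {set 'I_N} := [set a : 'I_N | get false pay x a].
Definition cl N (C : seq (seq bool)) (j : nat) : {set 'I_N} := [set a : 'I_N | get false C j a].
Arguments py : clear implicits.
Arguments cl : clear implicits.

Section PhaseSpec.
Variable N : nat.
Implicit Types (adj pay C : seq (seq bool)) (p q x : 'I_N).
Notation rl := (rl N).
Notation st := (st N).
Notation py := (py N).
Notation cl := (cl N).

Lemma rl_eq adj (e : rel 'I_N) : (forall x y, rl adj x y = e x y) -> rl adj = e.
Proof. by move=> H; do 2 apply: functional_extensionality => ?; apply: H. Qed.

Lemma py_eq pay D : (forall x, py pay x = D x) -> py pay = D.
Proof. by move=> H; apply: functional_extensionality. Qed.

Lemma del_mxE adj p q : rl (del_mx N adj p q) = del_edge (rl adj) p q.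
Proof. by apply: rl_eq => x y; rewrite rl_mkmx. Qed.

Lemma contract_mxE adj p q : rl (contract_mx N adj p q) = contract_edge (rl adj) p q.
Proof. by apply: rl_eq => x y; rewrite rl_mkmx. Qed.

Lemma merge_mxE pay p q : py (merge_mx N pay p q) = fun x => if x == p then py pay p :|: py pay q else py pay x.
Proof.
apply: py_eq => x; apply/setP => a; rewrite inE get_mkmx //.
by rewrite (_ : (nat_of_ord x == p) = (x == p)) //; case: ifP => _; rewrite !inE.
Qed.

Lemma internal_maskE adj Ts W :
  st (internal_mask N adj (blacks N Ts) W) = internal (rl adj) (map st Ts) (st W).
Proof.
rewrite st_mkrow; apply/setP => g; rewrite !inE -blacksE; congr (_ && _).
by rewrite all_iota; apply: eq_forallb => y; rewrite inE.
Qed.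

Lemma adj_in_mxE adj Ts W :
  rl (adj_in_mx N adj (internal_mask N adj (blacks N Ts) W) W) = adj_in (rl adj) (map st Ts) (st W).
Proof.
apply: rl_eq => x y; rewrite rl_mkmx /adj_in -internal_maskE !inE; congr (_ && _).
Qed.

Lemma weight_maskE Ts W : weight_mask N Ts W = weight (map st Ts) (st W).
Proof.
rewrite /weight_mask /weight count_map; apply: eq_count => T /=; congr (_ && _).
  by rewrite has_iota; apply/existsP/set0Pn => -[x]; [move=> Tx; exists x; rewrite inE|rewrite inE; exists x].
rewrite all_iota; apply/forallP/subsetP => H x; first by rewrite !inE => Tx; have := H x; rewrite Tx.
by apply/implyP => Tx; have := H x; rewrite !inE; apply.
Qed.

Lemma elim_mxE adj x : rl (elim_mx N adj x) = elim_vertex (rl adj) x.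
Proof. by apply: rl_eq => a b; rewrite rl_mkmx. Qed.

Lemma elim_masksE Ts x : map st (elim_masks N Ts x) = [seq T :\ x | T <- map st Ts].
Proof.
rewrite -!map_comp; apply: eq_map => T /=; rewrite st_mkrow; apply/setP => y.
by rewrite !inE.
Qed.

Lemma contract_set_mxE adj W I w : rl (contract_set_mx N adj W I (val w)) = contract_set (rl adj) (st W) (st I) w.
Proof.
apply: rl_eq => a b; rewrite rl_mkmx /contract_set !inE !has_iota.
by do 5 congr (_ && _); congr [|| _, _ && _ | _ && _]; apply: eq_existsb => x; rewrite inE.
Qed.

Lemma contract_masksE Ts W w : map st (contract_masks N Ts W (val w)) = [seq contract_terms (st W) w T | T <- map st Ts].
Proof.
rewrite -!map_comp; apply: eq_map => T /=; rewrite st_mkrow /contract_terms has_iota.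
have -> : (st T :&: st W == set0) = ~~ [exists x : 'I_N, nth false T x && nth false W x].
  apply/eqP/existsPn => [e x|H]; first by have := in_set0 x; rewrite -e !inE => ->.
  by apply/setP => x; rewrite !inE; apply/negbTE/H.
by case: [exists x : 'I_N, _] => /=; apply/setP => y; rewrite !inE.
Qed.

Lemma union_mxE pay W w : py (union_mx N pay W (val w)) =
  fun x => if x == w then \bigcup_(y in st W) py pay y else py pay x.
Proof.
apply: py_eq => x; apply/setP => a; rewrite inE get_mkmx //.
have -> : (nat_of_ord x == val w) = (x == w) by [].
case: ifP => _; last by rewrite inE.
rewrite has_iota; apply/existsP/bigcupP => [[y /andP[yW ya]]|[y]].
  by exists y; rewrite inE.
by rewrite !inE => yW ya; exists y; rewrite yW.
Qed.

Lemma extend_mxE r C pay cls j : j < r ->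
  cl (extend_mx N r C pay cls) j = cl C j :|: \bigcup_(g in cl cls j) py pay g.
Proof.
move=> jr; apply/setP => a; rewrite !inE get_mkmx //; congr (_ || _).
rewrite has_iota; apply/existsP/bigcupP => [[y /andP[yW ya]]|[y]].
  by exists y; rewrite inE.
by rewrite !inE => yW ya; exists y; rewrite yW.
Qed.

Section Invariant.
Variables (adj0 : rel 'I_N) (TT0 : seq {set 'I_N}) (r k : nat).
Hypothesis sym0 : symmetric adj0.

Definition minv adj pay Ts C :=
  linv adj0 TT0 r (rl adj) (map st Ts) (py pay) (cl C) /\ kcut k (rl adj) (map st Ts).

Definition edges adj := [set z : 'I_N * 'I_N | rl adj z.1 z.2].
Definition live adj := [set x | [exists y, rl adj x y]].

(** A lexicographic measure: a contraction isolates [q] and lowers the number of non-isolated nodes,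
    a deletion lowers the number of edges. A contraction may create edges, but there are never more
    than [N * N]; this determines the number of rounds of [reduce]. *)
Lemma reduce_stepP Ts C s : minv s.1 s.2 Ts C ->
  let s' := reduce_step N Ts k s in
  minv s'.1 s'.2 Ts C /\
  ((forall x y, ~~ black (map st Ts) x -> ~~ black (map st Ts) y -> ~~ rl s.1 x y) /\ s' = s \/
   #|live s'.1| * (N * N).+1 + #|edges s'.1| < #|live s.1| * (N * N).+1 + #|edges s.1|).
Proof.
move=> [li kc] s'; rewrite {}/s' /reduce_step.
set p := find (fun p : nat => has [eta wwedge s.1 (blacks N Ts) p] (iota 0 N)) (iota 0 N).
set q := find [eta wwedge s.1 (blacks N Ts) p] (iota 0 N).
case: ltnP => pN; last first.
  split=> //; left; split=> // x y bx yb; apply/negP => xy.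
  suff : p < N by rewrite ltnNge pN.
  rewrite /p find_iota; apply/existsP; exists x; rewrite has_iota; apply/existsP; exists y.
  by rewrite /wwedge !blacksE bx yb.
have qN : q < N by have := find_iotaP pN; rewrite has_find size_iota.
have := find_iotaP qN; rewrite -/q /wwedge.
pose p' := Ordinal pN; pose q' := Ordinal qN.
rewrite -[p]/(val p') -[q]/(val q') !blacksE => /and3P[bp bq pq].
have sa := li_sym li; have ir := li_irr li.
have npq : p' != q' by apply/eqP => e; move: pq; rewrite e -/(rl s.1 q' q') ir.
have sub : subrel (del_edge (rl s.1) p' q') (rl s.1) by move=> x y /andP[].
have liveE (a : seq (seq bool)) : #|edges a| <= N * N.
  by rewrite -[X in _ <= X](_ : #|{: 'I_N * 'I_N}| = _) ?max_card // card_prod card_ord.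
case: (kcutP N (del_mx N s.1 p' q') Ts k) => kd; rewrite del_mxE in kd.
  split.
    rewrite /minv del_mxE; split=> //; apply: linv_sub li => //.
    by move=> x y; rewrite /del_edge sa orbC (andbC (y == q')) (andbC (y == p')).
  right; rewrite /=.
  have l1 : #|live (del_mx N s.1 p' q')| <= #|live s.1|.
    apply: subset_leq_card; apply/subsetP => x; rewrite !inE del_mxE => /existsP[y /sub xy].
    by apply/existsP; exists y.
  have l2 : #|edges (del_mx N s.1 p' q')| < #|edges s.1|.
    apply: proper_card; apply/properP; split.
      by apply/subsetP => z; rewrite !inE del_mxE; apply: sub.
    by exists (p', q'); rewrite ?inE // del_mxE /del_edge /= !eqxx andbF.
  by rewrite -addnS; apply: leq_add => //; rewrite leq_mul2r l1 orbT.
split.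
  rewrite /minv contract_mxE merge_mxE; split; first exact: linv_contract_edge.
  exact: reduction_step.
right; rewrite /=.
have l1 : #|live (contract_mx N s.1 p' q')| < #|live s.1|.
  apply: proper_card; apply/properP; split.
    apply/subsetP => x; rewrite !inE contract_mxE => /existsP[y /and4P[xy xq yq axy]]; apply/existsP.
    by case/or3P: axy => [axy|/andP[/eqP xp _]|/andP[_ axq]]; [exists y|exists q'; rewrite xp|exists q'].
  exists q'; first by rewrite inE; apply/existsP; exists p'; rewrite sa.
  by rewrite inE contract_mxE; apply/existsPn => y; rewrite /contract_edge eqxx !andbF.
have := liveE (contract_mx N s.1 p' q'); move: l1.
move: #|live (contract_mx N s.1 p' q')| #|live s.1| #|edges _| #|edges _| => a b c d ab cN.
apply: (@leq_trans (a.+1 * (N * N).+1)); last by apply: leq_trans (leq_addr _ _); rewrite leq_mul2r ab orbT.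
by rewrite mulSn addnC ltn_add2r ltnS.
Qed.

Lemma reduceP Ts C s : minv s.1 s.2 Ts C -> let s' := reduce N Ts k s in
  minv s'.1 s'.2 Ts C /\ forall x y, ~~ black (map st Ts) x -> ~~ black (map st Ts) y -> ~~ rl s'.1 x y.
Proof.
move=> mi; rewrite /reduce.
pose mu (s : seq (seq bool) * seq (seq bool)) := #|live s.1| * (N * N).+1 + #|edges s.1|.
have : mu s < N.+1 * (N * N).+1.
  have h1 : #|edges s.1| <= N * N.
    by rewrite -[X in _ <= X](_ : #|{: 'I_N * 'I_N}| = _) ?max_card // card_prod card_ord.
  have h2 : #|live s.1| <= N by rewrite -[X in _ <= X]card_ord max_card.
  apply: (@leq_trans (#|live s.1| * (N * N).+1 + (N * N).+1)); first by rewrite /mu ltn_add2l ltnS.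
  by rewrite -mulSnr leq_mul2r ltnS h2 orbT.
elim: (N.+1 * _) s mi => // n IH s mi lt; rewrite iterSr.
have [mi' [[nw e]|lt']] := reduce_stepP mi.
  rewrite e; have -> : iter n (reduce_step N Ts k) s = s by elim: (n) => //= i ->.
  by split.
by apply: IH => //; apply: leq_trans lt' _; rewrite -ltnS.
Qed.

(** The search must have stopped at a set without small cuts: if all [L.+1] rounds had cut,
    [winv_weight] would give 2 ^ L.+1 <= size Ts. *)
Lemma searchP adj pay Ts C (q0 L : nat) : minv adj pay Ts C ->
  (forall x y, ~~ black (map st Ts) x -> ~~ black (map st Ts) y -> ~~ rl adj x y) ->
  L.+1 * q0 <= k -> size Ts < 2 ^ L.+1 -> (exists x, black (map st Ts) x) ->
  let W := st (search N adj Ts q0 L) in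
  (exists s, winv (rl adj) (map st Ts) q0 s W) /\ kcut q0 (adj_in (rl adj) (map st Ts) W) [:: W].
Proof.
move=> [li kc] bipw Lk szT [x0 bx0] W.
have sa := li_sym li; have bip := li_bip li.
pose Wi i := st (iter i (search_step N adj Ts q0) (blacks N Ts)).
have W0 : Wi 0 = [set x | black (map st Ts) x] by apply/setP => x; rewrite inE -blacksE inE.
suff key i : i <= L.+1 -> winv (rl adj) (map st Ts) q0 i (Wi i) \/
    (exists s, winv (rl adj) (map st Ts) q0 s (Wi i)) /\ kcut q0 (adj_in (rl adj) (map st Ts) (Wi i)) [:: Wi i].
  have [//|wi|//] := key L.+1.
  by have := winv_weight wi; rewrite size_map leqNgt szT.
elim: i => [_|i IH iL].
  by left; rewrite W0; apply: winv_init => //; apply/set0Pn; exists x0; rewrite inE.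
have stepE : Wi i.+1 = st (search_step N adj Ts q0 (iter i (search_step N adj Ts q0) (blacks N Ts))) by [].
move: stepE IH; rewrite /Wi; move: (iter i _ _) => V -> IH; rewrite /search_step.
case: kcutP => kd.
  rewrite /= adj_in_mxE in kd; right; split=> //.
  by have [h|[h _]] := IH (ltnW iL) => //; exists i.
have nk : ~~ kcutb N (adj_in_mx N adj (internal_mask N adj (blacks N Ts) V) V) [:: V] q0 by apply/kcutP.
have [B] := side_ofP nk; rewrite adj_in_mxE => sc lt.
have [wi|[_ kd']] := IH (ltnW iL); last by case: kd; rewrite /= adj_in_mxE.
left; have sk : i.+1 * q0 <= k by apply: leq_trans Lk; rewrite leq_mul2r iL orbT.
have := winv_step sa bip bipw kc sk wi sc lt.
set A := side_of _ _ _ _ _.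
have -> : st V :&: st A = st (mkrow N (fun x : nat => nth false V x && nth false A x)).
  by rewrite st_mkrow; apply/setP => x; rewrite !inE.
have -> : st V :\: st A = st (mkrow N (fun x : nat => nth false V x && ~~ nth false A x)).
  by rewrite st_mkrow; apply/setP => x; rewrite !inE andbC.
by rewrite -!weight_maskE; case: ifP.
Qed.

End Invariant.
End PhaseSpec.

(** Bounds the size of a Boolean matrix with [N] rows and columns: an entry has size at most 3, and
    each list cell adds 1. *)
Definition bsz N := N * (N * 4 + 2) + 1.

Lemma sz_bmx m N (f : nat -> nat -> bool) : m <= N -> @sz _ (code_seq (code_seq code_bool)) (mkmx m N f) <= bsz N.
Proof.
move=> mN; apply: leq_trans (@sz_mkmx _ _ m N f 3 _) _; first by move=> i j _ _; rewrite sz_bool; case: (f i j).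
by rewrite /bsz leq_add2r leq_mul2r mN orbT.
Qed.

Lemma sz_brow N (f : nat -> bool) : @sz _ (code_seq code_bool) (mkrow N f) <= bsz N.
Proof.
apply: leq_trans (@sz_mkrow _ _ N f 3 _) _; first by move=> i _; rewrite sz_bool; case: (f i).
by rewrite /bsz; case: N => // N; nia.
Qed.

Lemma pbnd_bsz X (cX : codable X) (N : X -> nat) : pbnd N -> pbnd (fun x => bsz (N x)).
Proof. by rewrite /bsz => H; auto 10 with pbnd. Qed.
#[export] Hint Resolve pbnd_bsz : pbnd.

Lemma p_reduce X (cX : codable X) (N : X -> nat) Ts k s :
  PT N -> PT Ts -> PT k -> PT s -> PT (fun x => reduce (N x) (Ts x) (k x) (s x)).
Proof.
move=> HN HT Hk Hs; rewrite /reduce.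
apply: (p_iter (B := fun x => 2 * sz (s x) + 2 * bsz (N x) + 3)).
- by rewrite /reduce_step /del_mx /contract_mx /merge_mx /wwedge; pt.
- exact: Hs.
- by pt.
- assert (H1 := PT_sz Hs); assert (H2 := pbnd_nat HN); by auto 10 with pbnd.
move=> x i _; set B := sz (s x) + bsz (N x).
have : sz (iter i (reduce_step (N x) (Ts x) (k x)) (s x)).1 <= B /\
       sz (iter i (reduce_step (N x) (Ts x) (k x)) (s x)).2 <= B.
  elim: i => [|i [IH1 IH2]] /=.
    rewrite /B; case: (s x) => a b; rewrite sz_pair /=; lia.
  rewrite {1 3}/reduce_step; case: ifP => // _; case: ifP => _ /=; split=> //;
  by apply: leq_trans (sz_bmx _ (leqnn _)) _; rewrite /B leq_addl.
rewrite /B; case: (iter _ _ _) => a b; rewrite sz_pair /=; lia.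
Qed.

Ltac pt_a2 := first [pt_al2 | lazymatch goal with
  | |- PT (fun x => reduce (@?N x) (@?T x) (@?k x) (@?s x)) => refine (p_reduce _ _ _ _)
  end].
Ltac pt_user ::= pt_a2.

Lemma p_search X (cX : codable X) (N : X -> nat) adj Ts q0 L :
  PT N -> PT adj -> PT Ts -> PT q0 -> PT L -> PT (fun x => search (N x) (adj x) (Ts x) (q0 x) (L x)).
Proof.
move=> HN Ha HT Hq HL; rewrite /search.
apply: (p_iter (B := fun x => bsz (N x))).
- by rewrite /search_step /adj_in_mx /internal_mask /weight_mask; pt.
- by pt.
- by pt.
- assert (H2 := pbnd_nat HN); by auto with pbnd.
move=> x i _; elim: i => [|i IH] /=; first exact: sz_brow.
by rewrite {1}/search_step; case: ifP => // _; case: ifP => _; apply: sz_brow.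
Qed.

(** * Computing the strength of a hypergraph *)

Definition degree N (adj : seq (seq bool)) (A B : seq bool) := count (fun e =>
  nth false A e && has (fun x => nth false B x && get false adj e x) (iota 0 N)) (iota 0 N).

(** Acts as infinity: it exceeds the value of the cut belonging to the empty set [B], which is at
    most [N] plus the sum of the earlier values. *)
Definition greedy_big N (ys : seq nat) := (sumn ys + N).+1.

(* The vertices are the nodes below [N], the element [e] is the node [N + e],
   the source is [N + N] and the sink is [(N + N).+1]. *)
Definition greedy_cap N (adj : seq (seq bool)) (W A : seq bool) t (ys : seq nat) a b :=
  let v := size ys in
  if a < N then
    if b == (N + N).+1 then (if (a < v) && nth false W a then t else 0)
    else if [&& N <= b, b < N + N, nth false A (b - N) & get false adj (b - N) a] then greedy_big N ys else 0
  else if a < N + N then (if (b == (N + N).+1) && nth false A (a - N) then 1 else 0)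
  else if a == N + N then
    if b == v then greedy_big N ys else if [&& b < v, b < N & nth false W b] then nth 0 ys b else 0
  else 0.

Definition greedy_cut N adj W A t ys := mincut (N + N).+2
  (mkmx (N + N).+2 (N + N).+2 (greedy_cap N adj W A t ys)) (N + N) (N + N).+1 (2 * greedy_big N ys).

(** The minimum with [N] does not alter the greedy value, which is at most the degree of the new
    vertex. It makes the result polynomially bounded on every input. *)
Definition greedy_val N adj W A t ys :=
  let v := size ys in
  if nth false W v then
    let S := greedy_cut N adj W A t ys in
    let B := mkrow N (fun u => [&& u < v, nth false W u & nth false S u]) in
    minn N (degree N adj A (mkrow N (fun u => (u == v) || nth false B u)) +
            t * count (fun u => nth false B u) (iota 0 N) -
            sumn [seq if nth false B u then nth 0 ys u else 0 | u <- iota 0 N])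
  else 0.

Definition greedy N adj W A t := iter N (fun ys => ys ++ [:: greedy_val N adj W A t ys]) [::].

Definition strength_alg N adj W A t := sumn (greedy N adj W A t).

Section GreedyCut.
Variables (N : nat) (adj : seq (seq bool)) (W A : seq bool) (t : nat) (ys : seq nat) (v : 'I_N).
Hypothesis vE : v = size ys :> nat.
Let c := get 0 (mkmx (N + N).+2 (N + N).+2 (greedy_cap N adj W A t ys)).
Let big := greedy_big N ys.
Let proc := [set u : 'I_N | (u < v) && nth false W u].
Let dg (B : {set 'I_N}) := #|[set e : 'I_N | nth false A e && [exists x in B, get false adj e x]]|.

Lemma big_greedy_split (F : nat -> nat) (S : pred nat) : \sum_(u < (N + N).+2 | S u) F u =
  \sum_(x < N | S x) F x + \sum_(x < N | S (N + x)) F (N + x) +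
  (if S (N + N) then F (N + N) else 0) + (if S (N + N).+1 then F (N + N).+1 else 0).
Proof.
rewrite big_mkcond !big_ord_recr /=; congr (_ + _ + _).
rewrite -(@big_cut_split N F S) [RHS]big_mkcond /=; exact: eq_bigr.
Qed.

Lemma greedy_cutE (S : nat -> bool) : S (N + N) -> ~~ S (N + N).+1 -> cut (N + N).+2 c S =
  \sum_(u < N | S u) ((if u \in proc then t else 0) +
     \sum_(e < N | ~~ S (N + e)) (if nth false A e && get false adj e u then big else 0)) +
  \sum_(e < N | S (N + e)) nth false A e +
  \sum_(u < N | ~~ S u) (if u == v then big else if u \in proc then nth 0 ys u else 0).
Proof.
move=> Ss St; have vN := ltn_ord v.
rewrite /cut (big_greedy_split (fun u => \sum_(w < (N + N).+2 | ~~ S w) c u w)) Ss (negPf St) addn0.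
congr (_ + _ + _).
- apply: eq_bigr => u Su; have uN := ltn_ord u.
  rewrite (big_greedy_split (c u) (predC S)) /= Ss St addn0 [X in X + _ + _]big1 ?add0n => [|x _]; last first.
    have xN := ltn_ord x; rewrite /c get_mkmx; [|lia|lia]; rewrite /greedy_cap uN.
    have -> : (nat_of_ord x == (N + N).+1) = false by apply/eqP; lia.
    by rewrite leqNgt xN.
  rewrite addnC; congr (_ + _).
    by rewrite /c get_mkmx; [|lia|lia]; rewrite /greedy_cap uN eqxx inE vE.
  apply: eq_bigr => e _; have eN := ltn_ord e; rewrite /c get_mkmx; [|lia|lia].
  rewrite /greedy_cap uN; have -> : (N + e == (N + N).+1) = false by apply/eqP; lia.
  by rewrite leq_addr ltn_add2l eN addnC addnK.
- apply: eq_bigr => e _; have eN := ltn_ord e.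
  have ce b : b < (N + N).+2 -> c (N + e) b = (b == (N + N).+1) && nth false A e.
    move=> bN; rewrite /c get_mkmx; [|lia|lia].
    by rewrite /greedy_cap ltnNge leq_addr /= ltn_add2l eN addnC addnK; case: (_ && _).
  rewrite (big_greedy_split (c (N + e)) (predC S)) /= Ss St addn0 !big1 ?add0n => [|x _|x _].
  + by rewrite ce // eqxx.
  + have xN := ltn_ord x; rewrite ce; [|lia].
    by have -> : (N + x == (N + N).+1) = false by apply/eqP; lia.
  have xN := ltn_ord x; rewrite ce; [|lia].
  by have -> : (nat_of_ord x == (N + N).+1) = false by apply/eqP; lia.
have cs b : b < (N + N).+2 -> c (N + N) b = if b == size ys then big else
    if [&& b < size ys, b < N & nth false W b] then nth 0 ys b else 0.
  move=> bN; rewrite /c get_mkmx; [|lia|lia].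
  by rewrite /greedy_cap ltnNge leq_addr /= ltnn eqxx.
rewrite (big_greedy_split (c (N + N)) (predC S)) /= Ss St addn0.
rewrite [X in _ + X + _]big1 ?addn0 => [|x _]; last first.
  have xN := ltn_ord x; rewrite cs; [|lia].
  have -> : (N + x == size ys) = false by rewrite -vE; apply/eqP; lia.
  by have -> : (N + x < N) = false; [lia|rewrite andbF].
rewrite cs; [|lia].
have -> : ((N + N).+1 == size ys) = false by rewrite -vE; apply/eqP; lia.
have -> : ((N + N).+1 < N) = false by lia.
rewrite andbF addn0; apply: eq_bigr => u _; have uN := ltn_ord u; rewrite cs; [|lia].
by rewrite -vE inE uN; congr (if _ then _ else _).
Qed.

(** The source side consists of the new vertex, [B] and the elements they touch. The cut pays 1 for
    each such element, [t] for each member of [B] and the values of the processed vertices left out;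
    up to a constant this is the function that the greedy step minimises. *)
Lemma greedy_cut_of (B : {set 'I_N}) : B \subset proc -> exists S : nat -> bool,
  [/\ S (N + N), ~~ S (N + N).+1 & cut (N + N).+2 c S =
    dg (v |: B) + t * #|B| + \sum_(u in proc :\: B) nth 0 ys u].
Proof.
move=> Bp; have vN := ltn_ord v.
pose S a := if a < N then [exists x in v |: B, val x == a] else
  if a < N + N then nth false A (a - N) && [exists x in v |: B, get false adj (a - N) x] else a == N + N.
have S1 (u : 'I_N) : S u = (u \in v |: B).
  rewrite /S ltn_ord; apply/existsP/idP => [[x /andP[xB /eqP/val_inj<-]]//|uB].
  by exists u; rewrite uB eqxx.
have S2 (e : 'I_N) : S (N + e) = nth false A e && [exists x in v |: B, get false adj e x].
  by rewrite /S ltnNge leq_addr /= ltn_add2l ltn_ord addnC addnK.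
have Ss : S (N + N) by rewrite /S ltnNge leq_addr /= ltnn.
have St : ~~ S (N + N).+1 by rewrite /S; case: ltnP => [|_]; [lia|]; case: ltnP => [|_]; lia.
exists S; split=> //; rewrite greedy_cutE //; congr (_ + _).
  rewrite addnC; congr (_ + _).
    rewrite /dg -sum1_card [RHS]big_mkcond [LHS]big_mkcond; apply: eq_bigr => e _.
    by rewrite S2 inE; case: (nth false A e); rewrite //= ?if_same; case: ifP.
  rewrite big_split /= [X in _ + X]big1 ?addn0 => [|u Su]; last first.
    apply: big1 => e; rewrite S2 negb_and; case: (nth false A e) => //= /existsPn/(_ u).
    by rewrite -S1 Su /= => /negPf->.
  rewrite -big_mkcondr /= sum_nat_const mulnC; congr (_ * _); apply: eq_card => u.
  rewrite unfold_in /= S1 !inE; case: (u =P v) => [->|_] /=.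
    rewrite ltnn /=; apply/esym/negbTE/negP => /(subsetP Bp).
    by rewrite inE ltnn.
  by case uB: (u \in B) => //=; have := subsetP Bp u uB; rewrite inE => ->.
rewrite [LHS]big_mkcond [RHS]big_mkcond; apply: eq_bigr => u _; rewrite S1 !inE.
by case: (u =P v) => [->|_] /=; [rewrite ltnn andbF|case: (u \in B); rewrite ?andbF].
Qed.

Lemma greedy_cutP (S := nth false (greedy_cut N adj W A t ys)) (B := [set u in proc | S u]) :
  forall B' : {set 'I_N}, B' \subset proc ->
  dg (v |: B) + t * #|B| + \sum_(u in B') nth 0 ys u <= dg (v |: B') + t * #|B'| + \sum_(u in B) nth 0 ys u.
Proof.
have vN := ltn_ord v.
have ysum : \sum_(u in proc) nth 0 ys u <= sumn ys.
  rewrite sumnE (big_nth 0) big_mkord -vE.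
  rewrite (big_ord_widen N (fun i => nth 0 ys i) (ltnW vN)).
  rewrite big_mkcond [X in _ <= X]big_mkcond; apply: leq_sum => u _; rewrite inE.
  by case: (u < v) => //=; case: ifP.
have Dsum (B1 : {set 'I_N}) : B1 \subset proc ->
    \sum_(u in proc) nth 0 ys u = \sum_(u in B1) nth 0 ys u + \sum_(u in proc :\: B1) nth 0 ys u.
  by move=> s; rewrite (big_setID B1) /= (setIidPr s).
have := @mincutP (N + N).+2 (mkmx (N + N).+2 (N + N).+2 (greedy_cap N adj W A t ys)) (N + N) (N + N).+1 _ _ (2 * big) _ _.
rewrite -/c -/(greedy_cut N adj W A t ys) -/S.
rewrite /B; clear B; clearbody S; set B := [set u in proc | S u]; case.
- by rewrite ltnW.
- by [].
- by rewrite neq_ltn ltnSn.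
- rewrite greedy_cutE /= ?eqxx //; last by rewrite neq_ltn ltnSn orbT.
  rewrite big1 ?add0n => [|u /eqP e]; last by have := ltn_ord u; rewrite e ltnNge leq_addr.
  rewrite big1 ?add0n => [|e /eqP]; last by have := ltn_ord e; lia.
  have vne : val v != N + N by apply/eqP; move=> /= e; have := ltn_ord v; lia.
  rewrite (bigD1 v) //= eqxx mul2n -addnn leq_add2l.
  apply: leq_trans (leq_trans ysum _); last by rewrite /big /greedy_big; lia.
  rewrite big_mkcond [X in _ <= X]big_mkcond; apply: leq_sum => u _.
  by case: (u =P v) => [->|_]; rewrite ?eqxx ?andbF // andbT; case: ifP.
move=> Ss St min.
(* So a minimum cut avoids all infinite arcs: its source side contains [v] and every element of [A]
   touched by one of its vertices. *)
have fin : cut (N + N).+2 c S < big.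
  have [S' [S's S't S'E]] := greedy_cut_of (sub0set proc).
  apply: leq_ltn_trans (min S' S's S't) _; rewrite {}S'E cards0 muln0 addn0 setD0 /big /greedy_big ltnS addnC.
  by apply: leq_add => //; rewrite -[X in _ <= X]card_ord; apply: max_card.
rewrite greedy_cutE // in fin.
have Sv : S v.
  apply/negPn/negP => nv; move: fin; apply/negP; rewrite -leqNgt (bigD1 (P := fun u : 'I_N => ~~ S u) v) //= eqxx.
  by apply: leq_trans (leq_addl _ _); apply: leq_addr.
have Se (u e : 'I_N) : S u -> nth false A e -> get false adj e u -> S (N + e).
  move=> Su Ae aeu; apply/negPn/negP => ne; move: fin; apply/negP; rewrite -leqNgt.
  rewrite (bigD1 u) //= (bigD1 (P := fun e : 'I_N => ~~ S (N + e)) e) //= Ae aeu.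
  by do 2 apply: leq_trans (leq_addr _ _); apply: leq_trans (leq_addr _ _); apply: leq_trans (leq_addl _ _); apply: leq_addr.
have Bp : B \subset proc by apply/subsetP => u; rewrite !inE => /andP[].
have low : dg (v |: B) + t * #|B| + \sum_(u in proc :\: B) nth 0 ys u <= cut (N + N).+2 c S.
  rewrite greedy_cutE // [X in X + _ <= _]addnC; apply: leq_add; first apply: leq_add.
  - rewrite mulnC -sum_nat_const big_mkcond [X in _ <= X]big_mkcond; apply: leq_sum => u _.
    by rewrite [u \in B]inE; case: (u \in proc); case: (S u) => //=; rewrite leq_addr.
  - rewrite /dg -sum1_card big_mkcond [X in _ <= X]big_mkcond; apply: leq_sum => e _.
    rewrite inE; case: ifP => // /andP[Ae /existsP[x /andP[xB aex]]].
    by rewrite (Se x e) ?Ae //; move: xB; rewrite !inE => /orP[/eqP->//|/andP[]].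
  rewrite big_mkcond [X in _ <= X]big_mkcond; apply: leq_sum => u _.
  rewrite in_setD [u \in B]inE; case up: (u \in proc); rewrite ?andbF //= andbT.
  case: (S u) => //=; case: eqP => // uv; move: up; by rewrite uv inE ltnn.
move=> B' Bp'; have [S' [S's S't S'E]] := greedy_cut_of Bp'.
have := leq_trans low (min S' S's S't); rewrite {}S'E.
have := Dsum B Bp; have := Dsum B' Bp'.
move: (dg _ + _) (dg _ + _) (\sum_(u in proc) _) (\sum_(u in B) _) (\sum_(u in B') _) (\sum_(u in _ :\: B) _) (\sum_(u in _ :\: B') _).
by clear; lia.
Qed.

End GreedyCut.

Lemma filter_split N (P : pred 'I_N) s1 w s2 : [seq x <- enum 'I_N | P x] = s1 ++ w :: s2 ->
  P w /\ [set x in s1] = [set x : 'I_N | P x && (x < w)].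
Proof.
move=> E; have mE x : (x \in s1 ++ w :: s2) = P x by rewrite -E mem_filter mem_enum andbT.
have : pairwise (fun x y : 'I_N => x < y) (s1 ++ w :: s2).
  rewrite -E; apply: pairwise_filter; rewrite -sorted_pairwise; last by move=> a b c; apply: ltn_trans.
  by have := iota_ltn_sorted 0 N; rewrite -val_enum_ord sorted_map.
rewrite pairwise_cat /= => /and3P[/allrelP h1 _ /andP[/allP h2 _]].
split; first by rewrite -mE mem_cat mem_head orbT.
apply/setP => x; rewrite !inE; apply/idP/andP => [xs|[Px xw]].
  by split; [rewrite -mE mem_cat xs|apply: h1; rewrite ?mem_head].
move: Px; rewrite -mE mem_cat inE => /or3P[//|/eqP xw'|/h2]; first by rewrite xw' ltnn in xw.
by rewrite ltnNge (ltnW xw).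
Qed.

Section GreedySpec.
Variables (N : nat) (adj : seq (seq bool)) (W A : seq bool) (t : nat) (h : 'I_N -> {set 'I_N}).
Hypothesis hA : forall e, e \in st N A -> h e = nbr (rl N adj) e.
Hypothesis hW : forall e, h e \subset st N W.
Let G i := iter i (fun ys => ys ++ [:: greedy_val N adj W A t ys]) [::].
Let y (u : 'I_N) := nth 0 (G N) u.
Let proc (v : 'I_N) := [set u : 'I_N | (u < v) && nth false W u].

Lemma size_greedy i : size (G i) = i.
Proof. by elim: i => //= i IH; rewrite size_cat IH addn1. Qed.

Lemma nth_greedy i j : i < j -> nth 0 (G j) i = greedy_val N adj W A t (G i).
Proof.
elim: j => // j IH; rewrite ltnS leq_eqVlt => /orP[/eqP->|ij] /=.
  by rewrite nth_cat size_greedy ltnn subnn.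
by rewrite nth_cat size_greedy ij IH.
Qed.

Lemma deg_rl (B : {set 'I_N}) :
  deg h (st N A) B = #|[set e : 'I_N | nth false A e && [exists x in B, get false adj e x]]|.
Proof.
apply: eq_card => e; rewrite !inE; case Ae: (nth false A e) => //=.
rewrite hA ?inE //; apply/set0Pn/existsP => [[x]|[x /andP[a b]]].
  by rewrite !inE => /andP[a b]; exists x; rewrite b.
by exists x; rewrite !inE a andbT.
Qed.

Lemma greedy_ymin i (v : 'I_N) : i <= N -> v < i -> nth false W v ->
  (forall B : {set 'I_N}, B \subset proc v -> y v + \sum_(u in B) y u <= deg h (st N A) (v |: B) + t * #|B|) /\
  (exists2 B : {set 'I_N}, B \subset proc v & y v + \sum_(u in B) y u = deg h (st N A) (v |: B) + t * #|B|).
Proof.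
elim: i v => // i IH v iN; rewrite ltnS leq_eqVlt => /orP[/eqP vi|vi] Wv; last exact: (IH v (ltnW iN)).
(* Feasibility for the vertices before [v]. It guarantees that the truncated subtraction in
   [greedy_val] is exact. *)
have feas (B : {set 'I_N}) : B \subset proc v -> B != set0 ->
    \sum_(u in B) y u <= deg h (st N A) B + t * (#|B| - 1).
  move=> Bp; pose P (x : 'I_N) := (x < v) && nth false W x.
  apply: (@greedy_feasible _ _ h t (st N A) y [seq x <- enum 'I_N | P x]).
  - by rewrite filter_uniq // enum_uniq.
  - move=> s1 w s2 /filter_split[/andP[wv Ww] ->].
    have -> : [set x : 'I_N | P x && (x < w)] = proc w.
      apply/setP => x; rewrite !inE /P; case: (ltnP x w) => xw; rewrite ?andbF //.
      by rewrite (ltn_trans xw wv) andbT.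
    by apply: (IH w) => //; [apply: ltnW|rewrite -vi].
  by apply: subset_trans Bp _; apply/subsetP => x; rewrite !inE mem_filter mem_enum andbT.
have vE : v = size (G v) :> nat by rewrite size_greedy.
have yE (u : 'I_N) : u \in proc v -> nth 0 (G v) u = y u.
  by rewrite inE => /andP[uv _]; rewrite /y !nth_greedy.
pose S := nth false (greedy_cut N adj W A t (G v)).
pose B0 := [set u in proc v | S u].
have B0p : B0 \subset proc v by apply/subsetP => u; rewrite inE => /andP[].
have sumE (B : {set 'I_N}) : B \subset proc v -> \sum_(u in B) nth 0 (G v) u = \sum_(u in B) y u.
  by move=> Bp; apply: eq_bigr => u uB; apply: yE; apply: (subsetP Bp).
have cutP (B : {set 'I_N}) : B \subset proc v ->
    deg h (st N A) (v |: B0) + t * #|B0| + \sum_(u in B) y u <=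
    deg h (st N A) (v |: B) + t * #|B| + \sum_(u in B0) y u.
  by move=> Bp; have := @greedy_cutP N adj W A t (G v) v vE B Bp; rewrite -!deg_rl -/S -/B0 !sumE.
have yv : y v = minn N (deg h (st N A) (v |: B0) + t * #|B0| - \sum_(u in B0) y u).
  rewrite /y nth_greedy // /greedy_val size_greedy Wv -/S.
  have BE (u : 'I_N) : nth false (mkrow N (fun u => [&& u < v, nth false W u & S u])) u = (u \in B0).
    by rewrite nth_mkrow // !inE andbA.
  congr (minn N (_ + t * _ - _)).
  - rewrite deg_rl /degree count_iota; apply: eq_card => e; rewrite !inE; congr (_ && _).
    by rewrite has_iota; apply: eq_existsb => x; rewrite nth_mkrow // BE !inE.
  - by rewrite count_iota; apply: eq_card => u; rewrite inE BE.
  rewrite sumn_iota -sumE // [RHS]big_mkcond; apply: eq_bigr => u _; by rewrite BE.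
have le0 : \sum_(u in B0) y u <= deg h (st N A) (v |: B0) + t * #|B0|.
  have [->|nB] := eqVneq B0 set0; first by rewrite big_set0.
  apply: leq_trans (feas B0 B0p nB) _; apply: leq_add; first by apply: deg_le; apply: subsetUr.
  by rewrite leq_mul2l leq_subr orbT.
have yv' : y v + \sum_(u in B0) y u = deg h (st N A) (v |: B0) + t * #|B0|.
  have := cutP set0 (sub0set _); rewrite big_set0 cards0 muln0 !addn0.
  have : deg h (st N A) (v |: set0) <= N by rewrite -[X in _ <= X]card_ord; apply: max_card.
  move: le0; rewrite yv; move: (_ + t * #|B0|) (deg _ _ (v |: set0)) (\sum_(u in B0) _) => a b c; clear; lia.
split; last by exists B0.
move=> B Bp; have := cutP B Bp; rewrite -yv'; move: (y v) (\sum_(u in B0) _) (\sum_(u in B) _) (_ + _ * _) => a b c d.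
clear; lia.
Qed.

Lemma strength_algE : strength_alg N adj W A t = strength h (st N W) t (st N A).
Proof.
pose vs := [seq x : 'I_N <- enum 'I_N | nth false W x].
have WE : st N W = [set x in vs] by apply/setP => x; rewrite !inE mem_filter mem_enum andbT.
rewrite WE -(@greedy_strength _ _ h t (st N A) y vs).
- rewrite -WE /strength_alg -/(G N) sumnE (big_nth 0) size_greedy big_mkord [RHS]big_mkcond; apply: eq_bigr => u _.
  rewrite inE /y nth_greedy //; case: ifP => // Wu.
  by rewrite /greedy_val size_greedy Wu.
- by rewrite filter_uniq // enum_uniq.
- move=> s1 w s2 /filter_split[Ww ->].
  have -> : [set x : 'I_N | nth false W x && (x < w)] = proc w.
    by apply/setP => x; rewrite !inE andbC.
  exact: (greedy_ymin (leqnn N)).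
by rewrite -WE.
Qed.

Lemma strength_alg_le : strength_alg N adj W A t <= N * N.
Proof.
rewrite /strength_alg -/(G N) sumnE (big_nth 0) size_greedy big_mkord.
apply: (@leq_trans (\sum_(u < N) N)); last by rewrite sum_nat_const card_ord.
apply: leq_sum => u _; rewrite nth_greedy // /greedy_val; case: ifP => // _; exact: geq_minl.
Qed.

End GreedySpec.

(** * Colouring by local search *)

Definition class_mask N (E0 : seq bool) (chi : seq nat) j := mkrow N (fun e => nth false E0 e && (nth 0 chi e == j)).

(** [cap] keeps the weights, which are unary numbers, polynomial for all values of the parameters;
    it has no effect once 4 ^ q <= cap. *)
Definition pot N adj W E0 R q cap chi := sumn [seq sumn [seq
  minn cap (4 ^ (q - t.+1)) * strength_alg N adj W (class_mask N E0 chi j) t.+1 | t <- iota 0 q] | j <- iota 0 R].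

Definition recol N (chi : seq nat) e j := mkrow N (fun x => if x == e then j else nth 0 chi x).

Definition improves N adj W E0 R q cap chi e j :=
  nth false E0 e && (pot N adj W E0 R q cap chi < pot N adj W E0 R q cap (recol N chi e j)).

Definition colour_step N adj W E0 R q cap chi :=
  let e := find (fun e => has (fun j => improves N adj W E0 R q cap chi e j) (iota 0 R)) (iota 0 N) in
  let j := find (fun j => improves N adj W E0 R q cap chi e j) (iota 0 R) in
  if e < N then recol N chi e j else chi.

(** An effective step raises the potential by at least 1, and there are more rounds than the
    potential can have values above 0 ([pot_le]). *)
Definition local_search N adj W E0 R q cap :=
  iter (R * (q * (cap * (N * N)))).+1 (colour_step N adj W E0 R q cap) (mkrow N (fun=> 0)).

Definition good_colours N adj W E0 R chi := [seq j <- iota 0 R |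
  count (fun e => nth false (class_mask N E0 chi j) e) (iota 0 N) + count (fun x => nth false W x) (iota 0 N) - 1
    <= strength_alg N adj W (class_mask N E0 chi j) 1].

(** Twice as many colours as classes, because at least half of them turn out to be good. The default
    [2 * r] is not a colour. *)
Definition colouring N adj W E0 r q cap :=
  let chi := local_search N adj W E0 (2 * r) q cap in
  let goods := good_colours N adj W E0 (2 * r) chi in
  mkmx r N (fun i e => nth false E0 e && (nth 0 chi e == nth (2 * r) goods i)).

Section ColouringSpec.
Variables (N : nat) (adj : seq (seq bool)) (W E0 : seq bool) (R q cap : nat).
Hypothesis R0 : 0 < R.
Let P := pot N adj W E0 R q cap.

Lemma pot_le chi : P chi <= R * (q * (cap * (N * N))).
Proof.
have le T (s : seq T) f b : (forall x, f x <= b) -> sumn [seq f x | x <- s] <= size s * b.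
  by move=> H; elim: s => //= x s IH; rewrite mulSn; apply: leq_add.
apply: leq_trans (le _ _ _ (q * (cap * (N * N))) _) _; last by rewrite size_iota.
move=> j; apply: leq_trans (le _ _ _ (cap * (N * N)) _) _; last by rewrite size_iota.
by move=> t; apply: leq_mul; [exact: geq_minl|exact: strength_alg_le].
Qed.

Lemma local_searchP (chi := local_search N adj W E0 R q cap) :
  (forall e : 'I_N, nth 0 chi e < R) /\
  forall (e : 'I_N) j, j < R -> nth false E0 e -> P (recol N chi e j) <= P chi.
Proof.
pose X i := iter i (colour_step N adj W E0 R q cap) (mkrow N (fun=> 0)).
have stepP c : (forall e : 'I_N, nth 0 c e < R) -> let c' := colour_step N adj W E0 R q cap c in
    (forall e : 'I_N, nth 0 c' e < R) /\ (P c < P c' \/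
    c' = c /\ forall (e : 'I_N) j, j < R -> nth false E0 e -> P (recol N c e j) <= P c).
  move=> cR; rewrite /colour_step; set e := find _ (iota 0 N); set j := find _ (iota 0 R).
  case: ltnP => eN /=.
    have jR : j < R by have := find_iotaP eN; rewrite has_find size_iota.
    have /andP[_ lt] := find_iotaP jR; split; last by left.
    by move=> x; rewrite nth_mkrow //; case: ifP.
  split; [exact: cR|right; split; [reflexivity|move=> x i iR Ex]]; rewrite leqNgt; apply/negP => lt.
  suff : e < N by rewrite ltnNge eN.
  rewrite find_iota; apply/existsP; exists x; apply/hasP; exists i; rewrite ?mem_iota //.
  by rewrite /improves Ex.
have XR i : forall e : 'I_N, nth 0 (X i) e < R.
  by elim: i => [e|i IH]; [rewrite nth_mkrow|have [] := stepP _ IH].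
have key i : i <= P (X i) \/ forall (e : 'I_N) j, j < R -> nth false E0 e -> P (recol N (X i) e j) <= P (X i).
  elim: i => [|i IH]; first by left.
  have [_ [lt|[e opt]]] := stepP _ (XR i); last by right; rewrite /X /= -/(X i) e.
  case: IH => [le|opt]; first by left; apply: leq_ltn_trans le lt.
  have [_ [lt2|[e opt2]]] := stepP _ (XR i); last by right; rewrite /X /= -/(X i) e.
  exfalso; move: lt; rewrite /colour_step; set e := find _ (iota 0 N); set j := find _ (iota 0 R).
  case: (ltnP e N) => eN; last by rewrite ltnn.
  have jR : j < R by have := find_iotaP eN; rewrite has_find size_iota.
  have /andP[Ee _] := find_iotaP jR.
  by rewrite ltnNge (opt (Ordinal eN) j jR Ee).
rewrite /chi /local_search -/(X _); split; first exact: XR.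
have [le|//] := key (R * (q * (cap * (N * N)))).+1.
by exfalso; move: (leq_trans le (pot_le _)); rewrite ltnn.
Qed.

Variables (h : 'I_N -> {set 'I_N}) (q0 : nat).
Hypothesis hE : forall e, e \in st N E0 -> h e = nbr (rl N adj) e.
Hypothesis hW : forall e, h e \subset st N W.
Hypothesis hne : forall e, h e != set0.
Hypothesis W0 : 0 < #|st N W|.
Hypothesis cutW : forall Y : {set 'I_N}, Y \subset st N W -> Y != set0 -> Y != st N W ->
  q0 <= #|[set e in st N E0 | (h e :&: Y != set0) && (h e :&: (st N W :\: Y) != set0)]|.
Hypotheses (hq0 : 128 * R * q.+1 <= q0) (h10 : 10 * #|st N W| <= 4 ^ q) (q1 : 1 < q) (hcap : 4 ^ q <= cap).

Lemma strength_class chi j t : strength_alg N adj W (class_mask N E0 chi j) t =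
  strength h (st N W) t (st N (class_mask N E0 chi j)).
Proof.
apply: strength_algE => // e; rewrite inE nth_mkrow // => /andP[Ee _].
by apply: hE; rewrite inE.
Qed.

Lemma good_coloursP (chi := local_search N adj W E0 R q cap) :
  R <= 2 * size (good_colours N adj W E0 R chi).
Proof.
have := local_searchP; rewrite -/chi; clearbody chi; rewrite /P => -[].
move: R0 hq0; case: (R) => // R1 _ hq1 chiR opt.
pose F c : 'I_N -> 'I_R1.+1 := fun x => inord (nth 0 c x).
have classE c (j : 'I_R1.+1) : (forall e : 'I_N, nth 0 c e < R1.+1) ->
    st N (class_mask N E0 c j) = colour_class (st N E0) (F c) j.
  move=> cR; apply/setP => e; rewrite !inE nth_mkrow //; congr (_ && _).
  by rewrite -val_eqE /= inordK.
have potE c : (forall e : 'I_N, nth 0 c e < R1.+1) -> pot N adj W E0 R1.+1 q cap c = potential h (st N W) (st N E0) q (F c).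
  move=> cR; rewrite /pot sumn_iota; apply: eq_bigr => j _; rewrite sumn_iota; apply: eq_bigr => t _.
  rewrite strength_class classE //; congr (_ * _); apply/minn_idPr; apply: leq_trans hcap.
  by rewrite leq_exp2l // leq_subr.
have recE e (j : 'I_R1.+1) : F (recol N chi (val e) (val j)) = recolour (F chi) e j.
  apply: functional_extensionality => x; rewrite /F /recolour nth_mkrow //.
  by have -> : (nat_of_ord x == val e) = (x == e) by []; case: ifP => // _; rewrite inord_val.
have opt' e j : e \in st N E0 -> potential h (st N W) (st N E0) q (recolour (F chi) e j) <= potential h (st N W) (st N E0) q (F chi).
  rewrite inE => Ee.
  have c2R x : nth 0 (recol N chi (val e) (val j)) (nat_of_ord (x : 'I_N)) < R1.+1.
    by rewrite nth_mkrow //; case: ifP => // _; apply: ltn_ord.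
  rewrite -recE -(potE _ c2R) -(potE _ chiR); exact: opt (ltn_ord j) Ee.
have := @local_opt_good _ _ h (st N W) (st N E0) hW hne W0 R1.+1 q q0 cutW (F chi) opt' isT hq1 h10 q1.
rewrite size_filter (@count_iota R1.+1).
set bad := [set j | _]; set good := [set x | _].
have : bad :|: good = setT.
  apply/setP => j; rewrite !inE strength_class !count_iota.
  have -> : [set x : 'I_N | nth false (class_mask N E0 chi j) x] = st N (class_mask N E0 chi j) by [].
  rewrite -[[set x : 'I_N | nth false W x]]/(st N W) classE //; exact: ltn_leq_total || (by case: ltnP).
move=> bg; have : #|bad :|: good| <= #|bad| + #|good| by apply: (leq_card_setU _ _).1.
rewrite bg cardsT card_ord; move: #|bad| #|good| => a b; clear; lia.
Qed.

End ColouringSpec.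

Lemma colouringP N adj Ts W E0 r q cap q0 :
  let WS := st N W in let TT := map (st N) Ts in
  symmetric (rl N adj) -> WS \subset [set x | black TT x] -> WS != set0 ->
  st N E0 = [set g in internal (rl N adj) TT WS | [exists y, rl N adj g y]] ->
  kcut q0 (adj_in (rl N adj) TT WS) [:: WS] ->
  0 < r -> 128 * (2 * r) * q.+1 <= q0 -> 10 * #|WS| <= 4 ^ q -> 1 < q -> 4 ^ q <= cap ->
  let A := cl N (colouring N adj W E0 r q cap) in
  [/\ forall j, A j \subset st N E0, forall i j, i != j -> [disjoint A i & A j] &
      forall j x y, j < r -> x \in WS -> y \in WS -> connect (link (rl N adj) (A j) WS) x y].
Proof.
move=> WS TT sa bW W0 EE kc r0 hq0 h10 q1 hcap A.
(* Indices outside [E0] get the hyperedge [WS], so that all hyperedges are nonempty subsets of [WS];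
   these indices are never coloured. Isolated internal nodes are excluded from [E0] for the same
   reason. *)
pose h (e : 'I_N) := if e \in st N E0 then nbr (rl N adj) e else WS.
have hE e : e \in st N E0 -> h e = nbr (rl N adj) e by rewrite /h => ->.
have hW e : h e \subset WS.
  rewrite /h; case: ifP => //; rewrite EE inE => /andP[+ _]; rewrite inE => /andP[_ /forallP H].
  by apply/subsetP => x; rewrite inE => ex; have := H x; rewrite ex.
have hne e : h e != set0.
  rewrite /h; case: ifP => //; rewrite EE inE => /andP[_ /existsP[x ex]].
  by apply/set0Pn; exists x; rewrite inE.
have cutW (Y : {set 'I_N}) : Y \subset WS -> Y != set0 -> Y != WS ->
    q0 <= #|[set e in st N E0 | (h e :&: Y != set0) && (h e :&: (WS :\: Y) != set0)]|.
  move=> YW Y0 YnW; apply: leq_trans (kcut_in sa bW kc YW Y0 YnW) _.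
  apply: subset_leq_card; apply/subsetP => g; rewrite !inE => /andP[gI /andP[gY gZ]].
  have gE : g \in st N E0.
    rewrite EE inE inE gI; have [x] := set0Pn _ gY; rewrite !inE => /andP[gx _].
    by apply/existsP; exists x.
  by rewrite hE // gY gZ; move: gE; rewrite inE => ->.
have Wpos : 0 < #|WS| by rewrite card_gt0.
have R0 : 0 < 2 * r by rewrite muln_gt0.
have := @good_coloursP N adj W E0 (2 * r) q cap R0 h q0 hE hW hne Wpos cutW hq0 h10 q1 hcap.
rewrite /A /colouring; cbv zeta; move: (local_search N adj W E0 (2 * r) q cap) => chi.
have gsub j : j \in good_colours N adj W E0 (2 * r) chi -> strength h WS 1 (st N (class_mask N E0 chi j)) >= #|st N (class_mask N E0 chi j)| + #|WS| - 1.
  by rewrite mem_filter !count_iota (strength_class hE hW) => /andP[].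
have guniq : uniq (good_colours N adj W E0 (2 * r) chi) by rewrite filter_uniq // iota_uniq.
move: (good_colours _ _ _ _ _ _) gsub guniq => goods gsub guniq; rewrite leq_mul2l /= => rg.
have clE j : j < r -> cl N (mkmx r N (fun i e => nth false E0 e && (nth 0 chi e == nth (2 * r) goods i))) j =
    st N (class_mask N E0 chi (nth (2 * r) goods j)).
  by move=> jr; apply/setP => e; rewrite !inE get_mkmx // nth_mkrow.
have cl0 j : r <= j -> cl N (mkmx r N (fun i e => nth false E0 e && (nth 0 chi e == nth (2 * r) goods i))) j = set0.
  by move=> jr; apply/setP => e; rewrite !inE /get (nth_default [::]) ?nth_nil // size_map size_iota.
split.
- move=> j; case: (ltnP j r) => jr; last by rewrite cl0 // sub0set.
  by rewrite clE //; apply/subsetP => e; rewrite !inE nth_mkrow // => /andP[].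
- move=> i j ij; case: (ltnP i r) => ir; last by rewrite cl0 // disjoint0s || rewrite disjoints_subset cl0 ?sub0set.
  case: (ltnP j r) => jr; last by rewrite [cl N _ j]cl0 // disjoint_sym disjoints_subset sub0set.
  rewrite !clE //; apply/pred0P => e /=; rewrite !inE !nth_mkrow //; apply/negP => /andP[/andP[_ /eqP->] /andP[_]].
  by rewrite nth_uniq ?(leq_trans _ rg) // (negPf ij).
move=> j x y jr xW yW; rewrite clE //; set Aj := st N _.
have AjE e : e \in Aj -> e \in st N E0 by rewrite !inE nth_mkrow // => /andP[].
have glt := gsub _ (mem_nth (2 * r) (leq_trans jr rg)); rewrite -/Aj in glt.
have cs : connect_sym (link (rl N adj) Aj WS).
  apply: sym_connect_sym => a b; rewrite /link; case: (a \in WS); case: (b \in WS) => //=.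
  by apply: eq_existsb => g; case: (g \in Aj) => //=; rewrite andbC.
(* Label every vertex by its component: every element sees one label only. *)
have := leq_trans glt (strength_le hW 1 Aj (fingraph.root (link (rl N adj) Aj WS))).
rewrite /pval (eq_bigr (fun=> 1)) => [|e eA]; last first.
  apply/eqP; rewrite eqn_leq touch_gt0 // andbT.
  have [z zh] := set0Pn _ (hne e).
  rewrite -(cards1 (fingraph.root (link (rl N adj) Aj WS) z)); apply: subset_leq_card.
  apply/subsetP => _ /imsetP[z' zh' ->]; rewrite inE; apply/eqP/fingraph.rootP => //.
  apply: connect1; rewrite /link !(subsetP (hW e)) //; apply/existsP; exists e.
  by rewrite eA; move: zh zh'; rewrite hE ?AjE // !inE => -> ->.
rewrite sum1_card mul1n.
have lW : #|fingraph.root (link (rl N adj) Aj WS) @: WS| <= #|WS| by apply: leq_imset_card.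
move=> le1; have le2 : #|fingraph.root (link (rl N adj) Aj WS) @: WS| <= 1.
  move: le1 lW Wpos; move: #|Aj| #|WS| #|_ @: _| => a b c; clear; lia.
apply/(fingraph.rootP cs); have := card_le1_eqP le2; apply; exact: imset_f.
Qed.

(** The power itself may be exponentially large; truncation after each multiplication keeps the
    unary intermediate values below [cap]. *)
Lemma p_minpow X (cX : codable X) (b : nat) (cap f : X -> nat) : 0 < b ->
  PT cap -> PT f -> PT (fun x => minn (cap x) (b ^ f x)).
Proof.
move=> b0 Hc Hf.
have E c i : iter i (fun z => minn c (b * z)) (minn c 1) = minn c (b ^ i).
  elim: i => //= i ->; rewrite expnS; case: (leqP c (b ^ i)) => h.
    have h1 : c <= b * c by rewrite leq_pmull.
    have h2 : c <= b * b ^ i by apply: leq_trans h _; rewrite leq_pmull.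
    by rewrite (minn_idPl h1) (minn_idPl h2).
  by [].
apply: (@PT_ext _ _ _ _ (fun x => iter (f x) (fun z => minn (cap x) (b * z)) (minn (cap x) 1))) => [x|].
  exact: E.
apply: (p_iter (B := fun x => sz (cap x))); [by pt|by pt|by pt|exact: PT_sz|].
by move=> x i _; rewrite E !sz_nat; have := geq_minl (cap x) (b ^ i); lia.
Qed.

Ltac pt_a3 := first [pt_a2 | lazymatch goal with
  | |- PT (fun x => minn (@?c x) (?b ^ (@?f x))) => refine (p_minpow _ _ _); [by []| |]
  | |- PT (fun x => search (@?N x) (@?a x) (@?T x) (@?q x) (@?L x)) => refine (p_search _ _ _ _ _)
  end].
Ltac pt_user ::= pt_a3.

Lemma p_greedy_cut X (cX : codable X) (N : X -> nat) adj W A t ys :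
  PT N -> PT adj -> PT W -> PT A -> PT t -> PT ys ->
  PT (fun x => greedy_cut (N x) (adj x) (W x) (A x) (t x) (ys x)).
Proof. by move=> HN Ha HW HA Ht Hy; rewrite /greedy_cut /greedy_cap /greedy_big; pt. Qed.

Ltac pt_a4 := first [pt_a3 | lazymatch goal with
  | |- PT (fun x => greedy_cut (@?N x) (@?a x) (@?W x) (@?A x) (@?t x) (@?y x)) => refine (p_greedy_cut _ _ _ _ _ _)
  end].
Ltac pt_user ::= pt_a4.

Lemma p_greedy_val X (cX : codable X) (N : X -> nat) adj W A t ys :
  PT N -> PT adj -> PT W -> PT A -> PT t -> PT ys ->
  PT (fun x => greedy_val (N x) (adj x) (W x) (A x) (t x) (ys x)).
Proof. by move=> HN Ha HW HA Ht Hy; rewrite /greedy_val /degree; pt. Qed.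

Ltac pt_a5 := first [pt_a4 | lazymatch goal with
  | |- PT (fun x => greedy_val (@?N x) (@?a x) (@?W x) (@?A x) (@?t x) (@?y x)) => refine (p_greedy_val _ _ _ _ _ _)
  end].
Ltac pt_user ::= pt_a5.

Lemma p_strength_alg X (cX : codable X) (N : X -> nat) adj W A t :
  PT N -> PT adj -> PT W -> PT A -> PT t ->
  PT (fun x => strength_alg (N x) (adj x) (W x) (A x) (t x)).
Proof.
move=> HN Ha HW HA Ht; rewrite /strength_alg /greedy; apply: p_sumn.
apply: (p_iter (B := fun x => N x * (2 * N x + 2) + 1)); [by pt|by pt|by pt| |].
  assert (H := pbnd_nat HN); by auto 10 with pbnd.
move=> x i iN; apply: leq_trans (@sz_seq_le _ _ _ (2 * N x + 1) _) _; last first.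
  by rewrite size_greedy leq_add2r; apply: leq_mul => //; lia.
move=> j d; rewrite size_greedy => ji; rewrite (set_nth_default 0) ?size_greedy // nth_greedy // sz_nat.
rewrite /greedy_val; case: ifP => _; last by lia.
by set z := _ - _; have := geq_minl (N x) z; lia.
Qed.

Ltac pt_a6 := first [pt_a5 | lazymatch goal with
  | |- PT (fun x => strength_alg (@?N x) (@?a x) (@?W x) (@?A x) (@?t x)) => refine (p_strength_alg _ _ _ _ _)
  end].
Ltac pt_user ::= pt_a6.

Lemma p_pot X (cX : codable X) (N : X -> nat) adj W E0 R q cap chi :
  PT N -> PT adj -> PT W -> PT E0 -> PT R -> PT q -> PT cap -> PT chi ->
  PT (fun x => pot (N x) (adj x) (W x) (E0 x) (R x) (q x) (cap x) (chi x)).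
Proof. by move=> HN Ha HW HE HR Hq Hc Hchi; rewrite /pot /class_mask; pt. Qed.

Ltac pt_a7 := first [pt_a6 | lazymatch goal with
  | |- PT (fun x => pot (@?N x) (@?a x) (@?W x) (@?E x) (@?R x) (@?q x) (@?c x) (@?chi x)) =>
      refine (p_pot _ _ _ _ _ _ _ _)
  end].
Ltac pt_user ::= pt_a7.

Lemma p_local_search X (cX : codable X) (N : X -> nat) adj W E0 R q cap :
  PT N -> PT adj -> PT W -> PT E0 -> PT R -> PT q -> PT cap ->
  PT (fun x => local_search (N x) (adj x) (W x) (E0 x) (R x) (q x) (cap x)).
Proof.
move=> HN Ha HW HE HR Hq Hc; rewrite /local_search.
apply: (p_iter (B := fun x => N x * (2 * R x + 2) + 1)).
- by rewrite /colour_step /improves /recol; pt.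
- by pt.
- by pt.
- assert (H := pbnd_nat HN); assert (H1 := pbnd_nat HR); by auto 10 with pbnd.
move=> x i _.
suff [c [-> cR]] : exists c, iter i (colour_step (N x) (adj x) (W x) (E0 x) (R x) (q x) (cap x)) (mkrow (N x) (fun=> 0)) =
    mkrow (N x) c /\ forall j, j < N x -> c j <= R x.
  apply: leq_trans (@sz_mkrow _ _ (N x) c (2 * R x + 1) _) _; last by rewrite leq_add2r leq_mul2l addn1 addn2 leqnn orbT.
  by move=> j /cR; rewrite sz_nat; lia.
elim: i => [|i [c [E cR]]]; first by exists (fun=> 0).
rewrite iterS E /colour_step; set e := find _ _; set j := find _ _.
case: ifP => _; last by exists c.
exists (fun y => if y == e then j else nth 0 (mkrow (N x) c) y); split=> // y yN; case: ifP => _.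
  by rewrite -[X in _ <= X](size_iota 0); apply: find_size.
by rewrite nth_mkrow // cR.
Qed.

Ltac pt_a8 := first [pt_a7 | lazymatch goal with
  | |- PT (fun x => local_search (@?N x) (@?a x) (@?W x) (@?E x) (@?R x) (@?q x) (@?c x)) =>
      refine (p_local_search _ _ _ _ _ _ _)
  end].
Ltac pt_user ::= pt_a8.

Lemma p_colouring X (cX : codable X) (N : X -> nat) adj W E0 r q cap :
  PT N -> PT adj -> PT W -> PT E0 -> PT r -> PT q -> PT cap ->
  PT (fun x => colouring (N x) (adj x) (W x) (E0 x) (r x) (q x) (cap x)).
Proof. by move=> HN Ha HW HE HR Hq Hc; rewrite /colouring /good_colours /class_mask; pt. Qed.

Ltac pt_a9 := first [pt_a8 | lazymatch goal with
  | |- PT (fun x => colouring (@?N x) (@?a x) (@?W x) (@?E x) (@?r x) (@?q x) (@?c x)) =>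
      refine (p_colouring _ _ _ _ _ _ _)
  end].
Ltac pt_user ::= pt_a9.

(** * The main loop *)

Definition bmx := seq (seq bool).

(* The state consists of the current graph, the contents of its nodes, the
   current terminal sets and the classes built so far. *)
Definition phase N k q0 q L r cap (s : (bmx * bmx) * (bmx * bmx)) :=
  let Ts := s.2.1 in
  if has (fun x => nth false (blacks N Ts) x) (iota 0 N) then
    let ap := reduce N Ts k s.1 in
    let W := search N ap.1 Ts q0 L in
    let w := find (fun x => nth false W x) (iota 0 N) in
    if count (fun x => nth false W x) (iota 0 N) <= 1 then
      ((elim_mx N ap.1 w, ap.2), (elim_masks N Ts w, s.2.2))
    else
      let I := internal_mask N ap.1 (blacks N Ts) W in
      let E0 := mkrow N (fun g => nth false I g && has (fun y => get false ap.1 g y) (iota 0 N)) in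
      let cls := colouring N ap.1 W E0 r q cap in
      ((contract_set_mx N ap.1 W I w, union_mx N ap.2 W w),
       (contract_masks N Ts W w, extend_mx N r s.2.2 ap.2 cls))
  else s.

Lemma linv_eqC (V : finType) (adj0 : rel V) TT0 r adj TT D C C' : (forall j, j < r -> C j = C' j) ->
  linv adj0 TT0 r adj TT D C -> linv adj0 TT0 r adj TT D C'.
Proof.
move=> E [h1 h2 h3 h4 h5 h6 h7 h8 h9 h10 h11]; split=> //.
- by move=> j U x a b jr; rewrite -E //; apply: h6.
- by move=> j U x y jr; rewrite -E //; apply: h7.
- by move=> i iT; have [H|H] := h8 i iT; [left|right=> j a b jr; rewrite -E //; apply: H].
- by move=> x j jr; rewrite -E //; apply: h10.
by move=> i j ir jr; rewrite -!E //; apply: h11.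
Qed.

Section MainLoop.
Variables (N : nat) (adj0 : rel 'I_N) (TT0 : seq {set 'I_N}) (k q0 q L r cap : nat).
Hypothesis sym0 : symmetric adj0.
Hypotheses (r0 : 0 < r) (Lk : L.+1 * q0 <= k) (mL : size TT0 < 2 ^ L.+1)
  (hq0 : 128 * (2 * r) * q.+1 <= q0) (q1 : 1 < q) (hcap : 4 ^ q <= cap).

Let bset Ts := [set x | black (map (st N) Ts) x].
Let inv (s : (bmx * bmx) * (bmx * bmx)) := minv adj0 TT0 r k s.1.1 s.1.2 s.2.1 s.2.2.

(** Each phase loses a terminal: a set [W] with one node is eliminated, a larger one shrinks to [w].
    The number of terminals never grows, so one choice of [q] at the start serves all phases. *)
Lemma phaseP s : inv s -> 10 * #|bset s.2.1| <= 4 ^ q ->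
  let s' := phase N k q0 q L r cap s in
  inv s' /\ (#|bset s'.2.1| < #|bset s.2.1| \/ bset s'.2.1 = set0).
Proof.
move=> mi h10; rewrite /phase.
set Ts := s.2.1 in h10 *; rewrite has_iota; case: ifP => [/existsP[x0]|/existsP nb]; last first.
  by split=> //; right; apply/setP => x; rewrite !inE; apply/negbTE/negP => bx; apply: nb; exists x; rewrite blacksE.
rewrite blacksE => bx0.
have [{}mi bipw] := reduceP sym0 mi; rewrite -/Ts in mi bipw *.
move: (reduce N Ts k s.1) mi bipw => ap mi bipw; rewrite /= -/Ts in mi.
have [li kc] := mi; have szT := li_sz li; rewrite size_map in szT.
have [||[i wi] kW] := searchP mi bipw Lk; first by rewrite szT.
  by exists x0.
move: (search N ap.1 Ts q0 L) wi kW => W wi kW.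
have [W0 bW tW _ _] := wi.
have wE : find (fun x => nth false W x) (iota 0 N) < N.
  by rewrite find_iota; have [x] := set0Pn _ W0; rewrite inE => xW; apply/existsP; exists x.
have Ww := find_iotaP wE; set w0 := find _ _ in wE Ww *.
pose w : 'I_N := Ordinal wE; have wW : w \in st N W by rewrite inE.
have bWP x : x \in st N W -> black (map (st N) Ts) x by move=> /(subsetP bW); rewrite inE.
rewrite -[w0]/(val w) count_iota -/(st N W); case: (leqP #|st N W| 1) => cW /=.
  have WE : st N W = [set w].
    by apply/eqP; rewrite eq_sym eqEcard sub1set wW cards1.
  have hx T : T \in map (st N) Ts -> w \in T -> T = [set w].
    move=> TT wT; have [TW|dT] := tW T TT; last by rewrite (disjointFr dT wT) in wW.
    by apply/eqP; rewrite eq_sym eqEcard sub1set wT cards1 -(cards1 w) -WE subset_leq_card.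
  rewrite -[w0]/(nat_of_ord w); split.
    change (minv adj0 TT0 r k (elim_mx N ap.1 w) ap.2 (elim_masks N Ts w) s.2.2).
    rewrite /minv elim_mxE elim_masksE; split; first exact: linv_elim (bWP w wW) hx li.
    exact: kcut_elim (li_sym li) hx kc.
  left; apply: proper_card; apply/properP; split; last first.
    exists w; first by rewrite inE bWP.
    rewrite !inE /bset elim_masksE; apply/negP => /hasP[T /mapP[T' _ ->]]; by rewrite !inE eqxx.
  apply/subsetP => x; rewrite !inE /bset elim_masksE => /hasP[T /mapP[T' TT' ->]]; rewrite !inE => /andP[_ xT].
  by apply/hasP; exists T'.
set I := internal_mask _ _ _ _; set E0 := mkrow N _.
have IE : st N I = internal (rl N ap.1) (map (st N) Ts) (st N W) by rewrite internal_maskE.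
have EE : st N E0 = [set g in internal (rl N ap.1) (map (st N) Ts) (st N W) | [exists y, rl N ap.1 g y]].
  by rewrite -IE st_mkrow; apply/setP => g; rewrite !inE has_iota.
have hW10 : 10 * #|st N W| <= 4 ^ q.
  by apply: leq_trans h10; rewrite leq_mul2l /=; apply: subset_leq_card.
have [cE cd cc] := colouringP (li_sym li) bW W0 EE kW r0 hq0 hW10 q1 hcap.
have wI g : g \in st N I -> ~~ black (map (st N) Ts) g by rewrite IE inE => /andP[].
have IW g x : g \in st N I -> rl N ap.1 g x -> x \in st N W.
  by rewrite IE inE => /andP[_ /forallP/(_ x)/implyP].
rewrite -[w0]/(nat_of_ord w); split.
  change (minv adj0 TT0 r k (contract_set_mx N ap.1 W I w) (union_mx N ap.2 W w) (contract_masks N Ts W w)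
    (extend_mx N r s.2.2 ap.2 (colouring N ap.1 W E0 r q cap))).
  rewrite /minv contract_set_mxE contract_masksE union_mxE; split; last exact: kcut_contract (li_sym li) wW bWP wI IW kc.
  apply: linv_eqC (linv_contract_set sym0 wW bWP wI IW tW _ cd _ cc li).
  - by move=> j jr; rewrite extend_mxE.
  - move=> j; apply: subset_trans (cE j) _; rewrite EE IE.
    by apply/subsetP => g; rewrite inE => /andP[].
  by move=> j g /(subsetP (cE j)); rewrite EE inE => /andP[].
left; apply: proper_card; apply/properP; split.
  apply/subsetP => x; rewrite !inE /bset contract_masksE => /hasP[T /mapP[T' TT' ->]]; rewrite /contract_terms.
  case: ifP => _; first by move=> xT; apply/hasP; exists T'.
  rewrite !inE => /orP[/eqP->|/andP[_ xT]]; [exact: bWP|by apply/hasP; exists T'].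
have [x xW xw] : exists2 x, x \in st N W & x != w.
  have : 0 < #|st N W :\ w| by move: cW; rewrite (cardsD1 w) wW.
  by rewrite card_gt0 => /set0Pn[x]; rewrite in_setD1 => /andP[xw xW]; exists x.
exists x; first by rewrite inE bWP.
rewrite !inE /bset contract_masksE; apply/negP => /hasP[T /mapP[T' _ ->]]; rewrite /contract_terms.
case: ifP => [/eqP TW xT|_].
  by have : x \in T' :&: st N W by [rewrite inE xT]; rewrite TW inE.
by rewrite !inE (negPf xw) /= => /andP[/negP[]]; move: xW; rewrite inE.
Qed.

Lemma mainP n s : inv s -> 10 * #|bset s.2.1| <= 4 ^ q -> #|bset s.2.1| <= n ->
  let C := cl N (iter n (phase N k q0 q L r cap) s).2.2 in
  (forall i j a b, i < size TT0 -> j < r -> a \in nth set0 TT0 i -> b \in nth set0 TT0 i ->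
    connect (gam adj0 TT0 (C j)) a b) /\
  (forall i j, i < r -> j < r -> i != j -> [disjoint C i & C j]).
Proof.
move=> mi h10 hn.
suff [[li _] b0] : inv (iter n (phase N k q0 q L r cap) s) /\ bset (iter n (phase N k q0 q L r cap) s).2.1 = set0.
  split; last exact: li_CC li.
  move=> i j a b iT jr aT bT; have [H|H] := li_term li iT; last exact: H.
  have [x xT _] := H a aT; exfalso.
  have : x \in bset (iter n (phase N k q0 q L r cap) s).2.1.
    rewrite inE; apply/hasP; exists (nth set0 (map (st N) (iter n (phase N k q0 q L r cap) s).2.1) i) => //.
    by apply: mem_nth; rewrite (li_sz li).
  by rewrite b0 inE.
elim: n s mi h10 hn => [|n IH] s mi h10 hn.
  by split=> //; apply/eqP; rewrite -cards_eq0 -leqn0.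
have [mi' h] := phaseP mi h10; rewrite iterSr; apply: IH => //.
  case: h => [lt|->]; last by rewrite cards0 muln0.
  by apply: leq_trans h10; rewrite leq_mul2l /= ltnW.
case: h => [lt|->]; last by rewrite cards0.
by rewrite -ltnS; apply: leq_trans lt hn.
Qed.

End MainLoop.

Lemma p_phase X (cX : codable X) (N k q0 q L r cap : X -> nat) s :
  PT N -> PT k -> PT q0 -> PT q -> PT L -> PT r -> PT cap -> PT s ->
  PT (fun x => phase (N x) (k x) (q0 x) (q x) (L x) (r x) (cap x) (s x)).
Proof.
move=> HN Hk Hq0 Hq HL Hr Hc Hs; rewrite /phase /elim_mx /elim_masks /contract_set_mx /union_mx
  /contract_masks /extend_mx /internal_mask.
by pt.
Qed.

(** * Spanning forests *)

Definition reach n (F : bmx) u v :=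
  nth n (bfs n (mkmx n n (fun a b => if get false F a b then 1 else 0)) u) v < n.

Lemma reachE n F (u v : 'I_n) : reach n F u v = connect (rl n F) u v.
Proof.
rewrite /reach; set c := mkmx _ _ _.
have cE (a b : 'I_n) : (0 < get 0 c a b) = rl n F a b by rewrite get_mkmx // -/(rl n F a b); case: (rl n F a b).
apply/idP/connectP => [ru|[p]].
  have [p [_ pn _ pp lp]] := bfs_pathP (ltn_ord u) (ltn_ord v) ru.
  elim: p u pn pp lp {ru} => [|w p IH] u /=; first by move=> _ _ /val_inj->; exists [::].
  case/andP=> wn pn /andP[uw pp] lp.
  have [p' pp' lp'] := IH (Ordinal wn) pn pp lp.
  by exists (Ordinal wn :: p') => //=; rewrite -cE uw.
have : nth n (bfs n c u) u < n by apply: bfs_source.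
suff key w : nth n (bfs n c u) (nat_of_ord w) < n -> path (rl n F) w p -> v = last w p -> nth n (bfs n c u) v < n by apply: key.
elim: p w => [|z p IH] w rw /=; first by move=> _ ->.
case/andP=> wz pz lz; apply: (IH z) => //.
by apply: (bfs_closed (ltn_ord u) (ltn_ord w) (ltn_ord z) rw); rewrite cE.
Qed.

Definition prune_step n F :=
  let u := find (fun u => has (fun v => get false F u v && reach n (del_mx n F u v) u v) (iota 0 n)) (iota 0 n) in
  let v := find (fun v => get false F u v && reach n (del_mx n F u v) u v) (iota 0 n) in
  if u < n then del_mx n F u v else F.

Definition prune n F := iter (n * n).+1 (prune_step n) F.

Section Prune.
Variable n : nat.
Implicit Types (F : bmx) (f : rel 'I_n).

Lemma del_edge_sym (V : finType) (f : rel V) u v : symmetric f -> symmetric (del_edge f u v).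
Proof. by move=> sf x y; rewrite /del_edge sf orbC (andbC (y == v)) (andbC (y == u)). Qed.

Lemma connect_del_edge (V : finType) (f : rel V) u v x y : symmetric f -> connect (del_edge f u v) u v ->
  connect (del_edge f u v) x y = connect f x y.
Proof.
move=> sf cuv; apply/idP/idP; apply: connect_sub => a b.
  by case/andP=> ab _; apply: connect1.
move=> ab; case: (boolP (del_edge f u v a b)) => [/connect1//|].
rewrite /del_edge ab /= negbK => /orP[/andP[/eqP-> /eqP->]//|/andP[/eqP-> /eqP->]].
by rewrite (sym_connect_sym (del_edge_sym u v sf)).
Qed.

(** The remainder of a cycle connects the ends of any of its edges, so a graph in which every edge
    is a bridge has no cycle. *)
Lemma acyclic_minimal (V : finType) (f : rel V) : symmetric f ->
  (forall u v, f u v -> ~~ connect (del_edge f u v) u v) -> acyclic f.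
Proof.
move=> sf H [|x [|y [|z p]]] // /andP[/= /and3P[xy yz pz]].
rewrite !inE !negb_or => /and4P[/and3P[nxy nxz xp] /andP[nyz yp] zp up].
have := H x y xy; rewrite (sym_connect_sym (del_edge_sym x y sf)) => /negP[].
apply: (@connect_trans _ _ z).
  apply: connect1; rewrite /del_edge yz /= negb_or !negb_and (eq_sym y x) nxy eqxx /=.
  by rewrite eq_sym nxz orbT || rewrite (eq_sym z x) nxz.
apply/connectP; exists (rcons p x); last by rewrite last_rcons.
elim: p z pz nxz nyz xp yp {yz zp up} => [|w p IH] z /=.
  rewrite !andbT => zx nxz nyz _ _; rewrite /del_edge zx /= negb_or !negb_and.
  by rewrite (eq_sym z x) nxz (eq_sym z y) nyz.
rewrite !inE !negb_or => /andP[zw pw] nxz nyz /andP[nxw xp] /andP[nyw yp].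
by rewrite IH // andbT /del_edge zw /= negb_or !negb_and (eq_sym z x) nxz (eq_sym z y) nyz.
Qed.

Lemma prune_stepP F : symmetric (rl n F) -> let F' := prune_step n F in
  [/\ symmetric (rl n F'), subrel (rl n F') (rl n F),
      forall x y, connect (rl n F') x y = connect (rl n F) x y &
      #|edges n F'| < #|edges n F| \/ F' = F /\ forall u v, rl n F u v -> ~~ connect (del_edge (rl n F) u v) u v].
Proof.
move=> sF; rewrite /prune_step.
set u := find _ (iota 0 n); set v := find _ (iota 0 n).
case: (ltnP u n) => un; last first.
  split=> //; right; split=> // x y xy; apply/negP => cxy.
  suff : u < n by rewrite ltnNge un.
  rewrite find_iota; apply/existsP; exists x; rewrite has_iota; apply/existsP; exists y.
  by rewrite -/(rl n F x y) xy -[X in reach n X]/(del_mx n F x y) reachE del_mxE.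
have vn : v < n by have := find_iotaP un; rewrite has_find size_iota.
have := find_iotaP vn; rewrite -/v; pose u' := Ordinal un; pose v' := Ordinal vn.
rewrite -[u]/(val u') -[v]/(val v') reachE del_mxE => /andP[uv cuv].
split.
- exact: del_edge_sym.
- by move=> x y /andP[].
- by move=> x y; apply: connect_del_edge.
left; apply: proper_card; apply/properP; split.
  by apply/subsetP => z; rewrite !inE del_mxE => /andP[].
by exists (u', v'); rewrite ?inE // del_mxE /del_edge /= !eqxx andbF.
Qed.

Lemma pruneP F : symmetric (rl n F) -> let F' := prune n F in
  [/\ symmetric (rl n F'), subrel (rl n F') (rl n F),
      forall x y, connect (rl n F') x y = connect (rl n F) x y & acyclic (rl n F')].
Proof.
move=> sF; rewrite /prune.
have : #|edges n F| < (n * n).+1.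
  by rewrite ltnS -[X in _ <= X](_ : #|{: 'I_n * 'I_n}| = _) ?max_card // card_prod card_ord.
elim: (n * n).+1 F sF => // i IH F sF lt; rewrite iterSr.
have [s1 sub1 c1 [lt1|[e min]]] := prune_stepP sF.
  have [|s2 sub2 c2 a2] := IH _ s1; first by apply: leq_trans lt1 _; rewrite -ltnS.
  split=> //; first by move=> x y /sub2/sub1.
  by move=> x y; rewrite c2 c1.
rewrite e; have -> : iter i (prune_step n) F = F by elim: (i) => //= j ->.
by split=> //; apply: acyclic_minimal.
Qed.
End Prune.

Ltac pt_a10 := first [pt_a9 | lazymatch goal with
  | |- PT (fun x => bfs (@?N x) (@?c x) (@?s x)) => refine (p_bfs _ _ _)
  end].
Ltac pt_user ::= pt_a10.

Lemma p_prune X (cX : codable X) (n : X -> nat) F : PT n -> PT F -> PT (fun x => prune (n x) (F x)).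
Proof.
move=> Hn HF; rewrite /prune.
apply: (p_iter (B := fun x => sz (F x) + bsz (n x))).
- by rewrite /prune_step /reach /del_mx; pt.
- by pt.
- by pt.
- assert (H1 := PT_sz HF); assert (H2 := pbnd_nat Hn); by auto with pbnd.
move=> x i _; elim: i => [|i IH] /=; first exact: leq_addr.
rewrite {1}/prune_step; case: ifP => // _.
by apply: leq_trans (sz_bmx _ (leqnn _)) _; apply: leq_addl.
Qed.

(** * Subdividing the edges *)

(** The edge between u < v is the node n + (u n + v). The numbers of pairs that are not edges are
    isolated nodes. *)
Definition incident n (M : bmx) x y := has (fun u => has (fun v =>
  [&& y == n + (u * n + v), u < v, get false M u v & (x == u) || (x == v)]) (iota 0 n)) (iota 0 n).

Definition node_mx n N M := mkmx N N (fun x y =>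
  (x < n) && incident n M x y || (y < n) && incident n M y x).

Section Subdivision.
Variables (n : nat) (e : rel 'I_n) (M : bmx).
Hypotheses (se : symmetric e) (ie : irreflexive e) (ME : forall u v : 'I_n, get false M u v = e u v).
Let N := n + n * n.

Lemma nodeN (u v : 'I_n) : n + (u * n + v) < N.
Proof.
rewrite ltn_add2l; apply: (@leq_trans (u.+1 * n)); first by rewrite mulSn addnC ltn_add2r.
by rewrite leq_mul2r ltn_ord orbT.
Qed.

Definition vnode (u : 'I_n) : 'I_N := widen_ord (leq_addr _ _) u.
Definition enode (u v : 'I_n) : 'I_N := Ordinal (nodeN u v).
Definition edge_node (u v : 'I_n) : 'I_N := if u < v then enode u v else enode v u.

Lemma edge_nodeC u v : edge_node u v = edge_node v u.
Proof. by rewrite /edge_node; case: (ltngtP u v) => // /val_inj->. Qed.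

Lemma enode_inj u v u' v' : enode u v = enode u' v' -> u = u' /\ v = v'.
Proof.
move=> /(congr1 val)/= /addnI H.
have n0 : 0 < n by apply: leq_ltn_trans (ltn_ord u).
have := congr1 (divn^~ n) H; have := congr1 (modn^~ n) H.
by rewrite !modnMDl !divnMDl // !modn_small // !divn_small // !addn0 => /val_inj-> /val_inj->.
Qed.

Lemma edge_node_set u v u' v' : edge_node u v = edge_node u' v' -> [set u; v] = [set u'; v'].
Proof.
by rewrite /edge_node; case: ifP => _; case: ifP => _ /enode_inj[-> ->] //; rewrite setUC.
Qed.

Lemma vnode_edge x u v : vnode x != edge_node u v.
Proof.
apply/eqP => /(congr1 val) /= H; have := ltn_ord x; rewrite H /edge_node.
by case: ifP => _ /=; rewrite ltnNge leq_addr.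
Qed.

Lemma vnode_inj : injective vnode.
Proof. by move=> x y /(congr1 val) /= /val_inj. Qed.

Definition nadj := rl N (node_mx n N M).

Lemma incidentP (x y : 'I_N) : reflect (exists u v, [/\ e u v, x = vnode u & y = edge_node u v])
  ((x < n) && incident n M x y).
Proof.
apply: (iffP andP) => [[xn]|[u [v [uv -> ->]]]].
  rewrite /incident has_iota => /existsP[u]; rewrite has_iota => /existsP[v /and4P[/eqP yE uv Muv /orP[]/eqP xE]].
    exists u, v; split; [by rewrite -ME|exact: val_inj|].
    by rewrite /edge_node uv; apply: val_inj.
  exists v, u; split; [by rewrite se -ME|exact: val_inj|].
  by rewrite edge_nodeC /edge_node uv; apply: val_inj.
split; first exact: (ltn_ord u).
have key a b : e a b -> a < b -> incident n M a (enode a b) && incident n M b (enode a b).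
  move=> ab lab; rewrite /incident !has_iota; apply/andP; split; apply/existsP; exists a;
  rewrite has_iota; apply/existsP; exists b; rewrite eqxx lab ME ab eqxx ?orbT //.
rewrite /edge_node; case: ifP => luv; first by have /andP[] := key u v uv luv.
have lvu : v < u.
  rewrite ltn_neqAle leqNgt luv andbT; apply/negP => /eqP/val_inj vu; by rewrite vu ie in uv.
by have := key v u; rewrite se => /(_ uv lvu)/andP[].
Qed.

Lemma nadjP (x y : 'I_N) : reflect (exists u v, e u v /\
  (x = vnode u /\ y = edge_node u v \/ y = vnode u /\ x = edge_node u v)) (nadj x y).
Proof.
rewrite /nadj rl_mkmx; apply: (iffP orP) => [[/incidentP[u [v [uv a b]]]|/incidentP[u [v [uv a b]]]]|].
- by exists u, v; split=> //; left.
- by exists u, v; split=> //; right.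
by case=> u [v [uv [[a b]|[a b]]]]; [left|right]; apply/incidentP; exists u, v.
Qed.

Lemma nadj_sym : symmetric nadj.
Proof.
move=> x y; apply/nadjP/nadjP => -[u [v [uv [h|h]]]]; exists u, v; split=> //; [by right|by left|by right|by left].
Qed.

Lemma nadj_irr : irreflexive nadj.
Proof.
move=> x; apply/negP => /nadjP[u [v [_ [[-> /eqP]|[-> /eqP]]]]]; by rewrite (negPf (vnode_edge _ _ _)).
Qed.

Lemma nadj_bip (TT : seq {set 'I_N}) : (forall T x, T \in TT -> x \in T -> exists u, x = vnode u) ->
  forall x y, black TT x -> black TT y -> ~~ nadj x y.
Proof.
move=> H x y /hasP[T TT1 xT] /hasP[T' TT2 yT]; apply/negP => /nadjP[u [v [_ [[_ h]|[_ h]]]]].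
  by have [w yw] := H _ _ TT2 yT; have := vnode_edge w u v; rewrite -yw h eqxx.
by have [w yw] := H _ _ TT1 xT; have := vnode_edge w u v; rewrite -yw h eqxx.
Qed.

(* Every element-disjoint path from [A] to [B] crosses the cut in an element of its own. *)
Lemma path_crosses (T : {set 'I_n}) (A B : {set 'I_N}) u p :
  (forall x y, x \in A -> y \in B -> ~~ nadj x y) -> (forall x, x \in T -> vnode x \in A :|: B) ->
  path e u p -> vnode u \in A -> vnode (last u p) \notin A ->
  exists2 z, z \notin A :|: B & (exists2 x, x \in [seq x <- u :: p | x \notin T] & z = vnode x) \/
    (exists2 xy, [set xy.1; xy.2] \in path_edges u p & z = edge_node xy.1 xy.2).
Proof.
move=> nE tT; elim: p u => [|y p IH] u /=; first by move=> _ ->.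
case/andP=> uy py uA lA.
have a1 : nadj (vnode u) (edge_node u y) by apply/nadjP; exists u, y; split=> //; left.
have a2 : nadj (edge_node u y) (vnode y).
  by apply/nadjP; exists y, u; rewrite se; split=> //; right; rewrite edge_nodeC.
have nB : edge_node u y \notin B by apply/negP => eB; have := nE _ _ uA eB; rewrite a1.
case: (boolP (edge_node u y \in A)) => [eA|neA]; last first.
  exists (edge_node u y); first by rewrite inE negb_or neA.
  by right; exists (u, y) => //=; rewrite mem_head.
have yB : vnode y \notin B by apply/negP => yB; have := nE _ _ eA yB; rewrite a2.
case: (boolP (vnode y \in A)) => [yA|nyA]; last first.
  exists (vnode y); first by rewrite inE negb_or nyA.
  left; exists y => //; have yT : y \notin T.
    by apply/negP => /tT; rewrite inE (negPf nyA) (negPf yB).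
  by case: (u \notin T); rewrite /= yT ?inE eqxx ?orbT.
have [z zAB [[x xs zE]|[xy xys zE]]] := IH y py yA lA; exists z => //; [left|right].
  by exists x => //; case: (u \notin T); rewrite //= inE xs orbT.
by exists xy => //; rewrite inE xys orbT.
Qed.

(** The easy direction of Menger's theorem suffices: choosing for each path an element in which it
    meets the separator is injective, as distinct paths share neither edges nor non-terminals. *)
Lemma kcut_kappa k (T : {set 'I_n}) (TT : seq {set 'I_N}) :
  (forall S x, S \in TT -> x \in S -> exists2 u, u \in T & x = vnode u) ->
  (forall u, u \in T -> black TT (vnode u)) ->
  (forall S u v, S \in TT -> vnode u \in S -> vnode v \in S -> u != v -> k <= kappa e T u v) ->
  kcut k nadj TT.
Proof.
move=> TTv bT hk A B [d nE c /hasP[S STT /splitsP[a [b [aS aA bS bB]]]]].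
have [u uT au] := TTv _ _ STT aS; have [v vT bv] := TTv _ _ STT bS; subst a b.
have uv : u != v by apply/eqP => e'; have := disjointFr d aA; rewrite e' bB.
have tT x : x \in T -> vnode x \in A :|: B.
  by move=> /bT/hasP[S' STT' xS]; apply: (subsetP (c _ STT')).
apply: leq_trans (hk S u v STT aS bS uv) _.
apply/bigmax_leqP => P /andP[/forallP paths /forallP disj].
pose good (p : #|'I_n|.-bseq 'I_n) (z : 'I_N) := (z \notin A :|: B) &&
  ([exists x, (x \in [seq x <- u :: p | x \notin T]) && (z == vnode x)] ||
   [exists x, exists y, ([set x; y] \in path_edges u p) && (z == edge_node x y)]).
pose f p := odflt (vnode v) [pick z | good p z].
have fP p : p \in P -> good p (f p).
  move=> pP; have := paths p; rewrite pP => /and3P[pp /eqP lp _].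
  rewrite /f; case: pickP => [//|none].
  have lA : vnode (last u p) \notin A by rewrite lp; apply/negP => vA; have := disjointFr d vA; rewrite bB.
  have [z zAB h] := path_crosses nE tT pp aA lA.
  have := none z; rewrite /good zAB /=; case: h => [[x xs ->]|[xy xys ->]].
    by have -> : [exists x0, (x0 \in [seq x <- u :: p | x \notin T]) && (vnode x == vnode x0)] by [apply/existsP; exists x; rewrite xs eqxx].
  have -> : [exists x, exists y, ([set x; y] \in path_edges u p) && (edge_node xy.1 xy.2 == edge_node x y)].
    by apply/existsP; exists xy.1; apply/existsP; exists xy.2; rewrite xys eqxx.
  by rewrite orbT.
have finj : {in P &, injective f}.
  move=> p q pP qP fpq; apply/eqP/negPn/negP => npq.
  have := disj p; rewrite pP /= => /forallP/(_ q); rewrite qP npq /= => /andP[d1 d2].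
  have /andP[_ gp] := fP p pP; have /andP[_ gq] := fP q qP; rewrite -fpq in gq.
  case/orP: gp => [/existsP[x /andP[xs /eqP zx]]|/existsP[x /existsP[y /andP[xs /eqP zx]]]];
  case/orP: gq => [/existsP[x' /andP[xs' /eqP zx']]|/existsP[x' /existsP[y' /andP[xs' /eqP zx']]]].
  - by rewrite zx in zx'; have := disjointFr d2 xs; rewrite (vnode_inj zx') xs'.
  - by have := vnode_edge x x' y'; rewrite -zx zx' eqxx.
  - by have := vnode_edge x' x y; rewrite -zx' zx eqxx.
  rewrite zx in zx'; have := disjointFr d1 xs; by rewrite (edge_node_set zx') xs'.
rewrite -(card_in_imset finj); apply: subset_leq_card; apply/subsetP => _ /imsetP[p pP ->].
by have /andP[] := fP p pP; rewrite in_setC.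
Qed.

Definition class_rel (T : {set 'I_n}) (U : {set 'I_N}) : rel 'I_n := fun x y =>
  [&& e x y, edge_node x y \in U, (x \in T) || (vnode x \in U) & (y \in T) || (vnode y \in U)].

Lemma class_connect (T : {set 'I_n}) TT U x y : (forall z : 'I_N, black TT z -> exists2 u, u \in T & z = vnode u) ->
  connect (gam nadj TT U) (vnode x) (vnode y) -> connect (class_rel T U) x y.
Proof.
move=> bT /connectP[p pp lp].
(* The invariant along a walk in the subdivided graph: at the node of an edge, the end from which it
   was entered is remembered, and the edge counts as traversed only if the walk leaves by the other
   end. *)
pose Q (z : 'I_N) := (exists2 u, z = vnode u & connect (class_rel T U) x u) \/
  (exists u v, [/\ e u v, z = edge_node u v, z \in U, (u \in T) || (vnode u \in U) & connect (class_rel T U) x u]).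
have Q0 : Q (vnode x) by left; exists x.
have inT z : z \in [set x | black TT x] :|: U -> forall u, z = vnode u -> (u \in T) || (vnode u \in U).
  move=> + u zu; rewrite !inE => /orP[/bT[u' uT]|]; last by rewrite zu => ->; rewrite orbT.
  by rewrite zu => /vnode_inj->; rewrite uT.
have inU z u v : z = edge_node u v -> z \in [set x | black TT x] :|: U -> z \in U.
  move=> zE; rewrite !inE => /orP[/bT[w _ zw]|//].
  by have := vnode_edge w u v; rewrite -zw zE eqxx.
have Qlast : Q (last (vnode x) p).
  move: {lp} Q0 pp; move: (vnode x) => a; elim: p a => //= b p IH a Qa /andP[/and3P[ab aU bU] pb].
  apply: IH pb; case/nadjP: ab => u [v [uv [[aE bE]|[bE aE]]]].
    right; case: Qa => [[u' aE' cu]|[u' [v' [_ aE' _ _ _]]]]; last first.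
      by have := vnode_edge u u' v'; rewrite -aE aE' eqxx.
    have uu : u' = u by apply: vnode_inj; rewrite -aE -aE'.
    subst u'; exists u, v; split=> //; [exact: (inU b u v)|exact: (inT a aU u aE)].
  left; exists u => //; case: Qa => [[u' aE' _]|[u' [v' [uv' aE' aU' u'T cu]]]].
    by have := vnode_edge u' u v; rewrite -aE -aE' eqxx.
  have uT := inT _ bU u bE.
  have : u \in [set u'; v'] by rewrite -(edge_node_set (etrans (esym aE) aE')) !inE eqxx.
  rewrite !inE => /orP[/eqP->//|/eqP uv2]; subst v'.
  apply: connect_trans cu (connect1 _); rewrite /class_rel uv' -aE' aU' u'T; exact: uT.
rewrite -lp in Qlast; case: Qlast => [[u /vnode_inj->//]|[u [v [_ h _ _ _]]]].
by have := vnode_edge y u v; rewrite h eqxx.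
Qed.

End Subdivision.

(** * The algorithm *)

(** The final copy of the matrix makes its dimensions explicit, which the comparison with the
    required encoding uses ([enc_class]). *)
Definition class_graph n (M : bmx) (bl U : seq bool) : seq bool * bmx :=
  let vs := mkrow n (fun x => nth false bl x || nth false U x) in
  let F := prune n (mkmx n n (fun x y => [&& get false M x y,
    nth false U (n + (if x < y then x * n + y else y * n + x)), nth false vs x & nth false vs y])) in
  (vs, mkmx n n (fun x y => get false F x y)).

(** [k] is not part of the input. Validity is monotone in the threshold, so this count is the
    largest valid one up to [N]. *)
Definition connectivity N adj Ts := count (fun i => kcutb N adj Ts i.+1) (iota 0 N).

(** For [r = 0] one forest is still owed when the connectivity is positive, and all nodes together
    supply it. The cap comes from 4 ^ q <= 64 (|T| + 1)^2 for the value of [q] chosen in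
    [steiner]. *)
Definition classes n N k q0 q L r (adj Ts : bmx) : bmx :=
  if k == 0 then [::]
  else if r == 0 then mkmx 1 N (fun _ _ => true)
  else let s := iter n (phase N k q0 q L r (64 * (N.+1 * N.+1)))
           ((adj, mkmx N N (fun x a => x == a)), (Ts, [::])) in
    mkmx r N (fun j a => get false s.2.2 j a).

(** The summand 3 in [q] ensures 10 |T| <= 4 ^ q. The last divisor is 256 (q + 1), from the
    requirement 128 (2 r) (q + 1) <= q0 of the colouring with 2 r colours; it is written as a
    successor to fit [p_divS]. *)
Definition steiner (p : bmx * bmx) : seq (seq bool * bmx) :=
  let n := size p.1 in
  let N := n + n * n in
  let adj := node_mx n N p.1 in
  let bl := blacks N p.2 in
  let k := connectivity N adj p.2 in
  let L := trunc_log 2 (size p.2) in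
  let q := trunc_log 2 (count (fun x => nth false bl x) (iota 0 N)) + 3 in
  let q0 := k %/ L.+1 in
  let r := q0 %/ (255 + 256 * q).+1 in
  [seq class_graph n p.1 bl U | U <- classes n N k q0 q L r adj p.2].

Lemma count_lt_iota l n : l <= n -> count (fun i => i < l) (iota 0 n) = l.
Proof.
move=> ln; rewrite -[in iota 0 n](subnKC ln) iotaD count_cat.
rewrite (_ : count _ (iota 0 l) = l); last first.
  by rewrite -[RHS](size_iota 0); apply/eqP; rewrite -all_count; apply/allP => i; rewrite mem_iota.
rewrite (_ : count _ (iota (0 + l) _) = 0) ?addn0 //.
apply/eqP; rewrite -leqn0 leqNgt -has_count; apply/hasPn => i; rewrite mem_iota add0n -leqNgt.
by case/andP.
Qed.

Lemma p_divS X (cX : codable X) (f g : X -> nat) : PT f -> PT g -> PT (fun x => f x %/ (g x).+1).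
Proof.
move=> Hf Hg; apply: (@PT_ext _ _ _ _ (fun x => count (fun i => i.+1 * (g x).+1 <= f x) (iota 0 (f x)))) => [x|]; last by pt.
rewrite -[RHS](count_lt_iota (leq_div (f x) (g x).+1)); apply: eq_count => i.
by rewrite leq_divRL.
Qed.

Lemma p_trunc_log X (cX : codable X) (f : X -> nat) : PT f -> PT (fun x => trunc_log 2 (f x)).
Proof.
move=> Hf; apply: (@PT_ext _ _ _ _ (fun x => count (fun i => minn (f x).+1 (2 ^ i.+1) <= f x) (iota 0 (f x)))) => [x|]; last by pt.
set n := f x; case: (posnP n) => [->//|n0].
have /andP[lo hi] := trunc_log_bounds (isT : 1 < 2) n0; set l := trunc_log 2 n in lo hi *.
have ln : l <= n by apply: leq_trans (ltnW (ltn_expl l (isT : 1 < 2))) lo.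
have E i : (minn n.+1 (2 ^ i.+1) <= n) = (i < l).
  rewrite geq_min ltnn /=; apply/idP/idP => [h|h].
    by rewrite -ltnS -(ltn_exp2l _ _ (isT : 1 < 2)); apply: leq_ltn_trans h hi.
  by apply: leq_trans lo; rewrite leq_exp2l.
by rewrite (eq_count E) count_lt_iota.
Qed.

Lemma sz_bmx_le r N (f : nat -> nat -> bool) :
  @sz _ (code_seq (code_seq code_bool)) (mkmx r N f) <= r * (N * 4 + 2) + 1.
Proof. by apply: (@sz_mkmx _ _ r N f 3) => i j _ _; rewrite sz_bool; case: (f i j). Qed.

Lemma reduce_sz N Ts k (s : bmx * bmx) B : sz s.1 <= B -> sz s.2 <= B -> bsz N <= B ->
  sz (reduce N Ts k s).1 <= B /\ sz (reduce N Ts k s).2 <= B.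
Proof.
move=> h1 h2 hB; rewrite /reduce; elim: (_ * _) => [|i [IH1 IH2]] //=.
rewrite {1 3}/reduce_step; case: ifP => // _; case: ifP => _ /=; split=> //;
by apply: leq_trans (sz_bmx _ (leqnn _)) _.
Qed.

Ltac pt_b1 := first [pt_a10 | lazymatch goal with
  | |- PT (fun x => (@?f x) %/ (@?g x).+1) => refine (p_divS _ _)
  | |- PT (fun x => trunc_log 2 (@?f x)) => refine (p_trunc_log _)
  | |- PT (fun x => prune (@?n x) (@?F x)) => refine (p_prune _ _)
  end].
Ltac pt_user ::= pt_b1.

Lemma p_main_loop X (cX : codable X) (n N k q0 q L r cap : X -> nat) s :
  PT n -> PT N -> PT k -> PT q0 -> PT q -> PT L -> PT r -> PT cap -> PT s ->
  PT (fun x => iter (n x) (phase (N x) (k x) (q0 x) (q x) (L x) (r x) (cap x)) (s x)).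
Proof.
move=> Hn HN Hk Hq0 Hq HL Hr Hc Hs.
(* Every component of the state is either inherited or a Boolean matrix of known dimensions, and the
   number of terminal sets is the same in all phases. *)
pose (B := fun x => sz (s x) + bsz (N x) + (r x * (N x * 4 + 2) + 1) + (size (s x).2.1 * (bsz (N x) + 1) + 1)).
apply: (p_iter (B := fun x => 4 * B x + 3)).
- by apply: p_phase; pt.
- exact: Hs.
- exact: Hn.
- assert (H1 := PT_sz Hs); assert (H2 := pbnd_nat HN); assert (H3 := pbnd_nat Hr).
  assert (H4 : PT (fun x => size (s x).2.1)) by pt.
  assert (H5 := pbnd_nat H4); rewrite /B; by auto 15 with pbnd.
move=> x i _; set F := phase _ _ _ _ _ _ _.
pose szb (M : bmx) := @sz _ (code_seq (code_seq code_bool)) M.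
suff : [/\ szb (iter i F (s x)).1.1 <= B x, szb (iter i F (s x)).1.2 <= B x, szb (iter i F (s x)).2.1 <= B x,
    szb (iter i F (s x)).2.2 <= B x & size (iter i F (s x)).2.1 = size (s x).2.1].
  case: (iter i F (s x)) => [[a b] [c d]] [/= h1 h2 h3 h4 _]; rewrite !sz_pair.
  by change (((szb a + szb b).+1 + (szb c + szb d).+1).+1 <= 4 * B x + 3); lia.
have bB : bsz (N x) <= B x by rewrite /B; lia.
elim: i => [|i] /=.
  have : szb (s x).1.1 + szb (s x).1.2 + (szb (s x).2.1 + szb (s x).2.2) <= B x.
    rewrite /B; case: (s x) => [[a b] [c d]]; rewrite !sz_pair /=.
    change (szb a + szb b + (szb c + szb d) <= ((szb a + szb b).+1 + (szb c + szb d).+1).+1 + bsz (N x) +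
      (r x * (N x * 4 + 2) + 1) + (size c * (bsz (N x) + 1) + 1)); lia.
  by move=> h; split=> //; lia.
move: (iter i F (s x)) => t [h1 h2 h3 h4 h5]; rewrite /F /phase.
have TB (g : seq bool -> nat -> bool) : szb [seq mkrow (N x) (g T) | T <- t.2.1] <= B x.
  apply: leq_trans (@sz_seq_le _ _ _ (bsz (N x)) _) _.
    by move=> j d; rewrite size_map => jt; rewrite (nth_map [::]) //; apply: sz_brow.
  by rewrite size_map h5 addn1 /B; lia.
case: ifP => _; last by split.
have [r1 r2] := reduce_sz t.2.1 (k x) h1 h2 bB.
case: ifP => _ /=; split=> //; rewrite ?size_map //; try by apply: leq_trans (sz_bmx _ (leqnn _)) bB.
- exact: (TB (fun T y => _)).
- exact: (TB (fun T y => _)).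
by apply: leq_trans (sz_bmx_le (r x) (N x) _) _; rewrite /B; lia.
Qed.

Lemma p_class_graph X (cX : codable X) (n : X -> nat) M bl U : PT n -> PT M -> PT bl -> PT U ->
  PT (fun x => class_graph (n x) (M x) (bl x) (U x)).
Proof. by move=> Hn HM Hb HU; rewrite /class_graph; pt. Qed.

Lemma p_classes X (cX : codable X) (n N k q0 q L r : X -> nat) adj Ts :
  PT n -> PT N -> PT k -> PT q0 -> PT q -> PT L -> PT r -> PT adj -> PT Ts ->
  PT (fun x => classes (n x) (N x) (k x) (q0 x) (q x) (L x) (r x) (adj x) (Ts x)).
Proof.
move=> Hn HN Hk Hq0 Hq HL Hr Ha HT; rewrite /classes.
assert (H : PT (fun x => iter (n x) (phase (N x) (k x) (q0 x) (q x) (L x) (r x) (64 * ((N x).+1 * (N x).+1)))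
           ((adj x, mkmx (N x) (N x) (fun x a => x == a)), (Ts x, [::])))).
  by apply: p_main_loop; pt.
apply: PT_if; [by pt|by pt|apply: PT_if; [by pt|by pt|]].
apply: p_mkmx; [by pt|by pt|].
apply: p_get; [|by pt|by pt].
exact: (p_snd (p_snd (PT_comp (p_fst (p_fst (PT_id _))) H))).
Qed.

Ltac pt_b2 := first [pt_b1 | lazymatch goal with
  | |- PT (fun x => classes (@?n x) (@?N x) (@?k x) (@?q0 x) (@?q x) (@?L x) (@?r x) (@?a x) (@?T x)) =>
      refine (p_classes _ _ _ _ _ _ _ _ _)
  | |- PT (fun x => class_graph (@?n x) (@?M x) (@?b x) (@?U x)) => refine (p_class_graph _ _ _ _)
  end].
Ltac pt_user ::= pt_b2.

Lemma PT_steiner : PT steiner.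
Proof.
rewrite /steiner /connectivity /node_mx /incident; apply: p_map.
  by pt.
by pt.
Qed.

(** * Correctness *)

Section Correctness.
Variables (n : nat) (e : rel 'I_n) (m : nat) (Ts : 'I_m -> {set 'I_n}).
Hypotheses (se : symmetric e) (ie : irreflexive e).
Let T := \bigcup_i Ts i.
Let N := n + n * n.
Let M : bmx := [seq [seq e x y | y <- enum 'I_n] | x <- enum 'I_n].
Let TL : bmx := [seq [seq x \in Ts i | x <- enum 'I_n] | i <- enum 'I_m].
Let TT := [seq st N l | l <- TL].
Let adj := node_mx n N M.

Lemma nth_enum_map A (f : 'I_n -> A) d (x : 'I_n) : nth d [seq f y | y <- enum 'I_n] x = f x.
Proof. by rewrite (nth_map x) ?size_enum_ord // nth_ord_enum. Qed.

Lemma MatE (u v : 'I_n) : get false M u v = e u v.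
Proof. by rewrite /get !nth_enum_map. Qed.

Lemma size_TL : size TL = m. Proof. by rewrite size_map size_enum_ord. Qed.

Lemma nth_TL (i : 'I_m) : nth [::] TL i = [seq x \in Ts i | x <- enum 'I_n].
Proof. by rewrite (nth_map i) ?size_enum_ord // nth_ord_enum. Qed.

Lemma in_TT (i : 'I_m) (z : 'I_N) :
  z \in nth set0 TT i <-> exists2 u, u \in Ts i & z = vnode u.
Proof.
rewrite (nth_map [::]) ?size_TL // nth_TL inE; split=> [|[u uT ->]]; last by rewrite nth_enum_map.
case: (ltnP z n) => zn; last by rewrite nth_default // size_map size_enum_ord.
rewrite -[nat_of_ord z]/(nat_of_ord (Ordinal zn)) nth_enum_map => zT.
by exists (Ordinal zn) => //; apply: val_inj.
Qed.

Lemma TT_nth S : S \in TT -> exists i : 'I_m, S = nth set0 TT i.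
Proof.
move=> /(nthP set0)[i]; rewrite size_map size_TL => im <-; by exists (Ordinal im).
Qed.

Lemma black_TT z : black TT z <-> exists2 u, u \in T & z = vnode u.
Proof.
split=> [/hasP[S /TT_nth[i ->] /in_TT[u uT ->]]|[u /bigcupP[i _ uT] ->]].
  by exists u => //; apply/bigcupP; exists i.
apply/hasP; exists (nth set0 TT i); last by apply/in_TT; exists u.
by apply: mem_nth; rewrite size_map size_TL.
Qed.

Lemma black_vnode u : black TT (vnode u) = (u \in T).
Proof.
apply/idP/idP => [/black_TT[u' uT /vnode_inj->]//|uT]; by apply/black_TT; exists u.
Qed.

Lemma card_black : #|[set z | black TT z]| = #|T|.
Proof.
rewrite -(card_imset _ (@vnode_inj n)); apply: eq_card => z; rewrite inE.
by apply/idP/imsetP => [/black_TT|/black_TT].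
Qed.

Lemma card_edge_set : #|edge_set e| <= N.
Proof.
apply: leq_trans (leq_imset_card _ _) _; apply: leq_trans (leq_addl _ _).
by rewrite -[X in _ <= X](_ : #|{: 'I_n * 'I_n}| = _) ?max_card // card_prod card_ord.
Qed.

(** The second conclusion comes from the neutral element of [kappa_set], the number of edges. It is
    needed because [connectivity] counts only up to [N]. *)
Lemma kappa_kcut k : 0 < m -> (forall i, k <= kappa_set e T (Ts i)) -> kcut k (rl N adj) TT /\ k <= N.
Proof.
move=> m0 hk; split; last first.
  apply: leq_trans (hk (Ordinal m0)) _; apply: leq_trans card_edge_set.
  rewrite /kappa_set; elim/big_rec: _ => // z x _ h; exact: leq_trans (geq_minr _ _) h.
apply: (@kcut_kappa n e M se ie MatE k T) => [S z /TT_nth[i ->] /in_TT[u uT ->]|u|S u v /TT_nth[i ->]].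
- by exists u => //; apply/bigcupP; exists i.
- by rewrite black_vnode.
move=> /in_TT[u' uT /vnode_inj uu] /in_TT[v' vT /vnode_inj vv] uv; subst u' v'.
apply: leq_trans (hk i) _; rewrite /kappa_set.
elim: (index_enum _) (mem_index_enum (u, v)) => // z s IH; rewrite inE big_cons => /orP[/eqP<-|/IH h].
  by rewrite /= uT vT uv geq_minl.
by case: ifP => // _; apply: leq_trans (geq_minr _ _) h.
Qed.

Lemma kcut_le k k' : k' <= k -> kcut k (rl N adj) TT -> kcut k' (rl N adj) TT.
Proof. by move=> le kc A B sc; apply: leq_trans le (kc A B sc). Qed.

Let K := connectivity N adj TL.

Lemma connectivityP : kcut K (rl N adj) TT /\ forall k, kcut k (rl N adj) TT -> k <= N -> k <= K.
Proof.
pose P i := kcutb N adj TL i.+1.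
have mono i j : i <= j -> P j -> P i.
  by move=> ij /kcutP kc; apply/kcutP; apply: kcut_le kc.
split; last first.
  move=> k kc kN; rewrite /K /connectivity -[in iota 0 N](subnKC kN) iotaD count_cat.
  apply: leq_trans (leq_addr _ _); rewrite -{1}(size_iota 0 k) (_ : count _ _ = size (iota 0 k)) //.
  apply/eqP; rewrite -all_count; apply/allP => i; rewrite mem_iota => /= ik.
  by apply/kcutP; apply: kcut_le kc.
case EK: K => [|i]; first by move=> A B _.
apply/kcutP; case: (boolP (kcutb N adj TL i.+1)) => // nP; exfalso.
have iN : i <= N.
  have : K <= N by rewrite -[X in _ <= X](size_iota 0); apply: count_size.
  by rewrite EK => /ltnW.
have : K <= i.
  rewrite /K /connectivity -[in iota 0 N](subnKC iN) iotaD count_cat -[X in _ <= X]addn0.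
  apply: leq_add; first by apply: leq_trans (count_size _ _) _; rewrite size_iota.
  rewrite leqNgt -has_count; apply/hasPn => j; rewrite mem_iota add0n => /andP[ij _].
  by apply: contra nP; apply: (mono i j).
by rewrite EK ltnn.
Qed.

Let bl := blacks N TL.

Definition class_subgraph U : subgraph 'I_n :=
  Subgraph (st n (class_graph n M bl U).1) (rl n (class_graph n M bl U).2).

Lemma class_subgraphE U : sg_verts (class_subgraph U) = [set x | (x \in T) || (vnode x \in st N U)].
Proof.
rewrite /= st_mkrow; apply/setP => x; rewrite !inE -black_vnode -blacksE.
by congr (nth _ _ _ || _).
Qed.

Lemma class_subgraphP U :
  [/\ symmetric (sg_adj (class_subgraph U)), subrel (sg_adj (class_subgraph U)) (class_rel e T (st N U)),
    acyclic (sg_adj (class_subgraph U)) &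
    forall x y, connect (class_rel e T (st N U)) x y -> connect (sg_adj (class_subgraph U)) x y].
Proof.
rewrite /class_subgraph /class_graph /=; set F := mkmx n n (fun x y => [&& _, _, _ & _]).
have FE : rl n F = class_rel e T (st N U).
  apply: rl_eq => x y; rewrite rl_mkmx /class_rel MatE; congr [&& _, _, _ & _].
  - by rewrite inE /edge_node; case: ifP.
  - by rewrite nth_mkrow // -black_vnode -blacksE inE.
  by rewrite nth_mkrow // -black_vnode -blacksE inE.
have sF : symmetric (rl n F).
  move=> x y; rewrite FE /class_rel se edge_nodeC; congr [&& _, _ & _]; exact: andbC.
have [s1 sub c1 a1] := pruneP sF.
have E : rl n (mkmx n n (fun x y => get false (prune n F) x y)) = rl n (prune n F).
  by apply: rl_eq => x y; rewrite rl_mkmx.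
rewrite E -FE; split=> // x y; by rewrite c1.
Qed.

Lemma class_steiner U : (forall (i : 'I_m) a b, a \in nth set0 TT i -> b \in nth set0 TT i ->
    connect (gam (rl N adj) TT (st N U)) a b) -> steiner_forest e Ts (class_subgraph U).
Proof.
move=> H; have [s1 sub a1 c1] := class_subgraphP U; split=> //.
- split=> //; first by move=> x y /sub/and4P[].
  by move=> x y /sub/and4P[_ _ h1 h2]; rewrite class_subgraphE; apply/andP; split; rewrite inE.
- by apply/subsetP => x xT; rewrite class_subgraphE inE xT.
move=> i x y xT yT; apply: c1; apply: (@class_connect n e M se ie MatE T TT).
  by move=> z /black_TT.
by apply: (H i); apply/in_TT; [exists x|exists y].
Qed.

Lemma class_disjoint U U' : [disjoint st N U & st N U'] ->
  element_disjoint T (class_subgraph U) (class_subgraph U').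
Proof.
move=> d; have [_ sub _ _] := class_subgraphP U; have [_ sub' _ _] := class_subgraphP U'.
apply/andP; split.
  apply/forallP => x; apply/forallP => y; apply/negP => /andP[/sub/and4P[_ h _ _] /sub'/and4P[_ h' _ _]].
  by have := disjointFr d h; rewrite h'.
apply/subsetP => x; rewrite inE !class_subgraphE !inE.
case: (boolP (x \in T)) => //= xT /andP[h h'].
by have := disjointFr d (x := vnode x); rewrite !inE h => /(_ isT); rewrite h'.
Qed.

Let L := trunc_log 2 m.
Let q := trunc_log 2 #|T| + 3.
Let r := K %/ L.+1 %/ (255 + 256 * q).+1.

Lemma classes_correct C : C = classes n N K (K %/ L.+1) q L r adj TL -> 0 < m ->
  [/\ size C = (if K == 0 then 0 else if r == 0 then 1 else r),
    forall j (i : 'I_m) a b, j < size C -> a \in nth set0 TT i -> b \in nth set0 TT i ->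
      connect (gam (rl N adj) TT (st N (nth [::] C j))) a b &
    forall i j, i < size C -> j < size C -> i != j -> [disjoint st N (nth [::] C i) & st N (nth [::] C j)]].
Proof.
move=> -> m0; rewrite /classes; have [kK _] := connectivityP.
have K_N : K <= N by rewrite -[X in _ <= X](size_iota 0); apply: count_size.
case: (posnP K) => [_|K0]; first by split.
case: (posnP r) => [_|r0].
  split=> //; last by case=> // -[].
  case=> // i a b _ aT bT; set U := st N _.
  have UT : U = setT by apply/setP => x; rewrite !inE /= (nth_map 0) ?size_iota.
  rewrite UT; apply/negPn/negP => nc.
  have gE x y : gam (rl N adj) TT setT x y = rl N adj x y by rewrite /gam !inE !orbT !andbT.
  (* Were [b] not reachable, the component of [a] and its complement would form a cut with empty
     separator, although [K] is positive. *)
  pose A := [set z | connect (gam (rl N adj) TT setT) a z].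
  have := kK A (~: A); rewrite setUCr setCT cards0 leqn0 => H.
  suff : K == 0 by rewrite gtn_eqF.
  apply: H; split.
  - by rewrite disjoints_subset setCK.
  - move=> x y; rewrite !inE => ax nay; apply: contra nay => xy.
    by apply: connect_trans ax (connect1 _); rewrite gE.
  - by move=> S _; rewrite setUCr subsetT.
  apply/hasP; exists (nth set0 TT i); first by apply: mem_nth; rewrite size_map size_TL.
  by apply/splitsP; exists a, b; rewrite !inE connect0.
set cap := 64 * _; set s0 := (_, _); set it := iter _ _ _.
have q0h : 128 * (2 * r) * q.+1 <= K %/ L.+1.
  apply: leq_trans (leq_trunc_div (K %/ L.+1) (255 + 256 * q).+1); rewrite -/r; lia.
have Lk : L.+1 * (K %/ L.+1) <= K by rewrite mulnC leq_trunc_div.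
have mL : size TT < 2 ^ L.+1 by rewrite size_map size_TL; have /andP[] := trunc_log_bounds (isT : 1 < 2) m0.
have q1 : 1 < q by rewrite /q; lia.
have tb : #|T| < 2 ^ (trunc_log 2 #|T|).+1 /\ 2 ^ trunc_log 2 #|T| <= #|T|.+1.
  case: (posnP #|T|) => [->|t0]; first by [].
  by have /andP[h1 h2] := trunc_log_bounds (isT : 1 < 2) t0; split=> //; apply: leqW.
have q4 : 4 ^ q = 64 * (2 ^ trunc_log 2 #|T| * 2 ^ trunc_log 2 #|T|).
  by rewrite /q expnD (_ : 4 = 2 * 2) // expnMn mulnC.
have h10 : 10 * #|T| <= 4 ^ q.
  rewrite q4; case: tb; rewrite expnS; have : 0 < 2 ^ trunc_log 2 #|T| by rewrite expn_gt0.
  move: #|T| (2 ^ trunc_log 2 #|T|) => b a; clear; nia.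
have TN : #|T| <= N.
  apply: leq_trans (leq_addr _ _); rewrite -[X in _ <= X]card_ord; exact: max_card.
have hcap : 4 ^ q <= cap.
  rewrite q4 /cap leq_mul2l /=; have [_ h] := tb.
  by apply: leq_mul; apply: leq_trans h _; rewrite ltnS.
have sym0 : symmetric (rl N adj) by apply: nadj_sym se ie MatE.
have mi : minv (rl N adj) TT r K s0.1.1 s0.1.2 s0.2.1 s0.2.2.
  split=> //=.
  have -> : py N (mkmx N N (fun x a => x == a)) = fun x => [set x].
    by apply: py_eq => x; apply/setP => a; rewrite !inE get_mkmx // eq_sym.
  have -> : cl N [::] = fun=> set0.
    apply: functional_extensionality => j; apply/setP => a; rewrite !inE /get.
    by rewrite (nth_default [::]) // nth_nil.
  apply: (linv_init _ sym0); first by move=> z; exact: (nadj_irr se ie MatE z).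
  apply: (nadj_bip se ie MatE) => S z /TT_nth[i ->] /in_TT[u _ ->]; by exists u.
have bs : 10 * #|[set x | black (map (st N) s0.2.1) x]| <= 4 ^ q by rewrite /= -/TT card_black.
have bn : #|[set x | black (map (st N) s0.2.1) x]| <= n.
  by rewrite /= -/TT card_black -[X in _ <= X]card_ord max_card.
have [h1 h2] := mainP sym0 r0 Lk mL q0h q1 hcap mi bs bn.
have clE j : j < r -> st N (nth [::] (mkmx r N (fun j a => get false it.2.2 j a)) j) = cl N it.2.2 j.
  by move=> jr; apply/setP => a; rewrite !inE -/(get false _ j a) get_mkmx.
rewrite size_map size_iota; split=> //.
- move=> j i a b jr aT bT; rewrite clE //; apply: (h1 i j) => //.
  by rewrite size_map size_TL.
by move=> i j ir jr ij; rewrite !clE //; apply: h2.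
Qed.

Lemma steinerE : steiner (M, TL) = [seq class_graph n M bl U | U <- classes n N K (K %/ L.+1) q L r adj TL].
Proof.
have sM : size M = n by rewrite size_map size_enum_ord.
have cT : count (fun x => nth false (blacks N TL) x) (iota 0 N) = #|T|.
  by rewrite count_iota -card_black; apply: eq_card => z; rewrite !inE blacksE.
by rewrite /steiner /= sM -/N -/adj -/K cT size_TL.
Qed.

Lemma enc_instanceE : code (M, TL) = enc_instance e Ts.
Proof.
rewrite /code /code_prod /enc_instance /=; congr Node; rewrite /code /code_seq.
  rewrite /enc_rel -map_comp; congr enc_seq; apply: eq_map => x /=.
  by rewrite /code /enc_pred -map_comp.
rewrite -map_comp; congr enc_seq; apply: eq_map => i /=.
by rewrite /code /enc_set /enc_pred -map_comp.
Qed.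

Lemma enc_maskE (l : seq bool) : size l = n -> enc_pred (fun x : 'I_n => nth false l x) = code l.
Proof.
move=> sl; rewrite /enc_pred /code /code_seq; congr enc_seq.
rewrite (_ : [seq enc_bool (nth false l (nat_of_ord x)) | x <- enum 'I_n] =
  [seq enc_bool b | b <- [seq nth false l i | i <- [seq val x | x <- enum 'I_n]]]); last by rewrite -!map_comp.
by rewrite val_enum_ord -sl -/(mkseq (nth false l) (size l)) mkseq_nth.
Qed.

Lemma enc_class U : code (class_graph n M bl U) = enc_subgraph (class_subgraph U).
Proof.
rewrite /enc_subgraph /code /code_prod; congr Node.
  rewrite /enc_set -enc_maskE; last by rewrite size_map size_iota.
  by rewrite /enc_pred; congr enc_seq; apply: eq_map => x; rewrite !inE.
rewrite /class_subgraph /class_graph /=; set F := fun x y => get false _ x y.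
have -> : rl n (mkmx n n F) = fun x y : 'I_n => F x y by apply: rl_eq => x y; rewrite rl_mkmx.
have E : [seq mkrow n (F (val x)) | x <- enum 'I_n] = mkmx n n F.
  by have := map_comp (fun i => mkrow n (F i)) val (enum 'I_n); rewrite val_enum_ord.
rewrite /enc_rel /code /code_seq -E -map_comp; congr enc_seq; apply: eq_map => x /=.
rewrite -[LHS]/(code (mkrow n (F x))) -enc_maskE; last by rewrite size_map size_iota.
by rewrite /enc_pred; congr enc_seq; apply: eq_map => y; rewrite nth_mkrow.
Qed.

Lemma enc_familyE C : enc_family (fun i : 'I_(size C) => class_subgraph (nth [::] C i)) =
  code [seq class_graph n M bl U | U <- C].
Proof.
rewrite /enc_family /code /code_seq -map_comp; congr enc_seq.
rewrite (_ : [seq enc_subgraph (class_subgraph (nth [::] C (nat_of_ord i))) | i <- enum 'I_(size C)] =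
  [seq enc_subgraph (class_subgraph U) | U <- [seq nth [::] C i | i <- [seq val x | x <- enum 'I_(size C)]]]);
  last by rewrite -!map_comp.
rewrite val_enum_ord -/(mkseq (nth [::] C) (size C)) mkseq_nth.
by apply: eq_map => U; rewrite /= -enc_class.
Qed.

(** Rounding down loses at most a factor 2 when [r] is positive; for [r = 0] the single forest makes
    up for it. *)
Lemma K_bound : K < (if r == 0 then 1 else r.*2) * (L.+1 * (256 * q.+1)).
Proof.
have h : K < r.+1 * (L.+1 * (256 * q.+1)).
  have -> : r = K %/ (L.+1 * (256 * q.+1)) by rewrite /r -divnMA; congr (_ %/ (_ * _)); lia.
  by apply: ltn_ceil; rewrite !muln_gt0.
apply: leq_trans h _; rewrite leq_mul2r; apply/orP; right; case: (r) => // r1 /=; rewrite -addnn; lia.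
Qed.

End Correctness.

(** * Logarithms and the main theorem *)

Import Order.TTheory GRing.Theory Num.Theory.

Section Logarithms.
Variable R : realType.
Local Open Scope ring_scope.

Lemma log1_ge1 n : 1 <= log1 R n. Proof. by rewrite /log1 le_max lexx. Qed.

Lemma trunc_log_ln n : (trunc_log 2 n)%:R <= 2 * log1 R n.
Proof.
case: (posnP n) => [->|n0].
  by have := log1_ge1 0; rewrite (_ : trunc_log 2 0 = 0%N) //; lra.
have /andP[lo _] := trunc_log_bounds (isT : (1 < 2)%N) n0; set l := trunc_log 2 n in lo *.
(* From ln (1 + x) <= x at x = -1/2. *)
have ln2 : 2^-1 <= ln (2 : R).
  have := @le_ln1Dx R (- 2^-1); have -> : 1 + - 2^-1 = (2^-1 : R) by lra.
  by rewrite lnV ?posrE // => /(_ ltac:(lra)); lra.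
have h : ln (2 : R) *+ l <= ln n%:R.
  rewrite -lnXn // ler_ln ?posrE ?exprn_gt0 ?ltr0n //.
  by rewrite -natrX ler_nat.
have h2 : ln (n%:R : R) <= log1 R n by rewrite /log1 le_max lexx orbT.
have l0 : 0 <= l%:R :> R by [].
have h3 := ler_wpM2l l0 ln2.
have h' : l%:R * ln (2 : R) <= ln n%:R by rewrite mulr_natl.
lra.
Qed.

End Logarithms.

Theorem theorem4 (R : realType) :
  exists (alg : command) (d : nat) (c : R), (0 < c)%R /\
  forall (n : nat) (e : rel 'I_n) (m : nat) (Ts : 'I_m -> {set 'I_n}) (k : nat),
    symmetric e -> irreflexive e ->
    0 < m ->
    (forall i j : 'I_m, i != j -> [disjoint Ts i & Ts j]) ->
    let T := \bigcup_i Ts i in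
    (forall i : 'I_m, k <= kappa_set e T (Ts i)) ->
    exists (r : nat) (F : 'I_r -> subgraph 'I_n),
      [/\ computes_within alg (enc_instance e Ts) (enc_family F)
            (d * tree_size (enc_instance e Ts) ^ d + d),
          forall i : 'I_r, steiner_forest e Ts (F i),
          forall i j : 'I_r, i != j -> element_disjoint T (F i) (F j) &
          (c * k%:R / (log1 R #|T| * log1 R m) <= r%:R)%R].
Proof.
have [alg [b [B [[d Bd] _ run]]]] := PT_steiner.
(* The running time satisfies (z + 1)^d <= 2^d z^d for z >= 1. The rounded logarithms give L + 1 <=
   3 log1 m and q + 1 <= 6 log1 |T|, and 10000 exceeds 2 * 256 * 18 = 9216. *)
exists alg, (2 ^ d + d), ((100 * 100)^-1)%R; split; first by rewrite invr_gt0; lra.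
move=> n e m Ts k se ie m0 _ T hk.
set M : bmx := [seq [seq e x y | y <- enum 'I_n] | x <- enum 'I_n].
set TL : bmx := [seq [seq x \in Ts i | x <- enum 'I_n] | i <- enum 'I_m].
pose N := n + n * n; pose K := connectivity N (node_mx n N M) TL.
pose L := trunc_log 2 m; pose q := trunc_log 2 #|T| + 3; pose r := K %/ L.+1 %/ (255 + 256 * q).+1.
set C := classes n N K (K %/ L.+1) q L r (node_mx n N M) TL.
have [sC conn disj] := @classes_correct n e m Ts se ie C erefl m0.
exists (size C), (fun i => class_subgraph e Ts (nth [::] C i)); split.
- have [k' [s' [ex [out _ le]]]] := run (init_store (enc_instance e Ts)) (M, TL) (esym (enc_instanceE e Ts)).
  exists k', s'; split=> //.
    by rewrite out enc_familyE -[in RHS]steinerE.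
  apply: leq_trans le _; apply: leq_trans (Bd _) _; rewrite /sz.
  rewrite enc_instanceE; move: (tree_size _) (tree_size_gt0 (enc_instance e Ts)) => z z0.
  apply: leq_trans (leq_addr _ _); apply: (@leq_trans ((2 * z) ^ d)).
    by case: (d) => // d'; rewrite leq_exp2r //; lia.
  rewrite expnMn; apply: leq_mul; first exact: leq_addr.
  by rewrite leq_pexp2l // leq_addl.
- by move=> i; apply: class_steiner => // i' a a' aT bT; exact: (conn i i' a a' (ltn_ord i) aT bT).
- by move=> i j ij; apply: class_disjoint => //; apply: disj.
have [kc kN] := kappa_kcut se ie m0 hk.
have kK : k <= K by have [_] := connectivityP e Ts; apply.
have := K_bound e Ts; rewrite -/T -/M -/TL -/N -/K -/L -/q -/r => Kb.
case: (posnP k) => [->|k0]; first by rewrite mulr0 mul0r ler0n.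
have K0 : 0 < K by apply: leq_trans k0 kK.
have rC : (if r == 0 then 1 else r.*2) <= 2 * size C.
  by rewrite sC -/N -/K -/T -/L -/q -/r (gtn_eqF K0); case: (r) => // r1; rewrite mul2n.
have kb : k <= 2 * size C * (L.+1 * (256 * q.+1)).
  apply: leq_trans kK _; apply: leq_trans (ltnW Kb) _; by rewrite leq_mul2r rC orbT.
have h1 := trunc_log_ln R m; have h2 := trunc_log_ln R #|T|.
have g1 := log1_ge1 R m; have g2 := log1_ge1 R #|T|.
have E : ((2 * size C * (L.+1 * (256 * q.+1)))%:R = 2 * (size C)%:R *
    (((trunc_log 2 m)%:R + 1) * (256 * ((trunc_log 2 #|T|)%:R + 3 + 1))) :> R)%R.
  by rewrite !natrM -[L.+1]addn1 -[q.+1]addn1 /q /L !natrD.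
move: kb; rewrite -(ler_nat R) E.
move: (log1 R m) (log1 R #|T|) h1 h2 g1 g2 => a t h1 h2 g1 g2 kb.
have at0 : (0 < t * a)%R by nra.
rewrite ler_pdivrMr // ler_pdivrMl; last by lra.
apply: le_trans kb _.
have hL : ((trunc_log 2 m)%:R + 1 <= 3 * a)%R by lra.
have hq : ((trunc_log 2 #|T|)%:R + 3 + 1 <= 6 * t)%R by lra.
have L0 : (0 <= (trunc_log 2 m)%:R + 1 :> R)%R by rewrite addr_ge0.
have q0 : (0 <= (trunc_log 2 #|T|)%:R + 3 + 1 :> R)%R by rewrite !addr_ge0.
have hLq : (((trunc_log 2 m)%:R + 1) * ((trunc_log 2 #|T|)%:R + 3 + 1) <= 18 * (t * a))%R.
  by apply: le_trans (ler_pM L0 q0 hL hq) _; lra.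
have s0 : (0 <= (size C)%:R :> R)%R by [].
have := ler_wpM2l s0 hLq; have := mulr_ge0 s0 (ltW at0); lra.
Qed.
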